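(* Let $\{X_n;n\ge1\}$ be an $m$-dependent stationary sequence of random variables in a sub-linear expectation space $(\Omega,\mathcal H,\widehat{\mathbb E})$ such that: (1) $\breve{\mathbb E}[X_1]=\breve{\mathcal E}[X_1]=0$; (2) $\breve{\mathbb E}[X_1^2]<\infty$; (3) $C_{\mathbb V}\left[\dfrac{X_1^2}{\log\log|X_1|}\right]<\infty$. Let $S_n=\sum_{i=1}^nX_i$. Then the limits $$\bar\sigma^2:=\lim_{n\to\infty}\frac{\breve{\mathbb E}[S_n^2]}{n},\qquad \underline\sigma^2:=\lim_{n\to\infty}\frac{\breve{\mathcal E}[S_n^2]}{n}$$ exist, $0\le\underline\sigma\le\bar\sigma<\infty$, and $$\widehat{\mathcal V}^*\left(\underline\sigma\le\limsup_{n\to\infty}\frac{S_n}{\sqrt{2n\log\log n}}\le\bar\sigma\right)=1.$$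
   Context: Setting. $(\Omega,\mathcal F)$ is a measurable space and $\mathcal H$ is a linear space of real measurable functions on $(\Omega,\mathcal F)$ such that $\varphi(X_1,\dots,X_n)\in\mathcal H$ whenever $X_1,\dots,X_n\in\mathcal H$ and $\varphi\in C_{l,Lip}(\mathbb R^n)$, where $C_{l,Lip}(\mathbb R^n)$ is the space of functions with $|\varphi(x)-\varphi(y)|\le C(1+|x|^k+|y|^k)|x-y|$ for some $C>0,k\in\mathbb N$ depending on $\varphi$. $C_{b,Lip}(\mathbb R^n)$ denotes bounded Lipschitz functions. A sub-linear expectation is a map $\widehat{\mathbb E}:\mathcal H\to[-\infty,\infty]$ which is monotone, preserves constants, is sub-additive ($\widehat{\mathbb E}[X+Y]\le\widehat{\mathbb E}[X]+\widehat{\mathbb E}[Y]$ whenever the right side is not $\infty-\infty$ or $-\infty+\infty$), and is positively homogeneous ($\widehat{\mathbb E}[\lambda X]=\lambda\widehat{\mathbb E}[X]$ for $\lambda\ge0$, with $0\cdot\infty=0$). $(\Omega,\mathcal H,\widehat{\mathbb E})$ is then a sub-linear expectation space; $\widehat{\mathcal E}[X]=-\widehat{\mathbb E}[-X]$. Truncated expectation. For $c>0$, $X^{(c)}=(-c)\vee X\wedge c$; $\breve{\mathbb E}[X]=\lim_{c\to\infty}\widehat{\mathbb E}[X^{(c)}]$ if the limit exists, and $\breve{\mathcal E}[X]=-\breve{\mathbb E}[-X]$. Distribution and dependence. Random vectors $\bm X_1,\bm X_2$ of the same dimension are identically distributed, $\bm X_1\overset{d}{=}\bm X_2$, if $\widehat{\mathbb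 E}[\varphi(\bm X_1)]=\widehat{\mathbb E}[\varphi(\bm X_2)]$ for all $\varphi\in C_{b,Lip}$. $\bm Y$ is independent to (of) $\bm X$ if $\widehat{\mathbb E}[\varphi(\bm X,\bm Y)]=\widehat{\mathbb E}\big[\widehat{\mathbb E}[\varphi(\bm x,\bm Y)]|_{\bm x=\bm X}\big]$ for all bounded Lipschitz $\varphi$. $\{X_n\}$ is $m$-dependent ($m$ a nonnegative integer) if for every $n$ and every $j\ge m+1$, $(X_{n+m+1},\dots,X_{n+j})$ is independent of $(X_1,\dots,X_n)$. $\{X_n\}$ is stationary if $(X_1,\dots,X_n)\overset{d}{=}(X_{1+p},\dots,X_{n+p})$ for all positive integers $n,p$. Capacities. $\mathbb V:\mathcal F\to[0,1]$ is a sub-additive capacity ($\mathbb V(A\cup B)\le\mathbb V(A)+\mathbb V(B)$) satisfying $\widehat{\mathbb E}[f]\le\mathbb V(A)\le\widehat{\mathbb E}[g]$ whenever $f\le I_A\le g$, $f,g\in\mathcal H$, $A\in\mathcal F$. The Choquet integral is $C_{\mathbb V}[X]=\int_0^\infty\mathbb V(X\ge t)\,dt+\int_{-\infty}^0[\mathbb V(X\ge t)-1]\,dt$ (its value for $X\in\mathcal H$ does not depend on the choice of such $\mathbb V$). $\widehat{\mathbb V}(A)=\inf\{\widehat{\mathbb E}[\xi]: I_A\le\xi,\ \xi\in\mathcal H\}$, $\widehat{\mathbb V}^*(A)=\inf\{\sum_{n=1}^\infty\widehat{\mathbb V}(A_n): A\subset\bigcup_{n=1}^\infty A_n,\ A_n\in\mathcal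 F\}$ and $\widehat{\mathcal V}^*(A)=1-\widehat{\mathbb V}^*(A^c)$ for $A\in\mathcal F$. Convention. $\log x=\ln\max(e,x)$. *)

(* Defs.v *)
From HB Require Import structures.
From mathcomp Require Import all_boot all_order all_algebra.
From mathcomp Require Import all_classical all_reals all_analysis.
From mathcomp Require Import lra.

Set Implicit Arguments.
Unset Strict Implicit.
Unset Printing Implicit Defensive.

Import Order.TTheory GRing.Theory Num.Theory.
Import numFieldNormedType.Exports.

Local Open Scope classical_set_scope.
Local Open Scope ring_scope.

(* The library norm of ['rV_n] is the max norm. *)
Definition enorm (R : realType) (n : nat) (x : 'rV[R]_n) : R :=
  Num.sqrt (\sum_(i < n) x 0 i ^+ 2).

Definition C_lLip (R : realType) (n : nat) (phi : 'rV[R]_n -> R) : Prop :=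
  exists (C : R) (k : nat), 0 < C /\
    forall x y, `|phi x - phi y|
      <= C * (1 + enorm x ^+ k + enorm y ^+ k) * enorm (x - y).

Definition C_bLip (R : realType) (n : nat) (phi : 'rV[R]_n -> R) : Prop :=
  (exists M : R, forall x, `|phi x| <= M) /\
  (exists L : R, forall x y, `|phi x - phi y| <= L * enorm (x - y)).

(* The random vector whose coordinates are X_0, ..., X_(n-1). *)
Definition rvec (R : realType) (T : Type) (n : nat) (X : 'I_n -> T -> R)
    (w : T) : 'rV[R]_n :=
  \row_(i < n) X i w.

(* (X_a, X_(a+1), ..., X_(a+k-1)) *)
Definition segment (R : realType) (T : Type) (X : nat -> T -> R) (a k : nat) :
    T -> 'rV[R]_k :=
  rvec (fun i : 'I_k => X (a + i)%N).

Record random_variable_space (R : realType) (d : measure_display)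
    (T : measurableType d) (H : set (T -> R)) : Prop := RandomVariableSpace {
  rvs_measurable : forall X, H X -> measurable_fun setT X;
  rvs_zero : H (fun=> 0);
  rvs_add : forall X Y, H X -> H Y -> H (fun w => X w + Y w);
  rvs_scale : forall (a : R) X, H X -> H (fun w => a * X w);
  rvs_lLip : forall (n : nat) (phi : 'rV[R]_n -> R) (X : 'I_n -> T -> R),
    C_lLip phi -> (forall i, H (X i)) -> H (fun w => phi (rvec X w))
}.

(* [E] is a total function, but only its values on [H] are meaningful. *)
Record sublinear_expectation (R : realType) (T : Type) (H : set (T -> R))
    (E : (T -> R) -> \bar R) : Prop := SublinearExpectation {
  sle_monotone : forall X Y, H X -> H Y -> (forall w, X w <= Y w) ->
    (E X <= E Y)%E;
  sle_cst : forall c : R, E (fun=> c) = c%:E;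
  sle_subadd : forall X Y, H X -> H Y -> (E X +? E Y)%E ->
    (E (fun w => X w + Y w)%R <= E X + E Y)%E;
  sle_homog : forall (a : R) X, 0 <= a -> H X ->
    E (fun w => a * X w) = (a%:E * E X)%E
}.

Definition trunc_rv (R : realType) (T : Type) (X : T -> R) (c : R) (w : T) : R :=
  Num.max (- c) (Num.min (X w) c).

(* [lim] has a junk value when the limit does not exist, hence the separate
   existence predicate. *)
Definition has_trunc_expect (R : realType) (T : Type)
    (E : (T -> R) -> \bar R) (X : T -> R) : Prop :=
  cvg (E (trunc_rv X c) @[c --> +oo]).

Definition trunc_expect (R : realType) (T : Type)
    (E : (T -> R) -> \bar R) (X : T -> R) : \bar R :=
  lim (E (trunc_rv X c) @[c --> +oo]).

Definition trunc_cexpect (R : realType) (T : Type)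
    (E : (T -> R) -> \bar R) (X : T -> R) : \bar R :=
  (- trunc_expect E (fun w => - X w)%R)%E.

Lemma trunc_rv_in (R : realType) (d : measure_display) (T : measurableType d)
    (H : set (T -> R)) (X : T -> R) (c : R) :
  random_variable_space H -> H X -> H (trunc_rv X c).
Proof.
move=> Hs HX.
pose phi (x : 'rV[R]_1) := Num.max (- c) (Num.min (x 0 0) c).
suff phiL : C_lLip phi.
  suff -> : trunc_rv X c = fun w => phi (rvec (fun=> X) w).
    by apply: (rvs_lLip Hs (X := fun=> X) phiL) => i; exact: HX.
  by apply/funext => w; rewrite /trunc_rv /phi /rvec mxE.
exists 1, 0%N; split => // x y.
rewrite /phi /enorm !expr0 big_ord1 !mxE sqrtr_sqr.
have := ler_norm (y 0 0 - x 0 0); rewrite distrC => yx.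
have xy := ler_norm (x 0 0 - y 0 0); rewrite ler_norml /Num.max /Num.min.
by apply/andP; split;
   case: (ltP (x 0 0) c) => ?; case: (ltP (y 0 0) c) => ?; do !case: ltP => ?; lra.
Qed.

(* So [trunc_expect] and [trunc_cexpect] of a square are never junk values. *)
Lemma ge0_has_trunc_expect (R : realType) (d : measure_display)
    (T : measurableType d) (H : set (T -> R)) (E : (T -> R) -> \bar R)
    (X : T -> R) :
  random_variable_space H -> sublinear_expectation H E -> H X ->
  (forall w, 0 <= X w) ->
  has_trunc_expect E X /\ has_trunc_expect E (fun w => - X w).
Proof.
move=> Hs Es HX X0.
have HN : H (fun w => - X w).
  suff -> : (fun w => - X w) = fun w => -1 * X w by exact: rvs_scale.
  by apply/funext => w; rewrite mulN1r.
have maxE (Y : T -> R) : \forall c \near +oo%R,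
    E (trunc_rv Y (Num.max 0 c)) = E (trunc_rv Y c).
  near=> c; rewrite (_ : Num.max 0 c = c)//; apply/max_idPr.
  by near: c; exact: nbhs_pinfty_ge.
have max0 (a : R) : 0 <= Num.max 0 a :> R by rewrite le_max lexx.
have maxM (a b : R) : a <= b -> Num.max 0 a <= Num.max 0 b :> R.
  by move=> ab; rewrite ge_max !le_max lexx ab orbT.
have truncE (p x : R) : 0 <= p -> 0 <= x ->
    Num.max (- p) (Num.min x p) = Num.min x p.
  move=> p0 x0; apply/max_idPr; rewrite le_min.
  by rewrite (le_trans _ x0) ?(le_trans _ p0) ?oppr_le0.
have truncNE (p x : R) : 0 <= p -> 0 <= x ->
    Num.max (- p) (Num.min (- x) p) = Num.max (- p) (- x).
  move=> p0 x0; congr Num.max; apply/min_idPl.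
  by rewrite (le_trans _ p0) ?oppr_le0.
split; apply/cvg_ex.
- have nd : {homo (fun c => E (trunc_rv X (Num.max 0 c)))
      : a b / a <= b >-> (a <= b)%E}.
    move=> a b ab; apply: (sle_monotone Es); [exact: trunc_rv_in..|move=> w].
    rewrite /trunc_rv !truncE// le_min !ge_min lexx maxM//.
    by rewrite orbT.
  eexists; apply: cvg_trans (nondecreasing_cvge nd).
  exact: near_eq_cvg (maxE X).
- have ni : {homo (fun c => E (trunc_rv (fun w => - X w) (Num.max 0 c)))
      : a b / a <= b >-> (b <= a)%E}.
    move=> a b ab; apply: (sle_monotone Es); [exact: trunc_rv_in..|move=> w].
    rewrite /trunc_rv !truncNE// ge_max !le_max lexx lerN2 maxM//.
    by rewrite orbT.
  eexists; apply: cvg_trans (nonincreasing_cvge ni).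
  exact: near_eq_cvg (maxE _).
Unshelve. all: by end_near.
Qed.

Definition identically_distributed (R : realType) (T : Type)
    (E : (T -> R) -> \bar R) (n : nat) (X1 X2 : T -> 'rV[R]_n) : Prop :=
  forall phi : 'rV[R]_n -> R, C_bLip phi ->
    E (fun w => phi (X1 w)) = E (fun w => phi (X2 w)).

(* [Y] is independent of [X]; the relation is not symmetric.  The inner
   expectation is finite because [phi] is bounded, so [fine] loses nothing. *)
Definition independent_of (R : realType) (T : Type)
    (E : (T -> R) -> \bar R) (q p : nat)
    (Y : T -> 'rV[R]_q) (X : T -> 'rV[R]_p) : Prop :=
  forall phi : 'rV[R]_(p + q) -> R, C_bLip phi ->
    E (fun w => phi (row_mx (X w) (Y w))) =
    E (fun w => fine (E (fun w' => phi (row_mx (X w) (Y w'))))).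

(* Sequences of random variables are indexed from 1; [X 0] is never used. *)
Definition m_dependent (R : realType) (T : Type) (E : (T -> R) -> \bar R)
    (m : nat) (X : nat -> T -> R) : Prop :=
  forall n j : nat, (1 <= n)%N -> (m + 1 <= j)%N ->
    independent_of E (segment X (n + m + 1) (j - m)) (segment X 1 n).

Definition stationary (R : realType) (T : Type) (E : (T -> R) -> \bar R)
    (X : nat -> T -> R) : Prop :=
  forall n p : nat, (1 <= n)%N -> (1 <= p)%N ->
    identically_distributed E (segment X 1 n) (segment X (1 + p) n).

Record subadditive_capacity (R : realType) (d : measure_display)
    (T : measurableType d) (V : set T -> R) : Prop := SubadditiveCapacity {
  cap_range : forall A, measurable A -> 0 <= V A <= 1;
  cap_set0 : V set0 = 0;
  cap_setT : V setT = 1;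
  cap_monotone : forall A B, measurable A -> measurable B ->
    A `<=` B -> V A <= V B;
  cap_subadd : forall A B, measurable A -> measurable B ->
    V (A `|` B) <= V A + V B
}.

Definition capacity_compatible (R : realType) (d : measure_display)
    (T : measurableType d) (H : set (T -> R)) (E : (T -> R) -> \bar R)
    (V : set T -> R) : Prop :=
  forall (f g : T -> R) (A : set T), H f -> H g -> measurable A ->
    (forall w, f w <= \1_A w) -> (forall w, \1_A w <= g w) ->
    (E f <= (V A)%:E)%E /\ ((V A)%:E <= E g)%E.

Definition choquet (R : realType) (T : Type) (V : set T -> R) (X : T -> R) :
    \bar R :=
  (\int[lebesgue_measure]_(t in `[0%R, +oo[) (V [set w | t <= X w]%R)%:E
   + \int[lebesgue_measure]_(t in `]-oo, 0%R]) (V [set w | t <= X w] - 1)%R%:E)%E.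

Definition hatV (R : realType) (T : Type) (H : set (T -> R))
    (E : (T -> R) -> \bar R) (A : set T) : \bar R :=
  ereal_inf [set E xi | xi in [set xi | H xi /\ forall w, \1_A w <= xi w]].

Definition hatVstar (R : realType) (d : measure_display)
    (T : measurableType d) (H : set (T -> R)) (E : (T -> R) -> \bar R)
    (A : set T) : \bar R :=
  ereal_inf [set (\sum_(n <oo) hatV H E (F n))%E | F in
    [set F : nat -> set T |
      (forall n, measurable (F n)) /\ A `<=` \bigcup_n F n]].

Definition hatcVstar (R : realType) (d : measure_display)
    (T : measurableType d) (H : set (T -> R)) (E : (T -> R) -> \bar R)
    (A : set T) : \bar R :=
  (1 - hatVstar H E (~` A))%E.

Definition logp (R : realType) (x : R) : R := ln (Num.max (expR 1) x).

Definition psum (R : realType) (T : Type) (X : nat -> T -> R) (n : nat) (w : T) :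
    R :=
  \sum_(1 <= i < n.+1) X i w.

Definition limsup_lil (R : realType) (T : Type) (X : nat -> T -> R) (w : T) :
    \bar R :=
  limn_esup (fun n : nat =>
    (psum X n w / Num.sqrt (2 * n%:R * logp (logp n%:R)))%:E).

(* Main.v *)
Require Import Defs.
From HB Require Import structures.
From mathcomp Require Import all_boot all_order all_algebra.
From mathcomp Require Import all_classical all_reals all_analysis.
From mathcomp Require Import measurable_realfun ring lra.
Import Order.TTheory GRing.Theory Num.Theory.
Import numFieldNormedType.Exports.
Local Open Scope classical_set_scope.
Local Open Scope ring_scope.

Set Implicit Arguments.
Unset Strict Implicit.
Unset Printing Implicit Defensive.

(** Capacities are not continuous here, so no limit theorem is available and
    every estimate is carried out for the expectation of a bounded Lipschitz
    function of finitely many variables.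

    For an independent sequence with second moment bound [s^2], the upper half
    follows from a maximal exponential inequality for the sums truncated from
    above at a small multiple of the fluctuation scale; the Choquet condition
    makes the error terms summable along [2^k], and Borel--Cantelli applies.
    For the lower half, a bump [exp (- q)] with [q] a Huber function, moved at
    speed [v] with [v^2 < 2 r^2], loses at most a factor [exp (- kap t)] under
    the conjugate expectation whenever [r^2] bounds the lower second moment
    from below.  Hence the increment over the [k]-th block of
    times [M^k .. M^(k+1)] is large with lower probability at least of order
    [1/k], and these probabilities multiply by independence.

    The m-dependent sequence is cut into long blocks of length [p] separated by
    short ones of length [g = m + 1].  The long blocks form an independent
    sequence, and so do the short ones.  Minkowski's inequality for both
    variances gives [u (N (p+g) + r) <= sqrt N (u p + C) + C'] for the upper and
    lower norms [u n] of the partial sums, whence [u n / sqrt n] converges; and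
    as [p] grows the short blocks become negligible on the scale of the law of
    the iterated logarithm. *)

(** * Exponential and logarithmic estimates *)

Section ExponentialBounds.
Context (R : realType).

(** They are chosen so that averaging over one new variable gives an inequality of the same shape,
    which can be iterated backwards along the sequence. The mean is zero only as a limit of
    truncations. A one-step bound at a fixed level is therefore proved with a second, auxiliary
    level that grows: the linear term then vanishes while the quadratic one stays bounded.

    In the lower half only the smallest admissible variance can be relied on. A block is rescaled to
    duration ln k, and moving the bump at speed v costs about v^2 / (2 r^2) per unit of time: the
    drift p v is split by the arithmetic-geometric inequality into this cost and the gain p^2 r^2 /
    2 that the lower second moment guarantees. Hence sqrt 2 times r is the critical speed, where the
    total cost reaches ln k and the harmonic series still diverges. *)

Lemma is_derive_ge0 (f df : R -> R) : f 0 = 0 ->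
  (forall x : R, is_derive x 1 f (df x)) -> (forall x, 0 <= x -> 0 <= df x) ->
  forall x, 0 <= x -> 0 <= f x.
Proof.
move=> f0 fdf df0 x; rewrite le_eqVlt => /predU1P[<-|x0]; first by rewrite f0.
have [|c] := @MVT R f df 0 x x0 (fun y _ => fdf y).
  apply: continuous_subspaceT => y.
  by apply: differentiable_continuous; apply/derivable1_diffP; exact: ex_derive.
rewrite in_itv/= => /andP[c0 cx]; rewrite f0 !subr0 => ->.
by rewrite mulr_ge0 ?df0 ?ltW.
Qed.

(** The derivative of the defect of such a Taylor bound is, up to a nonnegative term, the defect of
    the bound one order lower, so [is_derive_ge0] climbs from [expR_ge1Dx]. *)
Lemma expR_ge_quad (z : R) : 0 <= z -> 1 + z + z ^+ 2 / 2 <= expR z.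
Proof.
move=> z0; rewrite -subr_ge0.
have := @is_derive_ge0 (fun x => expR x - (1 + x + x ^+ 2 / 2))
  (fun x => expR x - (1 + x)).
apply=> // [|x|x x0].
    by rewrite ?oppr0 expR0; ring.
  apply: is_derive_eq; rewrite /GRing.scale/=; lra.
by rewrite subr_ge0 expR_ge1Dx.
Qed.

Lemma expRN_le_quad (z : R) : 0 <= z -> expR (- z) <= 1 - z + z ^+ 2 / 2.
Proof.
move=> z0; rewrite -subr_ge0.
have := @is_derive_ge0 (fun x => (1 - x + x ^+ 2 / 2) - expR (- x))
  (fun x => expR (- x) - (1 - x)).
apply=> // [|x|x x0].
    by rewrite ?oppr0 expR0; ring.
  apply: is_derive_eq; rewrite /GRing.scale/=; lra.
by rewrite subr_ge0 expR_ge1Dx.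
Qed.

Lemma expRN_ge_cubic (z : R) : 0 <= z ->
  1 - z + z ^+ 2 / 2 - z ^+ 3 / 6 <= expR (- z).
Proof.
move=> z0; rewrite -subr_ge0.
have := @is_derive_ge0 (fun x => expR (- x) - (1 - x + x ^+ 2 / 2 - x ^+ 3 / 6))
  (fun x => 1 - x + x ^+ 2 / 2 - expR (- x)).
apply=> // [|x|x x0].
    by rewrite ?oppr0 expR0; ring.
  apply: is_derive_eq; rewrite /GRing.scale/=; lra.
by rewrite subr_ge0 expRN_le_quad.
Qed.

Lemma expR_ge_cubic (z : R) :
  1 + z + z ^+ 2 / 2 - `|z| ^+ 3 / 6 <= expR z.
Proof.
have [z0|z0] := leP 0 z.
  by rewrite ger0_norm//; have := expR_ge_quad z0; have := exprn_ge0 3 z0; lra.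
have := @expRN_ge_cubic (- z); rewrite opprK sqrrN ltr0_norm//.
by rewrite oppr_ge0 => /(_ (ltW z0)); lra.
Qed.

(** The remainder keeps the factor [expR z], so that no upper bound on [z] is required; it becomes
    the factor [expR (l * y)] of [exp_rate]. *)
Lemma expR_le_cubic (z : R) : 0 <= z ->
  expR z <= 1 + z + z ^+ 2 / 2 + z ^+ 3 / 6 * expR z.
Proof.
have h1 (x : R) : expR x <= 1 + x * expR x.
  have := expR_ge1Dx (- x); have := expR_gt0 x => e0 h.
  have := ler_wpM2r (ltW e0) h; rewrite -expRD addNr expR0; lra.
have h2 (x : R) : 0 <= x -> expR x <= 1 + x + x ^+ 2 / 2 * expR x.
  move=> x0; rewrite -subr_ge0.
  have := @is_derive_ge0 (fun x => 1 + x + x ^+ 2 / 2 * expR x - expR x)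
    (fun x => 1 + x * expR x + x ^+ 2 / 2 * expR x - expR x).
  apply=> // [|y|y y0].
      by rewrite ?oppr0 expR0; ring.
    apply: is_derive_eq; rewrite /GRing.scale/=; lra.
  have := h1 y; have : 0 <= y ^+ 2 / 2 * expR y.
    by rewrite mulr_ge0 ?expR_ge0// divr_ge0 ?sqr_ge0.
  lra.
move=> z0; rewrite -subr_ge0.
have := @is_derive_ge0 (fun x => 1 + x + x ^+ 2 / 2 + x ^+ 3 / 6 * expR x - expR x)
  (fun x => 1 + x + x ^+ 2 / 2 * expR x + x ^+ 3 / 6 * expR x - expR x).
apply=> // [|x|x x0].
    by rewrite ?oppr0 expR0; ring.
  apply: is_derive_eq; rewrite /GRing.scale/=; lra.
have := h2 x x0; have : 0 <= x ^+ 3 / 6 * expR x.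
  by rewrite mulr_ge0 ?expR_ge0// divr_ge0 ?exprn_ge0.
lra.
Qed.

Lemma expRN_lip (x y : R) : 0 <= x -> 0 <= y ->
  `|expR (- x) - expR (- y)| <= `|x - y|.
Proof.
wlog xy : x y / x <= y.
  move=> h x0 y0; have [xy|/ltW yx] := leP x y; first exact: h.
  by rewrite distrC (distrC x); exact: h.
move=> x0 y0; rewrite ger0_norm; last by rewrite subr_ge0 ler_expR lerN2.
rewrite distrC ger0_norm ?subr_ge0//.
have -> : expR (- x) - expR (- y) = expR (- x) * (1 - expR (- (y - x))).
  rewrite mulrBr mulr1 -expRD; congr (_ - expR _); ring.
have := expR_ge1Dx (- (y - x)) => h.
rewrite (@le_trans _ _ (1 * (y - x)))//; last by rewrite mul1r.
apply: ler_pM; first exact: expR_ge0.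
- by rewrite subr_ge0 expR_le1 oppr_le0 subr_ge0.
- by rewrite expR_le1 oppr_le0.
- lra.
Qed.

End ExponentialBounds.

(** * Series with bounded partial sums *)

Section Summability.
Context (R : realType).
Implicit Types u v : nat -> R.

Definition bounded_sums u := exists M : R, forall N, \sum_(0 <= k < N) u k <= M.

Lemma bounded_sumsD u v : bounded_sums u -> bounded_sums v ->
  bounded_sums (fun k => u k + v k).
Proof.
move=> [M uM] [N vN]; exists (M + N) => n.
by rewrite big_split/= lerD.
Qed.

Lemma bounded_sumsZ (a : R) u : 0 <= a -> bounded_sums u ->
  bounded_sums (fun k => a * u k).
Proof. by move=> a0 [M uM]; exists (a * M) => n; rewrite -mulr_sumr ler_wpM2l. Qed.

Lemma bounded_sums_le u v : (forall k, u k <= v k) -> bounded_sums v ->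
  bounded_sums u.
Proof.
move=> uv [M vM]; exists M => N; rewrite (le_trans _ (vM N))//.
by apply: ler_sum => k _.
Qed.

Lemma bounded_sums_tail u (eps : R) : (forall k, 0 <= u k) -> bounded_sums u ->
  0 < eps -> exists K, forall N, \sum_(0 <= i < N) u (K + i)%N <= eps.
Proof.
move=> u0 [M uM] e0.
pose S : set R := range (fun N => \sum_(0 <= k < N) u k).
have hS : has_sup S by split; [exists 0, 0%N => //; rewrite big_geq|exists M => _ [N _ <-]].
have [_ [K _ <-] hK] := sup_adherent e0 hS.
exists K => N.
have : \sum_(0 <= k < K + N) u k <= sup S by apply: sup_ubound; [case: hS|exists (K + N)%N].
rewrite (big_cat_nat (n := K)) ?leq_addr//=.
rewrite -{2}[K]add0n big_addn addKn.
under [X in _ + X <= _ -> _]eq_bigr do rewrite addnC.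
by lra.
Qed.

(** Summing the recursion leaves 1 - r times the sum of [u] on the left, against [u 0] plus the sum
    of [v]. *)
Lemma bounded_sums_contract u v (r : R) : 0 <= r -> r < 1 ->
  (forall k, u k.+1 <= r * u k + v k) -> (forall k, 0 <= u k) ->
  bounded_sums v -> bounded_sums u.
Proof.
move=> r0 r1 uv u0 [M vM]; exists ((u 0%N + M) / (1 - r)) => N.
have r10 : 0 < 1 - r by rewrite subr_gt0.
rewrite ler_pdivlMr//.
have : \sum_(0 <= k < N.+1) u k <= u 0%N + (r * \sum_(0 <= k < N) u k + M).
  rewrite big_nat_recl//= lerD2l.
  apply: (@le_trans _ _ (\sum_(0 <= k < N) (r * u k + v k))).
    by apply: ler_sum => k _.
  by rewrite big_split/= -mulr_sumr lerD2l.
rewrite big_nat_recr//=.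
have : 0 <= u N by [].
lra.
Qed.

(** This plays log log n for n of the order of 2^k or M^k; the shift by 3, which exceeds e, keeps it
    at least 1 from k = 0 on. *)
Definition lnk (k : nat) : R := ln k.+3%:R.

Lemma expR1_le3 : expR 1 <= 3 :> R.
Proof. by have := @expR_le_cubic R 1 ler01; rewrite !expr1n; lra. Qed.

Lemma lnk_ge1 k : 1 <= lnk k.
Proof.
rewrite /lnk -[leLHS](expRK 1) ler_ln ?posrE ?expR_gt0//.
by rewrite (le_trans expR1_le3)// ler_nat.
Qed.

Lemma lnk_gt0 k : 0 < lnk k.
Proof. exact: lt_le_trans ltr01 (lnk_ge1 k). Qed.

Lemma lnk_ge0 k : 0 <= lnk k.
Proof. exact: ltW (lnk_gt0 k). Qed.

Lemma lnk_leS k : lnk k <= lnk k.+1.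
Proof. by rewrite /lnk ler_ln ?posrE// ler_nat. Qed.

Lemma expR_lnk k : expR (lnk k) = k.+3%:R.
Proof. by rewrite lnK// posrE. Qed.

(** The terms are (k + 3)^-(1 + eta). As in the integral test, each is at most the decrement of (k +
    2)^-eta / eta, so the sum telescopes. *)
Lemma bounded_sums_lnk (eta : R) : 0 < eta ->
  bounded_sums (fun k => expR (- ((1 + eta) * lnk k))).
Proof.
move=> e0; pose f (k : nat) : R := expR (- (eta * ln k.+2%:R)).
exists (eta^-1 * f 0%N) => N.
suff h : forall n,
    \sum_(0 <= k < n) expR (- ((1 + eta) * lnk k)) <= eta^-1 * (f 0%N - f n).
  by rewrite (le_trans (h N))// ler_wpM2l ?invr_ge0 ?(ltW e0)// gerBl expR_ge0.
elim=> [|{}N IH]; first by rewrite big_geq// subrr mulr0.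
rewrite big_nat_recr//=.
suff : expR (- ((1 + eta) * lnk N)) <= eta^-1 * (f N - f N.+1).
  by move: IH; rewrite !mulrBr; lra.
rewrite ler_pdivlMl// /f -/(lnk N).
pose de : R := lnk N - ln N.+2%:R.
have -> : - (eta * ln N.+2%:R) = - (eta * lnk N) + eta * de by rewrite /de; ring.
have -> : - ((1 + eta) * lnk N) = - (eta * lnk N) + - lnk N by ring.
rewrite !expRD (_ : expR (- lnk N) = N.+3%:R^-1); last by rewrite expRN expR_lnk.
rewrite -[X in _ - X]mulr1 -mulrBr mulrCA ler_wpM2l ?expR_ge0//.
have de1 : N.+3%:R^-1 <= de.
  have h : ln (N.+2%:R / N.+3%:R) <= - N.+3%:R^-1 :> R.
    rewrite -[leRHS]expRK ler_ln ?posrE ?expR_gt0 ?divr_gt0//.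
    rewrite (le_trans _ (expR_ge1Dx _))//.
    rewrite (_ : N.+2%:R = N.+3%:R - 1 :> R); last by rewrite -(natr1 N.+2) addrK.
    by rewrite mulrBl divff ?pnatr_eq0// mul1r.
  move: h; rewrite ln_div ?posrE// /de /lnk.
  by move: (ln _) (ln _) (_^-1) => p q r; lra.
by rewrite lerBrDl (le_trans _ (expR_ge1Dx _))// lerD2l ler_wpM2l// ltW.
Qed.

End Summability.

(** * The iterated logarithm compared with [lnk] along geometric times *)

Section IteratedLogarithm.
Context (R : realType).

Definition lil (n : nat) : R := Num.sqrt (2 * n%:R * logp (logp n%:R)).

Lemma logp_ge1 (x : R) : 1 <= logp x.
Proof.
rewrite /logp -[leLHS](expRK 1) ler_ln ?posrE ?expR_gt0 ?le_max ?lexx//.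
by rewrite lt_max expR_gt0.
Qed.

Lemma le_logp (x y : R) : x <= y -> logp x <= logp y.
Proof.
move=> xy; rewrite /logp ler_ln ?posrE ?lt_max ?expR_gt0//.
by rewrite ge_max !le_max lexx xy orbT.
Qed.

Lemma ln_le_logp (x : R) : 0 < x -> ln x <= logp x.
Proof.
by move=> x0; rewrite /logp ler_ln ?posrE ?lt_max ?expR_gt0// le_max lexx orbT.
Qed.

Lemma logp_le_max (x y : R) : 0 < y -> x <= y -> logp x <= Num.max 1 (ln y).
Proof.
move=> y0 xy; rewrite /logp; have [ex|xe] := leP (expR 1) x.
  by rewrite le_max ler_ln ?posrE// ?xy ?orbT// (lt_le_trans (expR_gt0 1)).
by rewrite expRK le_max lexx.
Qed.

Lemma lil_ge0 n : 0 <= lil n.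
Proof. exact: sqrtr_ge0. Qed.

Lemma lil_sqr n : lil n ^+ 2 = 2 * n%:R * logp (logp n%:R).
Proof.
rewrite sqr_sqrtr// mulr_ge0 ?mulr_ge0//.
exact: le_trans (logp_ge1 _).
Qed.

Lemma lil_gt0 n : (0 < n)%N -> 0 < lil n.
Proof.
move=> n0; rewrite sqrtr_gt0 mulr_gt0 ?mulr_gt0 ?ltr0n//.
exact: lt_le_trans (logp_ge1 _).
Qed.

Lemma ln2_ge : 1 / 2 <= ln 2 :> R.
Proof.
rewrite -[leLHS]expRK ler_ln ?posrE ?expR_gt0//.
rewrite -(@ler_pXn2r _ 2) ?nnegrE ?expR_ge0//.
rewrite -expRM_natl; have -> : 2 * (1 / 2) = 1 :> R by field.
have := expR1_le3 R; lra.
Qed.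

Lemma natr_ge (x : R) : exists K : nat, forall k, (K <= k)%N -> x <= k%:R.
Proof.
exists (Num.truncn x).+1 => k Kk; apply: (@le_trans _ _ (Num.truncn x).+1%:R).
  by rewrite ltW// truncnS_gt.
by rewrite ler_nat.
Qed.

Lemma lnk_le_loglog (de : R) : 0 < de -> exists K, forall k n : nat,
  (K <= k)%N -> (2 ^ k <= n)%N -> lnk R k <= (1 + de) * logp (logp n%:R).
Proof.
(* As ln 2 >= 1/2, ln n >= k/2, while k + 3 <= 8 (k/2) once k >= 1; the summand ln 8 is absorbed by
   de ln (k/2) from [K] on. *)
move=> d0; have [K hK] := natr_ge (Num.max 1 (2 * expR (ln 8 / de))).
exists K => k n /hK; rewrite ge_max => /andP[k1 ke] kn.
have k0 : 0 < k%:R :> R by rewrite (lt_le_trans _ k1).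
have h1 : ln (k%:R / 2) <= logp (logp n%:R) :> R.
  apply: (le_trans (ln_le_logp _)); first by rewrite divr_gt0.
  apply: le_logp; apply: (@le_trans _ _ (ln n%:R)); last first.
    by apply: ln_le_logp; rewrite ltr0n (leq_trans _ kn)// expn_gt0.
  apply: (@le_trans _ _ (ln (2 ^+ k))).
    rewrite lnXn// -[leRHS]mulr_natl ler_wpM2l//; have := ln2_ge; lra.
  rewrite ler_ln ?posrE ?exprn_gt0// -?natrX ?ler_nat// ltr0n.
  by rewrite (leq_trans _ kn)// expn_gt0.
have h2 : ln 8 <= de * ln (k%:R / 2) :> R.
  rewrite -ler_pdivrMl// mulrC -[leLHS]expRK ler_ln ?posrE ?expR_gt0 ?divr_gt0//.
  by rewrite ler_pdivlMr//; lra.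
have h3 : lnk R k <= ln 8 + ln (k%:R / 2).
  rewrite -lnM ?posrE ?divr_gt0// /lnk ler_ln ?posrE ?mulr_gt0 ?divr_gt0//.
  rewrite -[k.+3]addn3 natrD; lra.
have : (1 + de) * ln (k%:R / 2) <= (1 + de) * logp (logp n%:R).
  by rewrite ler_wpM2l//; lra.
lra.
Qed.

Lemma loglog_le_lnk (de C M : R) : 0 < de -> 1 <= C -> 1 <= M ->
  exists K, forall k n : nat, (K <= k)%N -> n%:R <= C * M ^+ k ->
    logp (logp n%:R) <= (1 + de) * lnk R k.
Proof.
(* For n <= C M^k the logarithm of n is at most A (k + 3), and ln A is at most de [lnk k] once k
   exceeds A^(1/de). *)
move=> d0 C1 M1; pose A : R := 1 + ln C + ln M.
have lC : 0 <= ln C by exact: ln_ge0.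
have lM : 0 <= ln M by exact: ln_ge0.
have A0 : 0 < A by rewrite /A; lra.
have [K hK] := natr_ge (expR (ln A / de)).
exists K => k n /hK ke nk.
have CM0 : 0 < C * M ^+ k.
  by rewrite mulr_gt0 ?exprn_gt0// (lt_le_trans ltr01).
have h1 : logp n%:R <= A * k.+3%:R.
  rewrite (le_trans (logp_le_max CM0 nk))// ge_max; apply/andP; split.
    apply: (@le_trans _ _ A); first by rewrite /A; lra.
    by rewrite ler_peMr ?ler1n// (ltW A0).
  rewrite lnM ?posrE ?exprn_gt0 ?(lt_le_trans ltr01 M1) ?(lt_le_trans ltr01 C1)// lnXn ?(lt_le_trans ltr01 M1)//.
  have : ln M * k%:R <= ln M * k.+3%:R by rewrite ler_wpM2l// ler_nat !leqW.
  have : ln C * 1 <= ln C * k.+3%:R by rewrite ler_wpM2l// ler1n.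
  have : 1 <= k.+3%:R :> R by rewrite ler1n.
  rewrite /A -[ln M *+ k]mulr_natr; move: (k.+3%:R) (k%:R) => p q; lra.
have Ak0 : 0 < A * k.+3%:R by rewrite mulr_gt0.
rewrite (le_trans (logp_le_max Ak0 h1))// ge_max; apply/andP; split.
  have := lnk_ge1 R k; have := mulr_ge0 (ltW d0) (lnk_ge0 R k); lra.
rewrite lnM ?posrE// -/(lnk R k) mulrDl mul1r addrC lerD2l.
rewrite -ler_pdivrMl// mulrC -[leLHS]expRK /lnk ler_ln ?posrE ?expR_gt0//.
by rewrite (le_trans ke)// ler_nat leqW// leqW.
Qed.

End IteratedLogarithm.

(** * The bump function of the lower bound *)

Section Huber.
Context (R : realType).

(** The projection of [- y] onto [0, B]; [huber_arg_var] is its variational inequality. *)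
Definition huber_arg (B y : R) : R := Num.min (Num.max 0 (- y)) B.

(** For a > 0, the supremum over t in [0, B] of a (- t y - t^2/2), attained at [huber_arg]: zero for
    y >= 0, then a y^2/2, then linear of slope - a B. Comparing maximizers gives monotonicity,
    Lipschitz and curvature bounds without derivatives. *)
Definition huber (a B y : R) : R :=
  a * (huber_arg B y * - y - huber_arg B y ^+ 2 / 2).

Definition bump (a B y : R) : R := expR (- huber a B y).

Context (a B : R).
Hypotheses (a0 : 0 < a) (B0 : 0 <= B).

Lemma huber_arg_ge0 y : 0 <= huber_arg B y.
Proof. by rewrite le_min le_max lexx B0. Qed.

Lemma huber_arg_le y : huber_arg B y <= B.
Proof. by rewrite ge_min lexx orbT. Qed.

Lemma huber_arg_var t y : 0 <= t -> t <= B ->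
  (t - huber_arg B y) * (- y - huber_arg B y) <= 0.
Proof.
move=> t0 tB; rewrite /huber_arg /Num.min /Num.max.
case: (ltP 0 (- y)) => y0; case: ltP => yB.
- by rewrite subrr mulr0.
- by rewrite mulr_le0_ge0 ?subr_le0 ?subr_ge0.
- by rewrite subr0 mulr_ge0_le0 ?subr0//; lra.
- by have -> : t - B = 0; [lra|rewrite mul0r].
Qed.

Lemma huber_ge t y : 0 <= t -> t <= B -> a * (t * - y - t ^+ 2 / 2) <= huber a B y.
Proof.
move=> t0 tB; rewrite /huber ler_wpM2l ?(ltW a0)//.
have := huber_arg_var y t0 tB; set u := huber_arg B y.
by have := sqr_ge0 (t - u); rewrite !expr2; lra.
Qed.

Lemma huber_ge0 y : 0 <= huber a B y.
Proof. by have := @huber_ge 0 y (lexx _) B0; rewrite expr0n/=; lra. Qed.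

Lemma huber0 : huber a B 0 = 0.
Proof.
rewrite /huber (_ : huber_arg B 0 = 0); first by rewrite expr0n/=; ring.
by rewrite /huber_arg oppr0 maxxx min_l.
Qed.

(** The curvature is at most [a]: the difference of the two sides is a completed square minus the
    product in the variational inequality, taken at the new maximizer. *)
Lemma huber_quad y xi : huber a B (y + xi) <=
  huber a B y - a * huber_arg B y * xi + a / 2 * xi ^+ 2.
Proof.
rewrite {1 2}/huber; set t' := huber_arg B (y + xi).
have := huber_arg_var y (huber_arg_ge0 (y + xi)) (huber_arg_le (y + xi)).
rewrite -/t'; set t := huber_arg B y => h.
rewrite -subr_ge0.
have -> : a * (t * - y - t ^+ 2 / 2) - a * t * xi + a / 2 * xi ^+ 2 -
    a * (t' * - (y + xi) - t' ^+ 2 / 2) =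
    a * ((t' - t + xi) ^+ 2 / 2 - (t' - t) * (- y - t)) by field.
by rewrite mulr_ge0 ?(ltW a0)//; have := sqr_ge0 (t' - t + xi); lra.
Qed.

Lemma huber_noninc y y' : y <= y' -> huber a B y' <= huber a B y.
Proof.
move=> yy; rewrite (le_trans _ (huber_ge y (huber_arg_ge0 y') (huber_arg_le y')))//.
rewrite ler_wpM2l ?(ltW a0)// lerD2r ler_wpM2l ?huber_arg_ge0//.
by rewrite lerN2.
Qed.

Lemma huber_lip y y' : y <= y' -> huber a B y - huber a B y' <= a * B * (y' - y).
Proof.
move=> yy; have h := huber_ge y' (huber_arg_ge0 y) (huber_arg_le y).
have : a * huber_arg B y * (y' - y) <= a * B * (y' - y).
  by rewrite ler_wpM2r ?subr_ge0// ler_wpM2l ?(ltW a0)// huber_arg_le.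
by move: h; rewrite {2}/huber; lra.
Qed.

Lemma bump_gt0 y : 0 < bump a B y. Proof. exact: expR_gt0. Qed.

Lemma bump_le1 y : bump a B y <= 1.
Proof. by rewrite expR_le1 oppr_le0 huber_ge0. Qed.

Lemma bump0 : bump a B 0 = 1.
Proof. by rewrite /bump huber0 oppr0 expR0. Qed.

Lemma bump_nondec y y' : y <= y' -> bump a B y <= bump a B y'.
Proof. by move=> yy; rewrite ler_expR lerN2 huber_noninc. Qed.

Lemma bump_dist y y' : `|bump a B y - bump a B y'| <= a * B * `|y - y'|.
Proof.
rewrite (le_trans (expRN_lip (huber_ge0 _) (huber_ge0 _)))//.
have [yy|/ltW yy] := leP y y'.
  rewrite ger0_norm ?subr_ge0 ?huber_noninc// distrC ger0_norm ?subr_ge0//.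
  exact: huber_lip.
rewrite distrC ger0_norm ?subr_ge0 ?huber_noninc// ger0_norm ?subr_ge0//.
exact: huber_lip.
Qed.

Lemma bump_ge y xi : bump a B y *
  expR (a * huber_arg B y * xi - a / 2 * xi ^+ 2) <= bump a B (y + xi).
Proof. by rewrite /bump -expRD ler_expR; have := huber_quad y xi; lra. Qed.

Lemma bump_le_exp y : bump a B y <= expR (a * B * y + a * B ^+ 2 / 2).
Proof. by rewrite ler_expR; have := huber_ge y B0 (lexx B); lra. Qed.

End Huber.

(** The gain p^2/2 is kept only on min(|y|, b)^2, which a bounded test function can measure. For |y|
    <= Q the cubic Taylor bound applies, and for small si the extra loss eta si^2 y^2 absorbs its
    error; for larger |y| the same loss outweighs the whole gain. *)
Lemma expR_ge_quad_trunc (R : realType) (a eta L b : R) :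
  0 < a -> 0 < eta -> 0 <= L -> 0 < b ->
  exists2 si0 : R, 0 < si0 & forall si, 0 < si -> si <= si0 ->
    forall p y, 0 <= p -> p <= L ->
    1 + p * si * y - (a + eta) * si ^+ 2 * y ^+ 2 +
      p ^+ 2 / 2 * si ^+ 2 * Num.min `|y| b ^+ 2 <=
    expR (p * si * y - a * si ^+ 2 * y ^+ 2).
Proof.
move=> a0 e0 L0 b0.
(* Chosen so that eta Q^2 >= L^2 b^2 / 2, which is [QE]. *)
pose Q := b * (1 + L ^+ 2 / eta).
have L2 : 0 <= L ^+ 2 / eta by rewrite divr_ge0 ?sqr_ge0 ?(ltW e0).
have bQ : b <= Q by rewrite ler_peMr ?(ltW b0)// lerDl.
have Q0 : 0 < Q by exact: lt_le_trans bQ.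
have QE : L ^+ 2 / 2 * b ^+ 2 <= eta * Q ^+ 2.
  have e : L ^+ 2 = eta * (L ^+ 2 / eta) by field; rewrite gt_eqF.
  rewrite /Q {1}e; move: (L ^+ 2 / eta) L2 => z z0.
  rewrite (_ : eta * z / 2 * b ^+ 2 = eta * b ^+ 2 * (z / 2)); last by ring.
  rewrite [leRHS](_ : _ = eta * b ^+ 2 * (1 + z) ^+ 2); last by ring.
  apply: ler_wpM2l; first exact: mulr_ge0 (ltW e0) (sqr_ge0 b).
  by have := sqr_ge0 z; rewrite !expr2; lra.
pose C := L + a * Q.
have C0 : 0 < C by rewrite ltr_wpDl// mulr_gt0.
(* With m = si |y|, the cross term of z^2 / 2 and the cubic remainder together are at most m^2 si D;
   hence the requirement si D <= eta. *)
pose D := L * a * Q + C ^+ 3 * Q / 6.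
have D0 : 0 <= D.
  apply: addr_ge0; first by rewrite mulr_ge0 ?(ltW Q0)// mulr_ge0 ?(ltW a0).
  by rewrite divr_ge0// mulr_ge0 ?(ltW Q0)// exprn_ge0// ltW.
exists (Num.min 1 (eta / (D + 1))).
  by rewrite lt_min ltr01 divr_gt0// ltr_wpDl.
move=> si si0; rewrite le_min => /andP[si1 siD] p y p0 pL.
have sin := ltW si0.
have siD' : si * D <= eta.
  move: siD; rewrite ler_pdivlMr ?ltr_wpDl//; have := mulr_ge0 sin D0; lra.
have [yQ|Qy] := leP `|y| Q; last first.
  rewrite min_r; last by rewrite (le_trans bQ)// ltW.
  rewrite (le_trans _ (expR_ge1Dx _))//.
  have h1 : p ^+ 2 / 2 * b ^+ 2 <= eta * y ^+ 2.
    apply: (@le_trans _ _ (L ^+ 2 / 2 * b ^+ 2)).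
      by rewrite ler_wpM2r ?sqr_ge0// ler_wpM2r// lerXn2r ?nnegrE.
    rewrite (le_trans QE)// ler_wpM2l ?(ltW e0)// -[leRHS]real_normK ?num_real//.
    by rewrite lerXn2r ?nnegrE ?(ltW Q0)// ltW.
  have := ler_wpM2l (sqr_ge0 si) h1; lra.
pose m := si * `|y|.
have m0 : 0 <= m by rewrite mulr_ge0.
set z := p * si * y - a * si ^+ 2 * y ^+ 2.
have y2 : y ^+ 2 = `|y| ^+ 2 by rewrite real_normK ?num_real.
have zm : `|z| <= m * C.
  rewrite /z (_ : _ - _ = si * y * (p - a * si * y)); last by ring.
  rewrite !normrM (ger0_norm sin) -/m ler_wpM2l// (le_trans (ler_normB _ _))//.
  rewrite (ger0_norm p0) lerD// !normrM (gtr0_norm a0) (ger0_norm sin).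
  by rewrite -mulrA ler_wpM2l ?(ltW a0)// (le_trans _ yQ)// ler_piMl.
have z3 : `|z| ^+ 3 <= m ^+ 2 * (si * (C ^+ 3 * Q)).
  apply: (@le_trans _ _ ((m * C) ^+ 3)).
    by rewrite lerXn2r ?nnegrE ?mulr_ge0 ?(ltW C0).
  have -> : (m * C) ^+ 3 = m ^+ 2 * (m * C ^+ 3) by ring.
  rewrite ler_wpM2l ?sqr_ge0// /m -mulrA ler_wpM2l// mulrC ler_wpM2l//.
  by rewrite exprn_ge0 ?(ltW C0).
have z2 : m ^+ 2 * p ^+ 2 - m ^+ 2 * (2 * (si * (L * a * Q))) <= z ^+ 2.
  have -> : z ^+ 2 = m ^+ 2 * (p - a * si * y) ^+ 2.
    by rewrite /z /m exprMn -y2; ring.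
  rewrite -mulrBr ler_wpM2l ?sqr_ge0//.
  have : p * (a * si * y) <= L * (a * si * Q).
    apply: (@le_trans _ _ (p * (a * si * Q))).
      rewrite ler_wpM2l// ler_wpM2l ?mulr_ge0 ?(ltW a0)//.
      by rewrite (le_trans (ler_norm _)).
    by rewrite ler_wpM2r// mulr_ge0 ?(ltW Q0)// mulr_ge0// ltW.
  have := sqr_ge0 (a * si * y); rewrite !expr2; lra.
have mn : p ^+ 2 / 2 * si ^+ 2 * Num.min `|y| b ^+ 2 <= m ^+ 2 * p ^+ 2 / 2.
  rewrite /m exprMn [leRHS](_ : _ = p ^+ 2 / 2 * si ^+ 2 * `|y| ^+ 2); last by ring.
  rewrite ler_wpM2l ?mulr_ge0 ?sqr_ge0 ?invr_ge0// lerXn2r ?nnegrE//.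
    by rewrite le_min normr_ge0 ltW.
  by rewrite ge_min lexx.
have := expR_ge_cubic z.
have hm : m ^+ 2 * (si * D) <= m ^+ 2 * eta by rewrite ler_wpM2l ?sqr_ge0.
have -> : (a + eta) * si ^+ 2 * y ^+ 2 = a * si ^+ 2 * y ^+ 2 + m ^+ 2 * eta.
  by rewrite /m exprMn -y2; ring.
have zE : z = p * si * y - a * si ^+ 2 * y ^+ 2 by [].
move: hm z2 z3 mn; rewrite /D; clearbody z m C.
move: (Num.min _ _ ^+ 2) (C ^+ 3) (`|z| ^+ 3) => c1 c2 c3; lra.
Qed.

(** Turns the one-step factor 1 + si^2 g of the bump estimate into an exponential, at a cost of
    second order. *)
Lemma expR_sub_sqr_le (R : realType) (x : R) : `|x| <= 1 / 4 ->
  expR (x - x ^+ 2) <= 1 + x.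
Proof.
rewrite ler_norml => /andP[x1 x2]; have [x0|x0] := leP 0 x.
  have h := expR_ge1Dx (- (x - x ^+ 2)).
  rewrite expRN in h.
  have e0 := expR_gt0 (x - x ^+ 2).
  have h' : (1 + - (x - x ^+ 2)) * expR (x - x ^+ 2) <= 1.
    by rewrite -[leRHS](mulVf (lt0r_neq0 e0)) ler_wpM2r ?(ltW e0).
  have h3 : 0 <= x ^+ 3 by exact: exprn_ge0.
  have h4 : expR (x - x ^+ 2) * ((1 + x) * (1 - (x - x ^+ 2))) <= 1 + x.
    have x10 : 0 <= 1 + x by lra.
    have := ler_wpM2l x10 h'; rewrite mulr1; lra.
  apply: le_trans h4; rewrite ler_peMr ?(ltW e0)//.
  have -> : (1 + x) * (1 - (x - x ^+ 2)) = 1 + x ^+ 3 by ring.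
  by rewrite lerDl.
have u0 : 0 <= - (x - x ^+ 2) by have := sqr_ge0 x; lra.
have := expRN_le_quad u0; rewrite opprK => /le_trans; apply.
have : x ^+ 2 * (- (1/2) - x + x ^+ 2 / 2) <= 0.
  have x16 : x ^+ 2 <= 1 / 16 by rewrite expr2; nra.
  by rewrite mulr_ge0_le0 ?sqr_ge0//; lra.
have -> : (- (x - x ^+ 2)) ^+ 2 = x ^+ 2 - 2 * x * x ^+ 2 + x ^+ 2 * x ^+ 2 by ring.
lra.
Qed.

(** * Scaling of [lil], and sequences of square-root growth *)

Section Scaling.
Context (R : realType).

Lemma lil_mono (n n' : nat) : (n <= n')%N -> lil R n <= lil R n'.
Proof.
move=> nn; apply: ler_wsqrtr; apply: ler_pM.
- by rewrite mulr_ge0.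
- exact: le_trans (logp_ge1 _).
- by rewrite ler_wpM2l// ler_nat.
- by apply: le_logp; apply: le_logp; rewrite ler_nat.
Qed.

Lemma lil_div (N q n : nat) : (0 < q)%N -> (N * q <= n)%N ->
  Num.sqrt q%:R * lil R N <= lil R n.
Proof.
move=> q0 Nqn; rewrite -sqrtrM//; apply: ler_wsqrtr.
rewrite mulrA; apply: ler_pM.
- by rewrite !mulr_ge0.
- exact: le_trans (logp_ge1 _).
- by rewrite mulrCA ler_wpM2l// -natrM ler_nat mulnC.
- apply: le_logp; apply: le_logp; rewrite ler_nat.
  by rewrite (leq_trans _ Nqn)// leq_pmulr.
Qed.

(** Both log log (N q) and log log N are within a factor 1 + de of [lnk] at the dyadic index of N,
    and (1 - de)(1 + de) <= 1 absorbs the two factors after the root is taken. *)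
Lemma lil_ratio (de : R) (q : nat) : 0 < de -> de < 1 -> (0 < q)%N ->
  exists K, forall N, (K <= N)%N ->
    (1 - de) * lil R (N * q) <= Num.sqrt q%:R * lil R N.
Proof.
move=> d0 d1 q0; have q1 : 1 <= 2 * q%:R :> R.
  by rewrite -natrM ler1n muln_gt0.
have [K1 hK1] := @loglog_le_lnk R de (2 * q%:R) 2 d0 q1 (ler1n R 2).
have [K2 hK2] := @lnk_le_loglog R de d0.
exists (2 ^ maxn K1 K2)%N => N KN.
have N0 : (0 < N)%N by rewrite (leq_trans _ KN)// expn_gt0.
pose k := trunc_log 2 N.
have /andP[k1 k2] := @trunc_log_bounds 2 N isT N0; rewrite -/k in k1 k2.
have Kk : (maxn K1 K2 <= k)%N.
  by rewrite -ltnS -(@ltn_exp2l 2)// (leq_ltn_trans KN).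
have l1 : logp (logp (N * q)%:R) <= (1 + de) * lnk R k.
  apply: hK1; first by rewrite (leq_trans _ Kk)// leq_maxl.
  rewrite -natrX -natrM -natrM ler_nat mulnC (mulnC 2) -mulnA leq_mul2l.
  by rewrite -expnS (ltnW k2) orbT.
have l2 : lnk R k <= (1 + de) * logp (logp N%:R).
  by apply: hK2 => //; rewrite (leq_trans _ Kk)// leq_maxr.
rewrite -[1 - de]ger0_norm; last lra.
rewrite -sqrtr_sqr -!sqrtrM ?sqr_ge0//; apply: ler_wsqrtr.
have L0 : 0 <= logp (logp N%:R) :> R by exact: le_trans (logp_ge1 _).
have h : (1 - de) ^+ 2 * logp (logp (N * q)%:R) <= logp (logp N%:R).
  apply: (@le_trans _ _ ((1 - de) ^+ 2 * ((1 + de) * ((1 + de) * logp (logp N%:R))))).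
    by rewrite ler_wpM2l ?sqr_ge0// (le_trans l1)// ler_wpM2l//; lra.
  rewrite [leLHS](_ : _ = (1 - de ^+ 2) ^+ 2 * logp (logp N%:R)); last by ring.
  rewrite ler_piMl// exprn_ile1//.
    by rewrite subr_ge0 exprn_ile1 ?ltW.
  by rewrite gerBl sqr_ge0.
have Nq0 : 0 <= 2 * (N%:R * q%:R) :> R by rewrite !mulr_ge0.
have := ler_wpM2l Nq0 h; rewrite natrM.
by move: (logp _) (logp _) => u v; lra.
Qed.

(** Fekete's argument for square-root growth: the limit is the infimum of (u p + C1) / sqrt (p + g).
    The infimum bounds u n from below up to [C1]; dividing n by p + g for a nearly optimal p bounds
    it from above. *)
Lemma sqrt_growth_cvg (u : nat -> R) (C1 : R) (g p0 : nat) :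
  (forall n, 0 <= u n) -> 0 <= C1 -> (0 < p0)%N ->
  (forall p, (p0 <= p)%N -> exists2 C', 0 <= C' & forall N rho, (rho < p + g)%N ->
    u (N * (p + g) + rho)%N <= Num.sqrt N%:R * (u p + C1) + C') ->
  exists2 sigma : R, 0 <= sigma &
    u n / Num.sqrt n%:R @[n --> \oo] --> sigma.
Proof.
move=> u0 C10 p00 hu.
pose S : set R := [set x | exists2 p, (p0 <= p)%N & x = (u p + C1) / Num.sqrt (p + g)%:R].
have S0 : lbound S 0.
  by move=> _ [p _ ->]; rewrite divr_ge0 ?sqrtr_ge0 ?addr_ge0.
have Sinf : has_inf S by split; [exists ((u p0 + C1) / Num.sqrt (p0 + g)%:R), p0|exists 0].
pose L := inf S; have L0 : 0 <= L by apply: lb_le_inf => //; case: Sinf.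
exists L => //.
apply/cvgrPdist_le => eps e0.
have e2 : 0 < eps / 2 by rewrite divr_gt0.
have [_ [p p0p ->] hp] := inf_adherent e2 Sinf.
have [C' C'0 hC'] := hu _ p0p.
have q0 : (0 < p + g)%N by rewrite addn_gt0 (leq_trans p00 p0p).
have [K hK] := natr_ge (((C' + C1) * (2 / eps)) ^+ 2).
exists (maxn (maxn p0 1) K) => // n /=; rewrite !geq_max -andbA => /and3P[p0n n1 Kn].
have sn0 : 0 < Num.sqrt n%:R :> R by rewrite sqrtr_gt0 ltr0n.
have small : (C' + C1) * (2 / eps) <= Num.sqrt n%:R.
  have h0 : 0 <= (C' + C1) * (2 / eps) by rewrite mulr_ge0 ?addr_ge0 ?divr_ge0 ?(ltW e0).
  rewrite -[leLHS]ger0_norm// -sqrtr_sqr; apply: ler_wsqrtr.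
  exact: hK.
have small' : C' + C1 <= eps / 2 * Num.sqrt n%:R.
  move: small; rewrite mulrA ler_pdivrMr//; lra.
rewrite distrC ler_norml; apply/andP; split.
- have : L <= (u n + C1) / Num.sqrt (n + g)%:R by apply: ge_inf; [exists 0|exists n].
  rewrite ler_pdivlMr ?sqrtr_gt0 ?ltr0n ?addn_gt0 ?n1// => h.
  have h2 : L * Num.sqrt n%:R <= L * Num.sqrt (n + g)%:R.
    by rewrite ler_wpM2l// ler_wsqrtr// ler_nat leq_addr.
  rewrite lerBrDr ler_pdivlMr// mulrDl mulNr.
  have : 0 <= eps / 2 * Num.sqrt n%:R by rewrite mulr_ge0 ?ltW.
  lra.
- rewrite lerBlDr ler_pdivrMr// [in leLHS](divn_eq n (p + g)).
  rewrite (le_trans (hC' _ _ (ltn_pmod _ q0)))//.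
  have h1 : u p + C1 <= (L + eps / 2) * Num.sqrt (p + g)%:R.
    by rewrite -ler_pdivrMr ?sqrtr_gt0 ?ltr0n// ltW.
  have h2 : Num.sqrt (n %/ (p + g))%:R * Num.sqrt (p + g)%:R <= Num.sqrt n%:R :> R.
    by rewrite -sqrtrM// ler_wsqrtr// -natrM ler_nat leq_trunc_div.
  have h3 : Num.sqrt (n %/ (p + g))%:R * (u p + C1) <=
      Num.sqrt (n %/ (p + g))%:R * ((L + eps / 2) * Num.sqrt (p + g)%:R).
    by rewrite ler_wpM2l.
  have Le : 0 <= L + eps / 2 by rewrite addr_ge0// ltW.
  have := ler_wpM2l Le h2; lra.
Qed.

End Scaling.

(** * Choquet integrals and limits superior *)

Section ChoquetTail.
Context (R : realType).

(** The intervals [c 2^k / 2, c 2^k[ abut without overlap, and on each of them [G] is at least its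
    value at the right end. *)
Lemma bounded_sums_dyadic (G : R -> R) (c : R) : (forall t, 0 <= G t) ->
  nonincreasing_fun G ->
  (\int[lebesgue_measure]_(t in `[0%R, +oo[) (G t)%:E < +oo)%E -> 0 < c ->
  bounded_sums (fun k => 2 ^+ k * G (c * 2 ^+ k)).
Proof.
move=> G0 Gni Gint c0.
have mG (D : set (measurableTypeR R)) : measurable D ->
    measurable_fun D (fun t => (G t)%:E).
  by move=> mD; apply/measurable_EFinP; exact: (@nonincreasing_measurable R).
have cE k : c / 2 * 2 ^+ k.+1 = c * 2 ^+ k :> R by rewrite exprS; field.
have c2 k : 0 <= c / 2 * 2 ^+ k by rewrite mulr_ge0 ?exprn_ge0// divr_ge0// ltW.
have cS k : c / 2 * 2 ^+ k <= c * 2 ^+ k.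
  by rewrite ler_wpM2r ?exprn_ge0//; lra.
have step k : ((c / 2 * (2 ^+ k * G (c * 2 ^+ k)))%:E <=
    \int[lebesgue_measure]_(t in `[(c / 2 * 2 ^+ k)%R, (c * 2 ^+ k)%R[%classic) (G t)%:E)%E.
  have mI : measurable (`[c / 2 * 2 ^+ k, c * 2 ^+ k[%classic : set (measurableTypeR R)).
    exact: measurable_itv.
  apply: (@le_trans _ _ (\int[lebesgue_measure]_(t in `[(c / 2 * 2 ^+ k)%R, (c * 2 ^+ k)%R[%classic)
     cst (G (c * 2 ^+ k)%R)%:E t)%E).
    rewrite integral_cst// [X in (_ * X)%E]lebesgue_measure_itv/= lte_fin.
    have -> : c / 2 * 2 ^+ k < c * 2 ^+ k by rewrite ltr_pM2r ?exprn_gt0//; lra.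
    rewrite -EFinB -EFinM lee_fin le_eqVlt; apply/orP; left; apply/eqP; by field.
  apply: (ge0_le_integral lebesgue_measure mI _ _ (mG _ mI)).
  - by move=> t _; rewrite lee_fin.
  - by apply: measurable_cst.
  - by move=> t /=; rewrite in_itv/= => /andP[_ h]; rewrite lee_fin Gni// ltW.
have sums N : ((c / 2 * \sum_(0 <= k < N) (2 ^+ k * G (c * 2 ^+ k)))%:E <=
    \int[lebesgue_measure]_(t in `[0%R, (c / 2 * 2 ^+ N)%R[%classic) (G t)%:E)%E.
  elim: N => [|N IH].
    by rewrite big_geq// mulr0; apply: integral_ge0 => t _; rewrite lee_fin.
  have -> : `[0%R, (c / 2 * 2 ^+ N.+1)%R[%classic =
      `[0%R, (c / 2 * 2 ^+ N)%R[%classic `|` `[(c / 2 * 2 ^+ N)%R, (c * 2 ^+ N)%R[%classic.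
    rewrite cE; apply/seteqP; split=> t /=; rewrite !in_itv/=.
      by case/andP=> t0 t1; case: (ltP t (c / 2 * 2 ^+ N)) => h; [left|right]; apply/andP.
    case=> /andP[h1 h2]; apply/andP; split => //.
      exact: lt_le_trans h2 (cS N).
    exact: le_trans (c2 N) h1.
  rewrite ge0_integral_setU//.
  - by rewrite big_nat_recr//= mulrDr EFinD; apply: leeD.
  - by apply: mG; apply: measurableU; exact: measurable_itv.
  - by move=> t _; rewrite lee_fin.
  - rewrite disj_set2E; apply/eqP; apply/seteqP; split => t //=.
    by rewrite !in_itv/= => -[/andP[_ h1] /andP[h2 _]]; move: h1; rewrite ltNge h2.
exists (fine (\int[lebesgue_measure]_(t in `[0%R, +oo[) (G t)%:E) / (c / 2)) => N.
rewrite ler_pdivlMr ?divr_gt0// mulrC -lee_fin fineK.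
  apply: (le_trans (sums N)); apply: ge0_subset_integral => //.
  - by apply: mG; exact: measurable_itv.
  - by move=> t _; rewrite lee_fin.
  - by move=> t /=; rewrite !in_itv/= andbT => /andP[].
by rewrite ge0_fin_numE// integral_ge0// => t _; rewrite lee_fin.
Qed.

Lemma logp_le (x : R) : 1 <= x -> logp x <= x.
Proof.
move=> x1; have x0 : 0 < x by rewrite (lt_le_trans ltr01).
rewrite (le_trans (logp_le_max x0 (lexx x)))// ge_max x1.
exact: ltW (ln_sublinear x0).
Qed.

(** Inverts x^2 / log log |x| up to a constant: if |x| <= exp (k + 3), the denominator is at most
    [lnk k]; otherwise |x| exceeds both 2^k and log log |x|. *)
Lemma sq_div_loglog_ge (c x : R) (k : nat) : 0 < c ->
  c * (2 ^+ k * lnk R k) <= x ^+ 2 ->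
  Num.min c 1 * 2 ^+ k <= x ^+ 2 / logp (logp `|x|).
Proof.
move=> c0 cx; have L0 : 0 < logp (logp `|x|) by rewrite (lt_le_trans _ (logp_ge1 _)).
have m0 : 0 <= Num.min c 1 by rewrite le_min ler01 (ltW c0).
have p0 : 0 <= 2 ^+ k :> R by rewrite exprn_ge0.
rewrite ler_pdivlMr//; have [xk|kx] := leP `|x| (expR k.+3%:R).
  have LL : logp (logp `|x|) <= lnk R k.
    have h : logp `|x| <= k.+3%:R.
      rewrite (le_trans (logp_le_max (expR_gt0 _) xk))// ge_max expRK lexx andbT.
      by rewrite ler1n.
    rewrite (le_trans (logp_le_max _ h))// ge_max lnk_ge1/=.
    exact: lexx.
  apply: le_trans cx; rewrite -mulrA; apply: ler_pM => //.
  - by rewrite mulr_ge0// (ltW L0).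
  - by rewrite ge_min lexx.
  - by rewrite ler_wpM2l.
have e2 : 2 ^+ k <= `|x|.
  rewrite (le_trans _ (ltW kx))// (@le_trans _ _ (expR k%:R))//; last first.
    by rewrite ler_expR ler_nat !leqW.
  rewrite -[k%:R]mulr1 expRM_natl lerXn2r ?nnegrE ?expR_ge0//.
  by have := expR_ge1Dx (1 : R); lra.
have x1 : 1 <= `|x| by rewrite (le_trans _ e2)// exprn_ege1// ler1n.
have Lx : logp (logp `|x|) <= `|x|.
  by rewrite (le_trans (logp_le (logp_ge1 _)))// logp_le.
rewrite -[leRHS]real_normK ?num_real// expr2 -mulrA.
apply: (@le_trans _ _ (1 * (2 ^+ k * logp (logp `|x|)))).
  by rewrite ler_wpM2r ?mulr_ge0 ?(ltW L0)// ge_min lexx orbT.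
by rewrite mul1r; apply: ler_pM => //; rewrite ltW.
Qed.

Lemma measurable_div_loglog (d : measure_display) (T : measurableType d)
  (f : T -> R) : measurable_fun setT f ->
  measurable_fun setT (fun w => f w ^+ 2 / logp (logp `|f w|)).
Proof.
move=> mf; apply: measurable_funM; first exact: measurable_funX.
have -> : (fun w => (logp (logp `|f w|))^-1) =
    (fun x : R => (logp (logp x))^-1) \o (@Num.norm _ R \o f) by [].
apply: measurableT_comp; last by apply: measurableT_comp.
apply: nonincreasing_measurable => // x y xy.
rewrite lef_pV2 ?posrE ?(lt_le_trans ltr01 (logp_ge1 _))//.
by do 2 apply: le_logp.
Qed.

End ChoquetTail.

Section LimitSuperior.
Context (R : realType) (T : Type).
Implicit Types (X : nat -> T -> R) (w : T) (sigma : R).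

Lemma limsup_lilE X w : limsup_lil X w =
  ereal_inf (range (esups (fun n => (psum X n w / lil R n)%:E))).
Proof. by rewrite /limsup_lil limn_esup_lim; apply/cvg_lim => //; exact: cvg_esups_inf. Qed.

Lemma limsup_lil_le X w sigma :
  (forall eps, 0 < eps -> exists N0, forall n, (N0 <= n)%N ->
    psum X n w <= (sigma + eps) * lil R n) ->
  (limsup_lil X w <= sigma%:E)%E.
Proof.
move=> h; rewrite limsup_lilE; apply/lee_addgt0Pr => eps e0.
have [N0 hN0] := h _ e0.
apply: (@le_trans _ _ (esups (fun n => (psum X n w / lil R n)%:E) N0.+1)).
  by apply: ereal_inf_lbound; exists N0.+1.
apply: ge_ereal_sup => _ [n /= Nn <-]; rewrite -EFinD lee_fin.
have n0 : (0 < n)%N by exact: leq_trans Nn.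
by rewrite ler_pdivrMr ?lil_gt0// hN0// ltnW.
Qed.

Lemma limsup_lil_ge X w sigma :
  (forall eps, 0 < eps -> ~ exists N0, forall n, (N0 <= n)%N ->
    psum X n w <= (sigma - eps) * lil R n) ->
  (sigma%:E <= limsup_lil X w)%E.
Proof.
move=> h; rewrite limsup_lilE; apply: le_ereal_inf_tmp => _ [N _ <-].
apply/lee_addgt0Pr => eps e0; rewrite -leeBlDr//.
have [n [Nn hn]] : exists n, (N.+1 <= n)%N /\ (sigma - eps) * lil R n < psum X n w.
  apply: contrapT => hN; apply: (h _ e0); exists N.+1 => n Nn.
  by rewrite leNgt; apply/negP => hn; apply: hN; exists n.
apply: (@le_trans _ _ (psum X n w / lil R n)%:E).
  rewrite -EFinB lee_fin ler_pdivlMr ?(ltW hn)// lil_gt0//.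
  exact: leq_trans Nn.
by apply: ereal_sup_ubound; exists n => //=; rewrite ltnW.
Qed.

End LimitSuperior.

(** * Lipschitz functionals and sub-linear expectations *)

Section Vectors.
Context (R : realType).

Lemma coord_le_enorm (n : nat) (x : 'rV[R]_n) (i : 'I_n) :
  `|x 0 i| <= enorm x.
Proof.
rewrite /enorm -sqrtr_sqr; apply: ler_wsqrtr.
by rewrite (bigD1 i)//= lerDl sumr_ge0// => j _; exact: sqr_ge0.
Qed.

Lemma enorm_ge0 (n : nat) (x : 'rV[R]_n) : 0 <= enorm x.
Proof. exact: sqrtr_ge0. Qed.

Lemma enorm_le_sum (n : nat) (x : 'rV[R]_n) :
  enorm x <= \sum_(i < n) `|x 0 i|.
Proof.
set S := \sum_(i < n) _.
have S0 : 0 <= S by apply: sumr_ge0.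
rewrite -(ger0_norm S0) -sqrtr_sqr; apply: ler_wsqrtr.
rewrite expr2 {1}/S mulr_suml; apply: ler_sum => i _.
rewrite -normr_id -real_normK ?num_real// expr2 normr_id ler_wpM2l//.
by rewrite /S (bigD1 i)//= lerDl sumr_ge0.
Qed.

Lemma sum_le_enorm (n : nat) (x : 'rV[R]_n) :
  \sum_(i < n) `|x 0 i| <= n%:R * enorm x.
Proof.
rewrite (le_trans (ler_sum _ (fun i _ => coord_le_enorm x i)))//.
by rewrite sumr_const card_ord mulr_natl.
Qed.

Lemma enorm_lsubmx (p q : nat) (z : 'rV[R]_(p + q)) :
  enorm (lsubmx z) <= enorm z.
Proof.
apply: ler_wsqrtr; rewrite [leRHS]big_split_ord/=.
under eq_bigr do rewrite mxE.
by rewrite lerDl sumr_ge0// => j _; exact: sqr_ge0.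
Qed.

End Vectors.

Section LipschitzFunctions.
Context (R : realType) (T : Type).
Implicit Types (f g : T -> R) (Z : nat -> T -> R).

Definition bounded_fct f := exists M : R, forall w, `|f w| <= M.

(* On a nonempty [T] these are exactly the Lipschitz functions of the vector
   (Z_0, ..., Z_(n-1)), by McShane's extension theorem. *)
Definition lip_in Z (n : nat) f :=
  exists C : R, 0 <= C /\ forall w w', `|f w - f w'| <= C * \sum_(i < n) `|Z i w - Z i w'|.

Definition lip (k : R -> R) :=
  exists C : R, 0 <= C /\ forall x y, `|k x - k y| <= C * `|x - y|.

Lemma bounded_fctD f g : bounded_fct f -> bounded_fct g ->
  bounded_fct (fun w => f w + g w).
Proof.
move=> [M fM] [N gN]; exists (M + N) => w.
by rewrite (le_trans (ler_normD _ _))// lerD.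
Qed.

Lemma bounded_fctM f g : bounded_fct f -> bounded_fct g ->
  bounded_fct (fun w => f w * g w).
Proof.
by move=> [M fM] [N gN]; exists (M * N) => w; rewrite normrM ler_pM.
Qed.

Lemma bounded_fct_cst (c : R) : bounded_fct (fun=> c).
Proof. by exists `|c|. Qed.

Lemma bounded_fct_comp (k : R -> R) f :
  (exists M, forall x, `|k x| <= M) -> bounded_fct (fun w => k (f w)).
Proof. by move=> [M kM]; exists M. Qed.

Lemma lip_in_cst Z n (c : R) : lip_in Z n (fun=> c).
Proof. by exists 0; split => // w w'; rewrite subrr normr0 mul0r. Qed.

Lemma lip_inD Z n f g : lip_in Z n f -> lip_in Z n g ->
  lip_in Z n (fun w => f w + g w).
Proof.
move=> [C [C0 fC]] [D [D0 gD]]; exists (C + D); split; first exact: addr_ge0.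
move=> w w'; rewrite opprD addrACA (le_trans (ler_normD _ _))// mulrDl.
exact: lerD.
Qed.

Lemma lip_inM Z n f g : bounded_fct f -> bounded_fct g ->
  lip_in Z n f -> lip_in Z n g -> lip_in Z n (fun w => f w * g w).
Proof.
move=> [M fM] [N gN] [C [C0 fC]] [D [D0 gD]].
have [w0|Te] := pselect (exists w : T, True); last first.
  by exists 0; split => // w; exfalso; apply: Te; exists w.
have M0 : 0 <= M by case: w0 => w _; exact: le_trans (fM w).
have N0 : 0 <= N by case: w0 => w _; exact: le_trans (gN w).
exists (C * N + M * D); split; first by rewrite addr_ge0 ?mulr_ge0.
move=> w w'; have -> : f w * g w - f w' * g w' =
  (f w - f w') * g w + f w' * (g w - g w') by ring.
rewrite (le_trans (ler_normD _ _))// !normrM mulrDl.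
apply: lerD; last by rewrite -mulrA ler_pM.
by rewrite mulrAC ler_pM.
Qed.

Lemma lip_in_comp Z n (k : R -> R) f : lip k -> lip_in Z n f ->
  lip_in Z n (fun w => k (f w)).
Proof.
move=> [C [C0 kC]] [D [D0 fD]]; exists (C * D); split; first exact: mulr_ge0.
by move=> w w'; rewrite (le_trans (kC _ _))// -mulrA ler_wpM2l.
Qed.

Lemma lip_in_coord Z n i : (i < n)%N -> lip_in Z n (Z i).
Proof.
move=> lt_in; exists 1; split => // w w'; rewrite mul1r.
by rewrite (bigD1 (Ordinal lt_in))//= lerDl sumr_ge0.
Qed.

Lemma lip_in_widen Z n n' f : (n <= n')%N -> lip_in Z n f -> lip_in Z n' f.
Proof.
move=> nn' [C [C0 fC]]; exists C; split => // w w'.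
rewrite (le_trans (fC _ _))// ler_wpM2l//.
rewrite (big_ord_widen n' (fun i => `|Z i w - Z i w'|))// big_mkcond/=.
by apply: ler_sum => i _; case: ifP.
Qed.

Lemma lip_in_sum Z n (I : Type) (r : seq I) (P : pred I) (F : I -> T -> R) :
  (forall i, P i -> lip_in Z n (F i)) ->
  lip_in Z n (fun w => \sum_(i <- r | P i) F i w).
Proof.
move=> PF; elim: r => [|i r IH].
  by under eq_fun do rewrite big_nil; exact: lip_in_cst.
under eq_fun do rewrite big_cons.
by case Pi: (P i) => //; apply: lip_inD => //; exact: PF.
Qed.

Lemma lip_in_mcshane Z n f : lip_in Z n f ->
  exists phi : 'rV[R]_n -> R,
    (exists L, forall x y, `|phi x - phi y| <= L * enorm (x - y)) /\ forall w, phi (segment Z 0 n w) = f w.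
Proof.
move=> [C [C0 fC]]; have [[w0 _]|Te] := pselect (exists w : T, True); last first.
  exists (fun=> 0); split; last by move=> w; exfalso; apply: Te; exists w.
  by exists 0 => x y; rewrite subrr normr0 mul0r.
(* The extension is the infimum over w of f w plus C times the l1 distance from x to the vector at
   w. *)
pose D (x : 'rV[R]_n) w := f w + C * \sum_(i < n) `|x 0 i - Z i w|.
have Dlip x y w : D x w <= D y w + C * \sum_(i < n) `|(x - y) 0 i|.
  rewrite /D -addrA lerD2l -mulrDr ler_wpM2l// -big_split/=.
  by apply: ler_sum => i _; rewrite !mxE addrC ler_distD.
have D0 (x : 'rV[R]_n) w : f w0 - C * \sum_(i < n) `|x 0 i - Z i w0| <= D x w.
  have := fC w0 w; rewrite ler_norml => /andP[_].
  suff : C * \sum_(i < n) `|Z i w0 - Z i w| <=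
    C * \sum_(i < n) `|x 0 i - Z i w0| + C * \sum_(i < n) `|x 0 i - Z i w|.
    by rewrite /D; lra.
  rewrite -mulrDr ler_wpM2l// -big_split/=; apply: ler_sum => i _.
  by rewrite (distrC (x 0 i) (Z i w0)) ler_distD.
have hlb (x : 'rV[R]_n) : has_lbound (range (D x)).
  by exists (f w0 - C * \sum_(i < n) `|x 0 i - Z i w0|) => _ [w _ <-].
have hne x : range (D x) !=set0 by exists (D x w0); exists w0.
have half x y : inf (range (D x)) - inf (range (D y)) <= C * n%:R * enorm (x - y).
  rewrite lerBlDr -lerBlDl; apply: lb_le_inf => // _ [w _ <-].
  rewrite lerBlDl; apply: (le_trans (y := D x w)).
    by apply: ge_inf => //; exists w.
  rewrite addrC (le_trans (Dlip x y w))// lerD2l -mulrA ler_wpM2l//.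
  exact: sum_le_enorm.
exists (fun x => inf (range (D x))); split.
  exists (C * n%:R) => x y; rewrite ler_norml half andbT.
  rewrite lerNl opprB (_ : enorm (x - y) = enorm (y - x)) ?half//.
  by rewrite /enorm; congr Num.sqrt; apply: eq_bigr => i _; rewrite !mxE -sqrrN opprB.
move=> w; apply/eqP; rewrite eq_le; apply/andP; split.
  apply: (le_trans (y := D (segment Z 0 n w) w)).
    by apply: ge_inf => //; exists w.
  by rewrite /D big1 ?mulr0 ?addr0// => i _; rewrite mxE add0n subrr normr0.
apply: lb_le_inf => // _ [w' _ <-]; rewrite /D.
have := fC w w'; rewrite ler_norml => /andP[_].
under [X in _ -> _ <= _ + _ * X]eq_bigr do rewrite mxE add0n.
lra.
Qed.

End LipschitzFunctions.

(** * The expectation as a real functional on bounded random variables *)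

Section RealExpectation.
Context (R : realType) (d : measure_display) (T : measurableType d).
Variables (H : set (T -> R)) (E : (T -> R) -> \bar R).
Hypotheses (Hs : random_variable_space H) (Es : sublinear_expectation H E).
Implicit Types (f g : T -> R).

Definition bdd_rv f := H f /\ bounded_fct f.

Lemma rv_lip_in (Z : nat -> T -> R) n f :
  (forall i, (i < n)%N -> H (Z i)) -> lip_in Z n f -> H f.
Proof.
move=> HZ /lip_in_mcshane[phi [[L phiL] phif]].
rewrite (_ : f = fun w => phi (rvec (fun i : 'I_n => Z i) w)); last first.
  by apply/funext => w; rewrite -phif; congr (phi _).
apply: (rvs_lLip Hs); last by move=> i; exact: HZ.
exists (`|L| + 1), 0%N; split; first by rewrite ltr_wpDl.
move=> x y; rewrite (le_trans (phiL x y))// ler_wpM2r ?enorm_ge0//.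
by rewrite !expr0; have := ler_norm L; have := normr_ge0 L; lra.
Qed.

Lemma rv_cst (c : R) : H (fun=> c).
Proof. by apply: (@rv_lip_in (fun _ _ => 0) 0) => //; exact: lip_in_cst. Qed.

Lemma rv_comp (k : R -> R) f : lip k -> H f -> H (fun w => k (f w)).
Proof.
move=> kl Hf; apply: (@rv_lip_in (fun _ => f) 1) => //.
by apply: (@lip_in_comp _ _ (fun _ => f)) => //; exact: (@lip_in_coord _ _ (fun _ => f) _ 0).
Qed.

Lemma rvN f : H f -> H (fun w => - f w).
Proof.
move=> Hf; rewrite (_ : (fun w => - f w) = fun w => -1 * f w).
  exact: rvs_scale.
by apply/funext => w; rewrite mulN1r.
Qed.

Lemma rv_sum (I : Type) (r : seq I) (P : pred I) (F : I -> T -> R) :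
  (forall i, P i -> H (F i)) -> H (fun w => \sum_(i <- r | P i) F i w).
Proof.
move=> PF; elim: r => [|i r IH].
  by under eq_fun do rewrite big_nil; exact: rv_cst.
under eq_fun do rewrite big_cons.
by case Pi: (P i) => //; apply: (rvs_add Hs) => //; exact: PF.
Qed.

Lemma bdd_rv_cst (c : R) : bdd_rv (fun=> c).
Proof. by split; [exact: rv_cst|exact: bounded_fct_cst]. Qed.

Lemma bdd_rvD f g : bdd_rv f -> bdd_rv g -> bdd_rv (fun w => f w + g w).
Proof.
by move=> [? ?] [? ?]; split; [exact: (rvs_add Hs)|exact: bounded_fctD].
Qed.

Lemma bdd_rvZ (a : R) f : bdd_rv f -> bdd_rv (fun w => a * f w).
Proof.
move=> [? ?]; split; first exact: rvs_scale.
by apply: bounded_fctM => //; exact: bounded_fct_cst.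
Qed.

Lemma bdd_rvN f : bdd_rv f -> bdd_rv (fun w => - f w).
Proof.
move=> [? [M fM]]; split; first exact: rvN.
by exists M => w; rewrite normrN.
Qed.

Lemma bdd_rv_sum (I : Type) (r : seq I) (P : pred I) (F : I -> T -> R) :
  (forall i, P i -> bdd_rv (F i)) ->
  bdd_rv (fun w => \sum_(i <- r | P i) F i w).
Proof.
move=> PF; elim: r => [|i r IH].
  by under eq_fun do rewrite big_nil; exact: bdd_rv_cst.
under eq_fun do rewrite big_cons.
by case Pi: (P i) => //; apply: bdd_rvD => //; exact: PF.
Qed.

Lemma bdd_rv_comp (k : R -> R) f : lip k -> (exists M, forall x, `|k x| <= M) ->
  H f -> bdd_rv (fun w => k (f w)).
Proof. by move=> kl kb Hf; split; [exact: rv_comp|exact: bounded_fct_comp]. Qed.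

(** On [bdd_rv] nothing is lost by [fine], as [expectE] shows; the estimates below stay in that
    class. *)
Definition expect f : R := fine (E f).

Lemma expectE f : bdd_rv f -> E f = (expect f)%:E.
Proof.
move=> [Hf [M fM]]; rewrite /expect fineK//.
have Ml : (E (fun=> (- M)%R) <= E f)%E.
  apply: (sle_monotone Es) => //; first exact: rv_cst.
  by move=> w; have := fM w; rewrite ler_norml => /andP[].
have Mu : (E f <= E (fun=> M))%E.
  apply: (sle_monotone Es) => //; first exact: rv_cst.
  by move=> w; have := fM w; rewrite ler_norml => /andP[].
move: Ml Mu; rewrite !(sle_cst Es) => Ml Mu.
by apply/fin_real; rewrite (lt_le_trans (ltNyr (- M)) Ml) (le_lt_trans Mu (ltry M)).
Qed.

Lemma expect_cst (c : R) : expect (fun=> c) = c.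
Proof. by rewrite /expect (sle_cst Es). Qed.

Lemma expect_le f g : bdd_rv f -> bdd_rv g -> (forall w, f w <= g w) ->
  expect f <= expect g.
Proof.
move=> hf hg fg; rewrite -lee_fin -!expectE//.
by apply: (sle_monotone Es) => //; [case: hf|case: hg].
Qed.

Lemma expectD_le f g : bdd_rv f -> bdd_rv g ->
  expect (fun w => f w + g w) <= expect f + expect g.
Proof.
move=> hf hg; rewrite -lee_fin EFinD -!expectE//; last exact: bdd_rvD.
apply: (sle_subadd Es); [by case: hf|by case: hg|].
by rewrite !expectE.
Qed.

Lemma expectZ (a : R) f : 0 <= a -> bdd_rv f ->
  expect (fun w => a * f w) = a * expect f.
Proof.
move=> a0 hf; apply: EFin_inj; rewrite EFinM -!expectE//; last exact: bdd_rvZ.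
by apply: (sle_homog Es) => //; case: hf.
Qed.

(** Constants pass through exactly, unlike general summands: sub-additivity is applied once with c
    and once with - c. *)
Lemma expectDc f (c : R) : bdd_rv f ->
  expect (fun w => f w + c) = expect f + c.
Proof.
move=> hf; apply/eqP; rewrite eq_le; apply/andP; split.
  by rewrite -[leRHS](congr1 (+%R _) (expect_cst c)) expectD_le//; exact: bdd_rv_cst.
rewrite -lerBrDr -[- c](expect_cst (- c)) (le_trans _ (expectD_le _ _))//.
- by under [X in _ <= expect X]eq_fun do rewrite addrK.
- by apply: bdd_rvD => //; exact: bdd_rv_cst.
- exact: bdd_rv_cst.
Qed.

Lemma expect_sum_le (I : Type) (r : seq I) (P : pred I) (F : I -> T -> R) :
  (forall i, P i -> bdd_rv (F i)) ->
  expect (fun w => \sum_(i <- r | P i) F i w) <=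
  \sum_(i <- r | P i) expect (F i).
Proof.
move=> PF; elim: r => [|i r IH].
  by under eq_fun do rewrite big_nil; rewrite expect_cst big_nil.
under eq_fun do rewrite big_cons; rewrite big_cons.
case: ifPn => // Pi.
rewrite (le_trans (expectD_le _ _)) ?lerD2l//; first exact: PF.
exact: bdd_rv_sum.
Qed.

Lemma expect_ge0 f : bdd_rv f -> (forall w, 0 <= f w) -> 0 <= expect f.
Proof.
move=> hf f0; rewrite -(expect_cst 0); apply: expect_le => //.
exact: bdd_rv_cst.
Qed.

Lemma expectN_ge f : bdd_rv f -> - expect (fun w => - f w) <= expect f.
Proof.
move=> hf; rewrite -subr_ge0 opprK addrC -(expect_cst 0).
rewrite (le_trans _ (expectD_le _ _))//; last exact: bdd_rvN.
by under [X in _ <= expect X]eq_fun do rewrite addNr.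
Qed.

Lemma expect_dist f g (D : R) : bdd_rv f -> bdd_rv g ->
  (forall w, `|f w - g w| <= D) -> `|expect f - expect g| <= D.
Proof.
move=> hf hg fg; rewrite ler_norml; apply/andP; split.
- rewrite lerBrDr addrC lerBlDr -expectDc//; apply: expect_le => //.
    by apply: bdd_rvD => //; exact: bdd_rv_cst.
  by move=> w; have := fg w; rewrite ler_norml => /andP[]; lra.
- rewrite lerBlDr addrC -expectDc//; apply: expect_le => //.
    by apply: bdd_rvD => //; exact: bdd_rv_cst.
  by move=> w; have := fg w; rewrite ler_norml => /andP[]; lra.
Qed.

Lemma lip_in_vcomp (U : Type) (Z : nat -> U -> R) n q (F : 'I_q -> U -> R)
    (phi : 'rV[R]_q -> R) (L : R) :
  (forall x y, `|phi x - phi y| <= L * enorm (x - y)) ->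
  (forall i, lip_in Z n (F i)) -> lip_in Z n (fun w => phi (\row_i F i w)).
Proof.
move=> phiL FL.
suff [C [C0 FC]] : exists C : R, 0 <= C /\ forall w w',
    \sum_(i < q) `|F i w - F i w'| <= C * \sum_(i < n) `|Z i w - Z i w'|.
  exists (`|L| * C); split; first by rewrite mulr_ge0.
  move=> w w'; rewrite (le_trans (phiL _ _))//.
  apply: (@le_trans _ _ (`|L| * enorm (\row_i F i w - \row_i F i w'))).
    by rewrite ler_wpM2r ?enorm_ge0// ler_norm.
  rewrite -mulrA ler_wpM2l// (le_trans (enorm_le_sum _))//.
  under eq_bigr do rewrite !mxE.
  exact: FC.
have /choice[C HC] i : exists C : R, 0 <= C /\ forall w w',
    `|F i w - F i w'| <= C * \sum_(j < n) `|Z j w - Z j w'| by exact: FL.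
exists (\sum_i C i); split; first by apply: sumr_ge0 => i _; have [] := HC i.
move=> w w'; rewrite mulr_suml; apply: ler_sum => i _.
by have [_] := HC i.
Qed.

(** Coordinates indexed by all naturals, zero out of range, so that the vectors themselves carry a
    sequence of functions and [lip_in] also describes Lipschitz functions of a vector. *)
Definition coordv (p i : nat) (z : 'rV[R]_p) : R := oapp (z 0) 0 (insub i).

Lemma coordvE p (i : 'I_p) (z : 'rV[R]_p) : coordv i z = z 0 i.
Proof. by rewrite /coordv valK. Qed.

Lemma lip_coordvP p (phi : 'rV[R]_p -> R) :
  lip_in (@coordv p) p phi ->
  exists L, forall x y, `|phi x - phi y| <= L * enorm (x - y).
Proof.
move=> [C [C0 phiC]]; exists (C * p%:R) => x y.
rewrite (le_trans (phiC _ _))// -mulrA ler_wpM2l// (le_trans _ (sum_le_enorm _))//.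
by apply: ler_sum => i _; rewrite !coordvE !mxE.
Qed.

(** Independence is recorded for one variable against its past, the empty past included, and laws
    are compared through bounded Lipschitz kernels: exactly what one backward step consumes. *)
Definition iid_seq (Y : nat -> T -> R) :=
  [/\ forall n, H (Y n),
      forall n, independent_of E (segment Y n 1) (segment Y 0 n)
    & forall n (k : R -> R), lip k -> (exists M, forall x, `|k x| <= M) ->
        expect (fun w => k (Y n w)) = expect (fun w => k (Y 0%N w))].

Definition clip (b x : R) : R := Num.max (- b) (Num.min x b).

Lemma clip_lip b : lip (clip b).
Proof.
exists 1; split => // x y; rewrite mul1r /clip.
have := ler_norm (y - x); rewrite distrC => yx.
have xy := ler_norm (x - y); rewrite ler_norml /Num.max /Num.min.
by apply/andP; split;
   case: (ltP x b) => ?; case: (ltP y b) => ?; do !case: ltP => ?; lra.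
Qed.

Lemma clip_norm b x : 0 <= b -> `|clip b x| <= b.
Proof.
by move=> b0; rewrite /clip ler_norml /Num.max /Num.min;
   case: (ltP x b) => ?; case: ltP => ?; lra.
Qed.

Lemma clip_id b x : `|x| <= b -> clip b x = x.
Proof.
by rewrite /clip ler_norml /Num.max /Num.min => /andP[? ?];
   case: (ltP x b) => ?; case: ltP => ?; lra.
Qed.

Lemma lip_kernel (K g : R -> R) (Z : T -> R) : lip K ->
  (exists M, forall x, `|K x| <= M) -> lip g -> H Z ->
  forall x, bdd_rv (fun w => K (x + g (Z w))).
Proof.
move=> [C [C0 KC]] Kb [D [D0 gD]] HZ x.
apply: (@bdd_rv_comp (fun z => K (x + g z))) => //; last first.
  by case: Kb => M KM; exists M => z.
exists (C * D); split; first exact: mulr_ge0.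
move=> z z'; rewrite (le_trans (KC _ _))// -mulrA ler_wpM2l//.
by rewrite (_ : x + g z - (x + g z') = g z - g z'); [exact: gD|ring].
Qed.

(** Averaging keeps the Lipschitz constant of [K], hence the averaged kernel remains an admissible
    test function. *)
Lemma expect_kernel_lip (K g : R -> R) (Z : T -> R) : lip K ->
  (exists M, forall x, `|K x| <= M) -> lip g -> H Z ->
  lip (fun x => expect (fun w => K (x + g (Z w)))).
Proof.
move=> Kl Kb gl HZ; have [C [C0 KC]] := Kl; exists C; split => // x y.
apply: expect_dist; [exact: lip_kernel Kl Kb gl HZ _|exact: lip_kernel Kl Kb gl HZ _|move=> w].
rewrite (le_trans (KC _ _))// ler_wpM2l//.
by rewrite (_ : x + g (Z w) - (y + g (Z w)) = x - y) //; ring.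
Qed.

Lemma expect_kernel_bdd (K g : R -> R) (Z : T -> R) : lip K ->
  (exists M, forall x, `|K x| <= M) -> lip g -> H Z ->
  exists M, forall x, `|expect (fun w => K (x + g (Z w)))| <= M.
Proof.
move=> Kl [M KM] gl HZ; exists M => x.
rewrite -[X in `|X|]subr0 -(expect_cst 0).
apply: expect_dist; [by apply: (lip_kernel Kl _ gl HZ); exists M|exact: bdd_rv_cst|].
by move=> w; rewrite subr0.
Qed.

Lemma lip_in_rv (Y : nat -> T -> R) n f : iid_seq Y -> lip_in Y n f -> H f.
Proof. by move=> [HY _ _]; apply: rv_lip_in. Qed.

Lemma bdd_lip_in_rv (Y : nat -> T -> R) n f : iid_seq Y -> bounded_fct f ->
  lip_in Y n f -> bdd_rv f.
Proof. by move=> Yi fb fl; split => //; exact: lip_in_rv fl. Qed.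

Lemma lip_in_coordv p (phi : 'rV[R]_p -> R) (L : R) :
  (forall x y, `|phi x - phi y| <= L * enorm (x - y)) ->
  lip_in (@coordv p) p phi.
Proof.
move=> phiL.
have := @lip_in_vcomp _ (@coordv p) p p (fun i z => z 0 i) phi L phiL.
rewrite (_ : (fun z : 'rV_p => phi _) = phi); last first.
  by apply/funext => z; congr phi; apply/rowP => i; rewrite mxE.
apply => i; rewrite (_ : (fun z : 'rV_p => z 0 i) = @coordv p i).
  exact: lip_in_coord.
by apply/funext => z; rewrite coordvE.
Qed.

(** A McShane extension may be unbounded; clipping it at a bound for [f] changes nothing on the
    values of the segment. *)
Lemma clip_mcshane (Y : nat -> T -> R) n f : bounded_fct f -> lip_in Y n f ->
  exists phi : 'rV[R]_n -> R, [/\ bounded_fct phi,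
    lip_in (@coordv n) n phi & forall w, phi (segment Y 0 n w) = f w].
Proof.
move=> [M fM] /lip_in_mcshane[phi [[L phiL] phif]].
exists (fun x => clip `|M| (phi x)); split.
- by exists `|M| => x; exact: clip_norm.
- apply: lip_in_comp; [exact: clip_lip|exact: lip_in_coordv phiL].
- by move=> w; rewrite phif clip_id// (le_trans (fM w))// ler_norm.
Qed.

Lemma lip_in_lsubmx n q (phi : 'rV[R]_n -> R) : lip_in (@coordv n) n phi ->
  lip_in (@coordv (n + q)) (n + q) (fun z => phi (lsubmx z)).
Proof.
move=> /lip_coordvP[L phiL]; apply: (@lip_in_coordv _ _ `|L|) => x y.
rewrite (le_trans (phiL _ _))//.
apply: (@le_trans _ _ (`|L| * enorm (lsubmx x - lsubmx y))).
  by rewrite ler_wpM2r ?enorm_ge0// ler_norm.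
by rewrite ler_wpM2l// -linearB/= enorm_lsubmx.
Qed.

(* The law of the new coordinate enters only through the averaged kernel, which
   turns the vector independence of the definition into a backward recursion. *)
Lemma iid_step (Y : nat -> T -> R) n (A B S : T -> R) (K g : R -> R) :
  iid_seq Y -> bounded_fct A -> lip_in Y n A ->
  bounded_fct B -> lip_in Y n B -> (forall w, 0 <= B w) -> lip_in Y n S ->
  lip K -> (exists M, forall x, `|K x| <= M) -> lip g ->
  expect (fun w => A w + B w * K (S w + g (Y n w))) =
  expect (fun w => A w + B w * expect (fun w' => K (S w + g (Y 0%N w')))).
Proof.
move=> Yi Ab Al Bb Bl B0 Sl Kl Kb gl.
have [HY /(_ n) Yind Yid] := Yi.
have [a [ab al aE]] := clip_mcshane Ab Al.
have [b [bb bl bE]] := clip_mcshane Bb Bl.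
have [s [[L sL] sE]] := lip_in_mcshane Sl.
have {}sl := lip_in_coordv sL.
pose Phi (z : 'rV[R]_(n + 1)) :=
  a (lsubmx z) + b (lsubmx z) * K (s (lsubmx z) + g (coordv n z)).
have PhiC : C_bLip Phi.
  split.
    apply: bounded_fctD; first by case: ab => M aM; exists M.
    apply: bounded_fctM; first by case: bb => M bM; exists M.
    exact: bounded_fct_comp.
  apply: lip_coordvP; apply: lip_inD; first exact: lip_in_lsubmx.
  apply: lip_inM; first by case: bb => M bM; exists M.
  - exact: bounded_fct_comp.
  - exact: lip_in_lsubmx.
  - apply: lip_in_comp => //; apply: lip_inD; first exact: lip_in_lsubmx.
    by apply: lip_in_comp => //; apply: lip_in_coord; rewrite addn1.
have cn (x : 'rV[R]_n) w : coordv n (row_mx x (segment Y n 1 w)) = Y n w.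
  have ce (z : 'rV[R]_(n + 1)) : coordv n z = z 0 (rshift n 0).
    by rewrite -coordvE /= addn0.
  by rewrite ce row_mxEr mxE addn0.
have := Yind Phi PhiC.
rewrite /Phi; under eq_fun do rewrite row_mxKl cn aE bE sE.
move=> EE; rewrite /expect EE; congr (fine (E _)); apply/funext => w.
under eq_fun do rewrite row_mxKl cn aE bE sE.
rewrite -/(expect _).
have hk m := lip_kernel Kl Kb gl (HY m) (S w).
(* With the past frozen, the inner expectation is that of a constant plus a nonnegative multiple of
   the kernel, and both can be taken out exactly. *)
under eq_fun do rewrite addrC.
rewrite expectDc; last exact: bdd_rvZ.
rewrite expectZ// addrC; congr (_ + _ * _).
apply: (Yid n (fun z => K (S w + g z))); last by case: Kb => M KM; exists M.
have [C [C0 KC]] := Kl; have [D [D0 gD]] := gl.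
exists (C * D); split; first exact: mulr_ge0.
move=> z z'; rewrite (le_trans (KC _ _))// -mulrA ler_wpM2l//.
by rewrite (_ : S w + g z - (S w + g z') = g z - g z'); [exact: gD|ring].
Qed.

(** * Centering and second moments *)

Lemma lipN_clip b : lip (fun x => - clip b x).
Proof.
have [C [C0 HC]] := clip_lip b; exists C; split => // x y.
by rewrite -opprD normrN; exact: HC.
Qed.

Lemma clip_sq_lip b : 0 <= b -> lip (fun x => clip b x ^+ 2).
Proof.
move=> b0; have [C [C0 HC]] := clip_lip b.
exists (C * (b + b)); split; first by rewrite mulr_ge0 ?addr_ge0.
move=> x y; rewrite subr_sqr normrM mulrAC ler_pM//.
by rewrite (le_trans (ler_normD _ _))// lerD// clip_norm.
Qed.

Lemma lipN (k : R -> R) : lip k -> lip (fun x => - k x).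
Proof.
move=> [C [C0 HC]]; exists C; split => // x y.
by rewrite -opprD normrN; exact: HC.
Qed.

Lemma clip_sq_le b x : 0 <= b -> clip b x ^+ 2 <= b ^+ 2.
Proof.
move=> b0; rewrite -[X in X <= _]real_normK ?num_real//.
by rewrite lerXn2r ?nnegrE// clip_norm.
Qed.

Lemma clip_sq_bdd b : 0 <= b -> exists M, forall x, `|clip b x ^+ 2| <= M.
Proof.
by move=> b0; exists (b ^+ 2) => x; rewrite ger0_norm ?sqr_ge0// clip_sq_le.
Qed.

Lemma clip_bdd b : 0 <= b -> exists M, forall x, `|clip b x| <= M.
Proof. by move=> b0; exists b => x; rewrite clip_norm. Qed.

Lemma bddN (k : R -> R) : (exists M, forall x, `|k x| <= M) ->
  exists M, forall x, `|- k x| <= M.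
Proof. by move=> [M kM]; exists M => x; rewrite normrN. Qed.

Lemma norm_clip b x : 0 <= b -> `|clip b x| = Num.min `|x| b.
Proof.
move=> b0; rewrite /clip /Num.min /Num.max; case: (ger0P x) => ?;
  by case: (ltP x b) => ?; do !case: ltP => ?; try case: ger0P => ?; lra.
Qed.

Lemma clip_sqE b x : 0 <= b -> clip b x ^+ 2 = Num.min `|x| b ^+ 2.
Proof. by move=> b0; rewrite -norm_clip// real_normK// num_real. Qed.

Lemma clip_sq_le_sqr b x : 0 <= b -> clip b x ^+ 2 <= x ^+ 2.
Proof.
move=> b0; rewrite clip_sqE// -[leRHS]real_normK ?num_real//.
by rewrite lerXn2r ?nnegrE ?le_min ?normr_ge0// ge_min lexx.
Qed.

Lemma bdd_clip b f : 0 <= b -> H f -> bdd_rv (fun w => clip b (f w)).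
Proof. by move=> b0 Hf; apply: bdd_rv_comp (clip_lip b) (clip_bdd b0) Hf. Qed.

Lemma bdd_clip_sq b f : 0 <= b -> H f -> bdd_rv (fun w => clip b (f w) ^+ 2).
Proof.
by move=> b0 Hf; apply: bdd_rv_comp (clip_sq_lip b0) (clip_sq_bdd b0) Hf.
Qed.

(** Truncated upper and lower mean zero, expressed by two one-sided bounds; the matching lower
    bounds follow from E[f] + E[-f] >= 0. *)
Definition centered f := forall eps : R, 0 < eps -> exists b0 : R,
  forall b, b0 <= b -> expect (fun w => clip b (f w)) <= eps /\
    expect (fun w => - clip b (f w)) <= eps.

(** [s] bounds the norm rather than its square, since norms obey Minkowski's inequality; quantifying
    over the truncation level avoids taking a limit. *)
Definition moment2_le f (s : R) := 0 <= s /\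
  forall b, 0 <= b -> expect (fun w => clip b (f w) ^+ 2) <= s ^+ 2.

(** Still an upper bound, but for the conjugate expectation of the square, that is, for the lower
    second moment. *)
Definition lmoment2_le f (s : R) := 0 <= s /\
  forall b, 0 <= b -> - expect (fun w => - clip b (f w) ^+ 2) <= s ^+ 2.

Lemma le_sqr_addeps (x u : R) : 0 <= u ->
  (forall eps, 0 < eps -> x <= (u + eps) ^+ 2) -> x <= u ^+ 2.
Proof.
move=> u0 h; rewrite leNgt; apply/negP => ux.
have x0 : 0 <= x by rewrite (le_trans _ (ltW ux))// sqr_ge0.
have us : u < Num.sqrt x by rewrite -(ger0_norm u0) -sqrtr_sqr ltr_sqrt// (le_lt_trans _ ux)// sqr_ge0.
have := h ((Num.sqrt x - u) / 2); rewrite divr_gt0 ?subr_gt0// => /(_ isT).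
by rewrite -[leLHS](sqr_sqrtr x0) leNgt ltrXn2r ?nnegrE//; lra.
Qed.

Lemma moment2_le_trans f s t : s <= t -> moment2_le f s -> moment2_le f t.
Proof.
move=> st [s0 h]; split; first exact: le_trans st.
move=> b b0; rewrite (le_trans (h b b0))// lerXn2r ?nnegrE//.
exact: le_trans st.
Qed.

(** The weights are those that prove Minkowski's inequality: with second moments s^2 and t^2 the
    right side becomes (s + t)^2. *)
Lemma clip_sqD (b x y s t : R) : 0 <= b -> 0 < s -> 0 < t ->
  clip b (x + y) ^+ 2 <=
  (1 + t / s) * clip b x ^+ 2 + (1 + s / t) * clip b y ^+ 2.
Proof.
move=> b0 s0 t0.
apply: (@le_trans _ _ ((`|clip b x| + `|clip b y|) ^+ 2)).
  rewrite -[leLHS]real_normK ?num_real// lerXn2r ?nnegrE ?addr_ge0//.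
  rewrite !norm_clip//; have := ler_normD x y.
  have := normr_ge0 x; have := normr_ge0 y.
  by rewrite /Num.min; do 3!case: ifPn; lra.
rewrite -(real_normK (num_real (clip b x))) -(real_normK (num_real (clip b y))).
move: `|_| `|clip b y| => u v.
rewrite -subr_ge0.
have -> : (1 + t / s) * u ^+ 2 + (1 + s / t) * v ^+ 2 - (u + v) ^+ 2 =
   (t * u - s * v) ^+ 2 / (s * t).
  by field; rewrite ?gt_eqF.
by rewrite divr_ge0 ?sqr_ge0// mulr_ge0// ltW.
Qed.

Lemma moment2_leD f g s t : H f -> H g -> moment2_le f s -> moment2_le g t ->
  moment2_le (fun w => f w + g w) (s + t).
Proof.
move=> Hf Hg [s0 fs] [t0 gt]; split; first exact: addr_ge0.
move=> b b0; apply: le_sqr_addeps; first exact: addr_ge0.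
(* The weights divide by the norms, which may be zero; hence the shift by eps / 2. *)
move=> eps e0; pose s' := s + eps / 2; pose t' := t + eps / 2.
have s'0 : 0 < s' by rewrite ltr_wpDl// divr_gt0.
have t'0 : 0 < t' by rewrite ltr_wpDl// divr_gt0.
have hf := bdd_clip_sq b0 Hf; have hg := bdd_clip_sq b0 Hg.
have hfg := bdd_clip_sq b0 (rvs_add Hs Hf Hg).
have c1 : 0 <= 1 + t' / s' by rewrite addr_ge0// divr_ge0 ?ltW.
have c2 : 0 <= 1 + s' / t' by rewrite addr_ge0// divr_ge0 ?ltW.
apply: (le_trans (expect_le hfg (bdd_rvD (bdd_rvZ (1 + t' / s') hf)
   (bdd_rvZ (1 + s' / t') hg)) (fun w => clip_sqD _ _ b0 s'0 t'0))).
apply: (le_trans (expectD_le (bdd_rvZ _ hf) (bdd_rvZ _ hg))).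
rewrite !expectZ//.
have -> : (s + t + eps) ^+ 2 = (1 + t' / s') * s' ^+ 2 + (1 + s' / t') * t' ^+ 2.
  rewrite (_ : s + t + eps = s' + t'); last by rewrite /s' /t'; lra.
  by field; rewrite ?gt_eqF.
apply: lerD; rewrite ler_wpM2l//.
  by rewrite (le_trans (fs _ b0))// lerXn2r ?nnegrE ?(ltW s'0)// /s'; lra.
by rewrite (le_trans (gt _ b0))// lerXn2r ?nnegrE ?(ltW t'0)// /t'; lra.
Qed.

(** The conjugate expectation of a sum is at most a conjugate plus an upper expectation, so one
    summand is measured in the upper norm. *)
Lemma lmoment2_leD f g s t : H f -> H g -> lmoment2_le f s -> moment2_le g t ->
  lmoment2_le (fun w => f w + g w) (s + t).
Proof.
move=> Hf Hg [s0 fs] [t0 gt]; split; first exact: addr_ge0.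
move=> b b0; apply: le_sqr_addeps; first exact: addr_ge0.
move=> eps e0; pose s' := s + eps / 2; pose t' := t + eps / 2.
have s'0 : 0 < s' by rewrite ltr_wpDl// divr_gt0.
have t'0 : 0 < t' by rewrite ltr_wpDl// divr_gt0.
have hf := bdd_clip_sq b0 Hf; have hg := bdd_clip_sq b0 Hg.
have hfg := bdd_clip_sq b0 (rvs_add Hs Hf Hg).
have c1 : 0 <= 1 + t' / s' by rewrite addr_ge0// divr_ge0 ?ltW.
have c2 : 0 <= 1 + s' / t' by rewrite addr_ge0// divr_ge0 ?ltW.
have : (1 + t' / s') * expect (fun w => - clip b (f w) ^+ 2) <=
    expect (fun w => - clip b (f w + g w) ^+ 2) +
    (1 + s' / t') * expect (fun w => clip b (g w) ^+ 2).
  rewrite -!expectZ//; last exact: bdd_rvN.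
  apply: (le_trans _ (expectD_le _ _)); [|exact: bdd_rvN|exact: bdd_rvZ].
  apply: expect_le; [by apply: bdd_rvZ; exact: bdd_rvN| |].
    by apply: bdd_rvD; [exact: bdd_rvN|exact: bdd_rvZ].
  by move=> w; have := clip_sqD (f w) (g w) b0 s'0 t'0; lra.
have -> : (s + t + eps) ^+ 2 = (1 + t' / s') * s' ^+ 2 + (1 + s' / t') * t' ^+ 2.
  rewrite (_ : s + t + eps = s' + t'); last by rewrite /s' /t'; lra.
  by field; rewrite ?gt_eqF.
have : (1 + t' / s') * - expect (fun w => - clip b (f w) ^+ 2) <= (1 + t' / s') * s' ^+ 2.
  rewrite ler_wpM2l//.
  by rewrite (le_trans (fs _ b0))// lerXn2r ?nnegrE ?(ltW s'0)// /s'; lra.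
have : (1 + s' / t') * expect (fun w => clip b (g w) ^+ 2) <= (1 + s' / t') * t' ^+ 2.
  rewrite ler_wpM2l//.
  by rewrite (le_trans (gt _ b0))// lerXn2r ?nnegrE ?(ltW t'0)// /t'; lra.
lra.
Qed.

(** The right side is linear in [clip c y] apart from its square, so centering applies at level c.
    If |y| > c, it is at least (c - |x|)^2, hence at least b^2. *)
Lemma clip_sq_shift (b c x y : R) : 0 <= b -> `|x| + b <= c ->
  clip b (x + y) ^+ 2 <= x ^+ 2 + (2 * x) * clip c y + clip c y ^+ 2.
Proof.
move=> b0 xbc; have c0 : 0 <= c by have := normr_ge0 x; lra.
rewrite (_ : _ + _ + _ = (x + clip c y) ^+ 2); last by ring.
have [yc|cy] := leP `|y| c; first by rewrite (clip_id yc) clip_sq_le_sqr.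
apply: (le_trans (clip_sq_le _ b0)).
rewrite -[leRHS]real_normK ?num_real// lerXn2r ?nnegrE//.
have := ler_normD (x + clip c y) (- x).
rewrite (_ : x + clip c y - x = clip c y); last by ring.
by rewrite norm_clip// normrN min_r ?(ltW cy)//; lra.
Qed.

Lemma centered_lin f (x eps : R) : H f -> centered f -> 0 < eps ->
  exists c0, forall c, c0 <= c -> expect (fun w => x * clip c (f w)) <= eps.
Proof.
move=> Hf fc e0.
have [|b0 hb] := fc (eps / (`|x| + 1)); first by rewrite divr_gt0// ltr_wpDl.
exists (Num.max 0 b0) => c; rewrite ge_max => /andP[c0 /hb[h1 h2]].
have hc := bdd_clip c0 Hf.
suff : expect (fun w => x * clip c (f w)) <= `|x| * (eps / (`|x| + 1)).
  move/le_trans; apply; rewrite mulrCA ger_pMr// ler_pdivrMr ?ltr_wpDl//.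
  by rewrite mul1r lerDl.
have [x0|x0] := leP 0 x.
  by rewrite expectZ// ger0_norm// ler_wpM2l// -(ger0_norm x0).
rewrite ltr0_norm// (_ : (fun w => _) = fun w => - x * - clip c (f w)); last first.
  by apply/funext => w; rewrite mulrNN.
rewrite expectZ; [|lra|exact: bdd_rvN].
by rewrite ler_wpM2l//; [lra|move: h2; rewrite ltr0_norm].
Qed.

(** For |x| <= b the cross term vanishes as the auxiliary level c grows; for |x| > b the trivial
    bound b^2 suffices. Having [clip b x ^+ 2] in both cases lets the inequality be iterated along a
    sum. *)
Lemma expect_clip_sq_shift f (s b x : R) : H f -> centered f ->
  moment2_le f s -> 0 <= b ->
  expect (fun w => clip b (x + f w) ^+ 2) <= clip b x ^+ 2 + s ^+ 2.
Proof.
move=> Hf fc [s0 fs] b0.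
have Hxf := rvs_add Hs (rv_cst x) Hf.
have hl := bdd_clip_sq b0 Hxf.
have hb : expect (fun w => clip b (x + f w) ^+ 2) <= b ^+ 2.
  rewrite -[leRHS]expect_cst; apply: (expect_le hl (bdd_rv_cst _)).
  by move=> w; exact: clip_sq_le.
have hx : expect (fun w => clip b (x + f w) ^+ 2) <= x ^+ 2 + s ^+ 2.
  apply/ler_addgt0Pr => eps e0.
  have [c0 hc] := centered_lin (2 * x) Hf fc e0.
  pose c := Num.max c0 (`|x| + b).
  have cc : `|x| + b <= c by rewrite le_max lexx orbT.
  have c00 : 0 <= c by have := normr_ge0 x; lra.
  have := hc c; rewrite le_max lexx => /(_ isT) hce.
  have h1 := bdd_clip c00 Hf; have h2 := bdd_clip_sq c00 Hf.
  have h3 := bdd_rvD (bdd_rv_cst (x ^+ 2)) (bdd_rvZ (2 * x) h1).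
  apply: (le_trans (expect_le hl (bdd_rvD h3 h2)
    (fun w => clip_sq_shift (f w) b0 cc))).
  apply: (le_trans (expectD_le h3 h2)).
  under eq_fun do rewrite addrC.
  rewrite expectDc; last exact: bdd_rvZ.
  by have := fs c c00; lra.
have [xb|bx] := leP `|x| b; first by rewrite (clip_id xb).
rewrite (le_trans hb)// clip_sqE// min_r ?(ltW bx)// lerDl; exact: sqr_ge0.
Qed.

Lemma lexpect_clip_sq_shift f (s b x : R) : H f -> centered f ->
  lmoment2_le f s -> 0 <= b ->
  - (clip b x ^+ 2) - s ^+ 2 <= expect (fun w => - clip b (x + f w) ^+ 2).
Proof.
move=> Hf fc [s0 fs] b0.
have Hxf := rvs_add Hs (rv_cst x) Hf.
have hl := bdd_rvN (bdd_clip_sq b0 Hxf).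
have hb : - b ^+ 2 <= expect (fun w => - clip b (x + f w) ^+ 2).
  rewrite -[leLHS]expect_cst; apply: (expect_le (bdd_rv_cst _) hl).
  by move=> w; rewrite lerN2; exact: clip_sq_le.
have hx : - x ^+ 2 - s ^+ 2 <= expect (fun w => - clip b (x + f w) ^+ 2).
  apply/ler_addgt0Pr => eps e0.
  have [c0 hc] := centered_lin (2 * x) Hf fc e0.
  pose c := Num.max c0 (`|x| + b).
  have cc : `|x| + b <= c by rewrite le_max lexx orbT.
  have c00 : 0 <= c by have := normr_ge0 x; lra.
  have := hc c; rewrite le_max lexx => /(_ isT) hce.
  have h1 := bdd_clip c00 Hf; have h2 := bdd_clip_sq c00 Hf.
  have : expect (fun w => - clip c (f w) ^+ 2 + - x ^+ 2) <=
      expect (fun w => - clip b (x + f w) ^+ 2) +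
      expect (fun w => (2 * x) * clip c (f w)).
    have h3 := bdd_rvZ (2 * x) h1.
    apply: (le_trans _ (expectD_le hl h3)).
    apply: (expect_le (bdd_rvD (bdd_rvN h2) (bdd_rv_cst _)) (bdd_rvD hl h3)).
    by move=> w; have := clip_sq_shift (f w) b0 cc; lra.
  rewrite expectDc; last exact: bdd_rvN.
  by have := fs c c00; lra.
have [xb|bx] := leP `|x| b; first by rewrite (clip_id xb).
rewrite (le_trans _ hb)// clip_sqE// min_r ?(ltW bx)//.
by have := sqr_ge0 s; lra.
Qed.

Lemma lip_id : lip (fun x : R => x).
Proof. by exists 1; split => // x y; rewrite mul1r. Qed.

Lemma lip_opp : lip (fun x : R => - x).
Proof. exact: lipN lip_id. Qed.

Lemma iid_lip_sum (Y : nat -> T -> R) (a b n : nat) (g : R -> R) : lip g ->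
  (b <= n)%N -> lip_in Y n (fun w => \sum_(a <= i < b) g (Y i w)).
Proof.
move=> gl bn.
under eq_fun do rewrite big_nat_cond.
apply: lip_in_sum => i; rewrite andbT => /andP[_ ib].
by apply: lip_in_comp => //; apply: lip_in_coord; exact: leq_trans bn.
Qed.

Lemma iid_moment2 (Y : nat -> T -> R) (s : R) n : iid_seq Y ->
  centered (Y 0%N) -> moment2_le (Y 0%N) s ->
  moment2_le (fun w => \sum_(0 <= i < n) Y i w) (Num.sqrt n%:R * s).
Proof.
move=> Yi Yc Ys; have [s0 hs] := Ys; split; first by rewrite mulr_ge0.
move=> b b0; rewrite exprMn sqr_sqrtr//; have [HY _ _] := Yi.
elim: n => [|n IH].
  under eq_fun do rewrite big_geq//.
  by rewrite expect_cst mul0r clip_id ?normr0// expr0n.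
have step := @iid_step Y n (fun=> 0) (fun=> 1) (fun w => \sum_(0 <= i < n) Y i w)
  (fun x => clip b x ^+ 2) (fun x => x) Yi (bounded_fct_cst _ 0)
  (lip_in_cst _ _ _) (bounded_fct_cst _ 1) (lip_in_cst _ _ _) (fun _ => ler01)
  (iid_lip_sum _ _ lip_id (leqnn n)) (clip_sq_lip b0) (clip_sq_bdd b0) lip_id.
under eq_fun do rewrite big_nat_recr//=.
move: step; under eq_fun do rewrite add0r mul1r.
under [in X in _ = X -> _]eq_fun do rewrite add0r mul1r.
move=> ->; have HS : H (fun w => \sum_(0 <= i < n) Y i w) by exact: rv_sum.
have hS := bdd_clip_sq b0 HS.
apply: (@le_trans _ _ (expect (fun w => clip b (\sum_(0 <= i < n) Y i w) ^+ 2 + s ^+ 2))).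
  apply: expect_le.
  - have := expect_kernel_bdd (clip_sq_lip b0) (clip_sq_bdd b0) lip_id (HY 0%N).
    have := expect_kernel_lip (clip_sq_lip b0) (clip_sq_bdd b0) lip_id (HY 0%N).
    by move=> kl kb; exact: (bdd_rv_comp kl kb HS).
  - by apply: bdd_rvD => //; exact: bdd_rv_cst.
  - by move=> w; exact: (expect_clip_sq_shift _ (HY 0%N) Yc Ys b0).
by rewrite expectDc// -natr1 mulrDl mul1r lerD2r.
Qed.

Lemma iid_lmoment2 (Y : nat -> T -> R) (s : R) n : iid_seq Y ->
  centered (Y 0%N) -> lmoment2_le (Y 0%N) s ->
  lmoment2_le (fun w => \sum_(0 <= i < n) Y i w) (Num.sqrt n%:R * s).
Proof.
move=> Yi Yc Ys; have [s0 hs] := Ys; split; first by rewrite mulr_ge0.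
move=> b b0; rewrite exprMn sqr_sqrtr//; have [HY _ _] := Yi.
elim: n => [|n IH].
  under eq_fun do rewrite big_geq//.
  by rewrite expect_cst mul0r clip_id ?normr0// expr0n oppr0 oppr0.
have kl := lipN (clip_sq_lip b0); have kb := bddN (clip_sq_bdd b0).
have step := @iid_step Y n (fun=> 0) (fun=> 1) (fun w => \sum_(0 <= i < n) Y i w)
  (fun x => - clip b x ^+ 2) (fun x => x) Yi (bounded_fct_cst _ 0)
  (lip_in_cst _ _ _) (bounded_fct_cst _ 1) (lip_in_cst _ _ _) (fun _ => ler01)
  (iid_lip_sum _ _ lip_id (leqnn n)) kl kb lip_id.
under eq_fun do rewrite big_nat_recr//=.
move: step; under eq_fun do rewrite add0r mul1r.
under [in X in _ = X -> _]eq_fun do rewrite add0r mul1r.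
move=> ->; have HS : H (fun w => \sum_(0 <= i < n) Y i w) by exact: rv_sum.
have hS := bdd_rvN (bdd_clip_sq b0 HS).
have : expect (fun w => - clip b (\sum_(0 <= i < n) Y i w) ^+ 2 + - s ^+ 2) <=
   expect (fun w => expect (fun w' => - clip b (\sum_(0 <= i < n) Y i w + Y 0%N w') ^+ 2)).
  apply: expect_le.
  - by apply: bdd_rvD => //; exact: bdd_rv_cst.
  - have := expect_kernel_bdd kl kb lip_id (HY 0%N).
    have := expect_kernel_lip kl kb lip_id (HY 0%N).
    by move=> kl' kb'; exact: (bdd_rv_comp kl' kb' HS).
  - by move=> w; exact: (lexpect_clip_sq_shift _ (HY 0%N) Yc Ys b0).
by rewrite expectDc// -natr1 mulrDl mul1r; lra.
Qed.

(** Clipping fails to be additive only if one argument exceeds b / 2 in absolute value; there the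
    defect is at most 3 b = 12 / b times (b / 2)^2. Bounded second moments make it vanish as b
    grows. *)
Lemma clipD_dist (b x y : R) : 0 < b ->
  `|clip b (x + y) - clip b x - clip b y| <=
  12 / b * (clip b x ^+ 2 + clip b y ^+ 2).
Proof.
move=> b0; have bn := ltW b0.
have [/andP[xb yb]|] := boolP ((`|x| <= b / 2) && (`|y| <= b / 2)).
  have xyb : `|x + y| <= b by rewrite (le_trans (ler_normD _ _))//; lra.
  rewrite !clip_id//; [|lra..].
  rewrite (_ : x + y - x - y = 0); last by ring.
  by rewrite normr0 mulr_ge0 ?addr_ge0 ?sqr_ge0// divr_ge0.
move=> h; apply: (@le_trans _ _ (3 * b)).
  have := clip_norm (x + y) bn; have := clip_norm x bn; have := clip_norm y bn.
  rewrite !ler_norml => /andP[? ?] /andP[? ?] /andP[? ?].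
  by apply/andP; split; lra.
have -> : 3 * b = 12 / b * (b / 2) ^+ 2 by field; rewrite gt_eqF.
rewrite ler_wpM2l//; first by rewrite divr_ge0.
have mono z : ~~ (`|z| <= b / 2) -> (b / 2) ^+ 2 <= clip b z ^+ 2.
  rewrite -ltNge => zb; rewrite clip_sqE// lerXn2r ?nnegrE ?le_min ?normr_ge0//=; lra.
case/nandP: h => /mono h; rewrite (le_trans h)// ?lerDl ?lerDr sqr_ge0//.
Qed.

Lemma centeredD f g s t : H f -> H g -> moment2_le f s -> moment2_le g t ->
  centered f -> centered g -> centered (fun w => f w + g w).
Proof.
move=> Hf Hg [s0 fs] [t0 gt] fc gc eps e0.
have e3 : 0 < eps / 3 by rewrite divr_gt0.
have [b1 h1] := fc _ e3; have [b2 h2] := gc _ e3.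
pose D := s ^+ 2 + t ^+ 2; have D0 : 0 <= D by rewrite addr_ge0 ?sqr_ge0.
(* Beyond 36 D / eps the additivity defect 12 D / b is at most eps / 3; the added 1 makes b
   positive. *)
exists (Num.max (Num.max b1 b2) (36 * D / eps + 1)) => b.
rewrite !ge_max => /andP[/andP[b1b b2b] Db].
have b0 : 0 < b by rewrite (lt_le_trans _ Db)// ltr_wpDl// divr_ge0 ?mulr_ge0// ltW.
have bn := ltW b0.
have Db3 : 12 / b * D <= eps / 3.
  rewrite mulrAC ler_pdivrMr//.
  have : 36 * D / eps * eps <= b * eps by rewrite ler_wpM2r ?ltW//; lra.
  by rewrite mulfVK ?gt_eqF//; lra.
have [f1 f2] := h1 _ b1b; have [g1 g2] := h2 _ b2b.
have hf := bdd_clip bn Hf; have hg := bdd_clip bn Hg.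
have hf2 := bdd_clip_sq bn Hf; have hg2 := bdd_clip_sq bn Hg.
have hfg := bdd_clip bn (rvs_add Hs Hf Hg).
have h3 : expect (fun w => 12 / b * (clip b (f w) ^+ 2 + clip b (g w) ^+ 2)) <= eps / 3.
  rewrite expectZ; [|by rewrite divr_ge0|exact: bdd_rvD].
  rewrite (le_trans _ Db3)// ler_wpM2l ?divr_ge0// (le_trans (expectD_le _ _))//.
  by apply: lerD; [exact: fs|exact: gt].
have hQ : bdd_rv (fun w => 12 / b * (clip b (f w) ^+ 2 + clip b (g w) ^+ 2)).
  by apply: bdd_rvZ; exact: bdd_rvD.
split.
- apply: (@le_trans _ _ (expect (fun w => clip b (f w) + clip b (g w) +
      12 / b * (clip b (f w) ^+ 2 + clip b (g w) ^+ 2)))).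
    apply: expect_le => //; first by apply: bdd_rvD => //; exact: bdd_rvD.
    move=> w; have := clipD_dist (f w) (g w) b0.
    by rewrite ler_norml => /andP[_]; lra.
  rewrite (le_trans (expectD_le _ _))//; first exact: bdd_rvD.
  have := expectD_le hf hg; lra.
- apply: (@le_trans _ _ (expect (fun w => - clip b (f w) + - clip b (g w) +
      12 / b * (clip b (f w) ^+ 2 + clip b (g w) ^+ 2)))).
    apply: expect_le => //; first exact: bdd_rvN.
      by apply: bdd_rvD => //; apply: bdd_rvD; exact: bdd_rvN.
    move=> w; have := clipD_dist (f w) (g w) b0.
    by rewrite ler_norml => /andP[+ _]; lra.
  rewrite (le_trans (expectD_le _ _))//; first by apply: bdd_rvD; exact: bdd_rvN.
  have := expectD_le (bdd_rvN hf) (bdd_rvN hg); lra.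
Qed.

(** * The upper bound for independent sequences *)

Definition pcut (y x : R) : R := Num.min (Num.max 0 x) y.

(** This is min(1, exp (l t - c)), a bounded Lipschitz exponential. *)
Definition sexp (c l t : R) : R := expR (- Num.max 0 (c - l * t)).

Lemma max0_lip (u v : R) : `|Num.max 0 u - Num.max 0 v| <= `|u - v|.
Proof.
have := ler_norm (u - v); have := ler_norm (v - u); rewrite distrC => ? ?.
by rewrite ler_norml /Num.max; case: (ltP 0 u); case: (ltP 0 v) => ? ?;
  apply/andP; split; lra.
Qed.

Lemma min_dist (y u v : R) : `|Num.min u y - Num.min v y| <= `|u - v|.
Proof.
have := ler_norm (u - v); have := ler_norm (v - u); rewrite distrC => ? ?.
by rewrite ler_norml /Num.min; case: (ltP u y); case: (ltP v y) => ? ?;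
  apply/andP; split; lra.
Qed.

Lemma min_lip (y : R) : lip (fun x => Num.min x y).
Proof. by exists 1; split => // u v; rewrite mul1r min_dist. Qed.

Lemma sexp_lip c l : 0 <= l -> lip (sexp c l).
Proof.
move=> l0; exists l; split => // x y.
have max0_ge0 (u : R) : 0 <= Num.max 0 u by rewrite le_max lexx.
rewrite (le_trans (expRN_lip (max0_ge0 _) (max0_ge0 _)))//.
rewrite (le_trans (max0_lip _ _))//.
rewrite (_ : c - l * x - (c - l * y) = l * (y - x)); last by ring.
by rewrite normrM (ger0_norm l0) distrC.
Qed.

Lemma sexp_ge0 c l t : 0 <= sexp c l t.
Proof. exact: expR_ge0. Qed.

Lemma sexp_le1 c l t : sexp c l t <= 1.
Proof. by rewrite expR_le1 oppr_le0 le_max lexx. Qed.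

Lemma sexp_bdd c l : exists M, forall t, `|sexp c l t| <= M.
Proof. by exists 1 => t; rewrite ger0_norm ?sexp_ge0 ?sexp_le1. Qed.

Lemma sexp_le_exp c l t : sexp c l t <= expR (l * t - c).
Proof. by rewrite ler_expR lerNl opprB le_max lexx orbT. Qed.

Lemma pcut_cube_lip y : 0 <= y -> lip (fun x => pcut y x ^+ 3).
Proof.
move=> y0; exists (3 * y ^+ 2); split; first by rewrite mulr_ge0 ?sqr_ge0.
move=> u v; have pc z : 0 <= pcut y z <= y.
  by rewrite /pcut le_min y0 le_max lexx ge_min lexx orbT.
have [/andP[u0 uy] /andP[v0 vy]] := (pc u, pc v).
have duv : `|pcut y u - pcut y v| <= `|u - v|.
  by rewrite (le_trans (min_dist _ _ _))// max0_lip.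
have -> : pcut y u ^+ 3 - pcut y v ^+ 3 = (pcut y u - pcut y v) *
   (pcut y u ^+ 2 + pcut y u * pcut y v + pcut y v ^+ 2) by ring.
rewrite normrM mulrC ler_pM// ger0_norm; last first.
  by rewrite !addr_ge0 ?sqr_ge0 ?mulr_ge0.
have := ler_pM u0 u0 uy uy; have := ler_pM v0 v0 vy vy; have := ler_pM u0 v0 uy vy.
rewrite !expr2; lra.
Qed.

Lemma pcut_cube_bdd y : 0 <= y -> exists M, forall x, `|pcut y x ^+ 3| <= M.
Proof.
move=> y0; exists (y ^+ 3) => x.
have /andP[p0 py] : 0 <= pcut y x <= y.
  by rewrite /pcut le_min y0 le_max lexx ge_min lexx orbT.
by rewrite ger0_norm ?exprn_ge0// lerXn2r ?nnegrE.
Qed.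

(* Truncating from above only keeps the mean of [Y /\ y] nonpositive: a
   two-sided truncation at the level needed for exponential moments would have
   a bias of the same order as the fluctuations. *)
Lemma expR_trunc_le (l y b x : R) : 0 <= l -> 0 <= y -> y <= b ->
  expR (l * Num.min x y) <= 1 + l * clip b x + l ^+ 2 / 2 * clip b x ^+ 2 +
    l ^+ 3 / 6 * expR (l * y) * pcut y x ^+ 3.
Proof.
move=> l0 y0 yb; have b0 := le_trans y0 yb; have [x0|x0] := leP 0 x.
  have px : pcut y x = Num.min x y by rewrite /pcut max_r.
  rewrite px; set u := Num.min x y.
  have u0 : 0 <= u by rewrite le_min x0 y0.
  have uy : u <= y by rewrite ge_min lexx orbT.
  have cx : clip b x = Num.min x b.
    by rewrite /clip max_r// le_min; apply/andP; split; lra.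
  have uc : u <= clip b x.
    by rewrite cx le_min !ge_min lexx /= yb orbT.
  have := expR_le_cubic (mulr_ge0 l0 u0).
  rewrite !exprMn => /le_trans; apply.
  have h1 := ler_wpM2l l0 uc.
  have h2 : l ^+ 2 / 2 * u ^+ 2 <= l ^+ 2 / 2 * clip b x ^+ 2.
    rewrite ler_wpM2l ?divr_ge0 ?sqr_ge0// lerXn2r// nnegrE//.
    exact: le_trans uc.
  have h3 : l ^+ 3 / 6 * u ^+ 3 * expR (l * u) <=
      l ^+ 3 / 6 * u ^+ 3 * expR (l * y).
    rewrite ler_wpM2l ?ler_expR ?ler_wpM2l//.
    by rewrite mulr_ge0 ?divr_ge0 ?exprn_ge0.
  lra.
have px : pcut y x = 0 by rewrite /pcut (max_l (ltW x0)) min_l.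
rewrite px expr0n/= mulr0 addr0 min_l; last lra.
pose u := Num.min (- x) b.
have u0 : 0 <= u by rewrite le_min b0 andbT; lra.
have cx : clip b x = - u.
  by rewrite /clip /u /Num.min /Num.max; case: (ltP x b) => ?;
    do !case: ltP => ?; lra.
have := expRN_le_quad (mulr_ge0 l0 u0); rewrite cx sqrrN !exprMn.
suff : expR (l * x) <= expR (- (l * u)) by lra.
rewrite ler_expR -mulrN ler_wpM2l// lerNr ge_min lexx//.
Qed.

(** The exponent gained per variable: the Gaussian part, and the cubic remainder with [beta]
    bounding the third moment of the cut positive part. *)
Definition exp_rate (l s y beta : R) : R :=
  l ^+ 2 / 2 * s ^+ 2 + l ^+ 3 / 6 * expR (l * y) * beta.

(** Averaging over one variable lowers the level c by [exp_rate]. Where the new function equals 1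
    this is trivial; elsewhere it is a pure exponential and 1 + al <= exp al closes the estimate. *)
Lemma expect_sexp_le f (s y beta l c x : R) : H f -> centered f ->
  moment2_le f s -> 0 < y -> 0 <= l ->
  expect (fun w => pcut y (f w) ^+ 3) <= beta ->
  expect (fun w => sexp c l (x + Num.min (f w) y)) <=
  sexp (c - exp_rate l s y beta) l x.
Proof.
move=> Hf fc [s0 fs] y0 l0 fb; have yn := ltW y0.
set al := exp_rate _ _ _ _.
have hK := lip_kernel (sexp_lip c l0) (sexp_bdd c l) (min_lip y) Hf x.
have [h|h] := leP (c - al - l * x) 0.
  rewrite {2}/sexp max_l// oppr0 expR0 -[leRHS]expect_cst.
  apply: (expect_le hK (bdd_rv_cst 1)) => w; exact: sexp_le1.
rewrite {2}/sexp (max_r (ltW h)).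
have -> : - (c - al - l * x) = (l * x - c) + al by ring.
rewrite expRD; apply: (@le_trans _ _ (expR (l * x - c) * (1 + al))); last first.
  by rewrite ler_wpM2l ?expR_ge0// expR_ge1Dx.
suff hb (eps : R) : 0 < eps ->
    expect (fun w => sexp c l (x + Num.min (f w) y)) <=
    expR (l * x - c) * (1 + al + l * eps).
  apply/ler_addgt0Pr => eps e0.
  pose D := expR (l * x - c) * l.
  have D0 : 0 <= D by rewrite mulr_ge0 ?expR_ge0.
  apply: (le_trans (hb (eps / (D + 1)) _)); first by rewrite divr_gt0// ltr_wpDl.
  rewrite mulrDr lerD2l mulrA -/D mulrCA ger_pMr// ler_pdivrMr ?ltr_wpDl//.
  by rewrite mul1r lerDl.
move=> e0; have [b0 hb] := fc _ e0.
pose b := Num.max b0 y; have yb : y <= b by rewrite le_max lexx orbT.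
have [|fb1 _] := hb b; first by rewrite le_max lexx.
have bn := le_trans yn yb.
have h1 := bdd_clip bn Hf; have h2 := bdd_clip_sq bn Hf.
have h3 := bdd_rv_comp (pcut_cube_lip yn) (pcut_cube_bdd yn) Hf.
set c3 := l ^+ 3 / 6 * expR (l * y).
have c30 : 0 <= c3 by rewrite mulr_ge0 ?expR_ge0// divr_ge0 ?exprn_ge0.
have c20 : 0 <= l ^+ 2 / 2 by rewrite divr_ge0 ?sqr_ge0.
have h12 := bdd_rvD (bdd_rvZ l h1) (bdd_rvZ (l ^+ 2 / 2) h2).
have h123 := bdd_rvD h12 (bdd_rvZ c3 h3).
have hF := bdd_rvZ (expR (l * x - c)) (bdd_rvD h123 (bdd_rv_cst 1)).
apply: (le_trans (expect_le hK hF _)).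
  move=> w; rewrite (le_trans (sexp_le_exp _ _ _))//.
  rewrite (_ : l * (x + Num.min (f w) y) - c = (l * x - c) + l * Num.min (f w) y).
    rewrite expRD ler_wpM2l ?expR_ge0//.
    by have := expR_trunc_le (f w) l0 yn yb; rewrite -/c3; lra.
  by ring.
rewrite expectZ ?expR_ge0//; last exact: bdd_rvD h123 (bdd_rv_cst 1).
rewrite ler_wpM2l ?expR_ge0// expectDc//.
have := expectD_le h12 (bdd_rvZ c3 h3); have := expectD_le (bdd_rvZ l h1) (bdd_rvZ (l ^+ 2 / 2) h2).
rewrite !expectZ//.
have := ler_wpM2l c30 fb; have := ler_wpM2l c20 (fs b bn); have := ler_wpM2l l0 fb1.
rewrite /al /exp_rate -/c3; lra.
Qed.

(** Equals 1 minus the product of 1 - g (S i) over 1 <= i <= j: for Lipschitz g, a continuous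
    substitute for the event that some S i reaches the level, in place of a stopping time. *)
Fixpoint run_max (g : R -> R) (S : nat -> T -> R) (j : nat) (w : T) : R :=
  if j is i.+1 then run_max g S i w + (1 - run_max g S i w) * g (S j w) else 0.

Lemma run_max01 (g : R -> R) (S : nat -> T -> R) j w :
  (forall t, 0 <= g t <= 1) -> 0 <= run_max g S j w <= 1.
Proof.
move=> g01; elim: j => [|j /andP[h0 h1]]/=; first by rewrite lexx ler01.
have /andP[g0 g1] := g01 (S j.+1 w); apply/andP; split.
  by rewrite addr_ge0// mulr_ge0// subr_ge0.
suff : (1 - run_max g S j w) * g (S j.+1 w) <= (1 - run_max g S j w) * 1 by lra.
by rewrite ler_wpM2l// subr_ge0.
Qed.

Lemma run_max1 (g : R -> R) (S : nat -> T -> R) j n w : (0 < j)%N ->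
  (j <= n)%N -> g (S j w) = 1 -> run_max g S n w = 1.
Proof.
case: j => // j _; elim: n => // n IH; rewrite leq_eqVlt => /predU1P[[->]|jn] gj /=.
  by rewrite gj; ring.
by rewrite IH//; ring.
Qed.

(** Doob's inequality by backward recursion: W j + (1 - W j) K j (S j), with [K j] the exponential
    bound for the remaining n - j steps, has an expectation nonincreasing in j; it equals [K 0] at 0
    initially and dominates W n at the end. The gap between x' and x leaves room for a Lipschitz
    g. *)
Lemma iid_max_exp (Y : nat -> T -> R) (s y beta l x x' : R) n :
  iid_seq Y -> centered (Y 0%N) -> moment2_le (Y 0%N) s -> 0 < y -> 0 <= l ->
  0 <= beta -> expect (fun w => pcut y (Y 0%N w) ^+ 3) <= beta -> x' < x ->
  exists W : T -> R, [/\ bdd_rv W, forall w, 0 <= W w,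
    forall j w, (0 < j <= n)%N -> x <= \sum_(0 <= i < j) Num.min (Y i w) y ->
      W w = 1
    & expect W <= expR (n%:R * exp_rate l s y beta - l * x')].
Proof.
move=> Yi Yc Ys y0 l0 beta0 Yb xx'; have [HY _ _] := Yi.
set al := exp_rate _ _ _ _.
have al0 : 0 <= al.
  apply: addr_ge0; first by rewrite mulr_ge0 ?divr_ge0 ?sqr_ge0.
  by rewrite mulr_ge0// mulr_ge0 ?expR_ge0// divr_ge0 ?exprn_ge0.
pose g t : R := Num.min 1 (Num.max 0 ((t - x') / (x - x'))).
have D0 : 0 < x - x' by rewrite subr_gt0.
have g01 t : 0 <= g t <= 1.
  by rewrite /g le_min ler01 le_max lexx ge_min lexx.
have gl : lip g.
  exists (x - x')^-1; split; first by rewrite invr_ge0 ltW.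
  move=> t t'; rewrite /g ![Num.min 1 _]minC.
  apply: (@le_trans _ _ `|(t - x') / (x - x') - (t' - x') / (x - x')|).
    by rewrite (le_trans (min_dist _ _ _))// max0_lip.
  rewrite (_ : _ - _ = (x - x')^-1 * (t - t')); last by field; rewrite gt_eqF.
  by rewrite normrM gtr0_norm ?invr_gt0.
have gb : exists M, forall t, `|g t| <= M.
  by exists 1 => t; have /andP[? ?] := g01 t; rewrite ger0_norm.
have gx t : x <= t -> g t = 1.
  move=> xt; rewrite /g min_l// le_max; apply/orP; right.
  by rewrite ler_pdivlMr//; lra.
have gx' t : t <= x' -> g t = 0.
  move=> tx; rewrite /g max_l ?min_r//.
  by rewrite pmulr_lle0 ?invr_gt0//; lra.
pose S j w := \sum_(0 <= i < j) Num.min (Y i w) y.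
have Sl j : lip_in Y j (S j) := iid_lip_sum Y 0 (min_lip y) (leqnn j).
pose W := run_max g S.
have W01 j w : 0 <= W j w <= 1 by exact: run_max01.
have W10 j w : 0 <= 1 - W j w by have /andP[_] := W01 j w; rewrite subr_ge0.
have Wb j : bounded_fct (W j).
  by exists 1 => w; have /andP[? ?] := W01 j w; rewrite ger0_norm.
have Wl j : lip_in Y j (W j).
  elim: j => [|j IH]; first exact: lip_in_cst.
  have {}IH := lip_in_widen (leqnSn j) IH.
  apply: lip_inD => //; apply: lip_inM.
  - apply: bounded_fctD; first exact: bounded_fct_cst.
    by have [M hM] := Wb j; exists M => w; rewrite normrN.
  - exact: (@bounded_fct_comp _ _ g (S j.+1) gb).
  - apply: lip_inD; first exact: lip_in_cst.
    exact: (lip_in_comp lip_opp IH).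
  - exact: (lip_in_comp gl (Sl j.+1)).
have W1b j : bounded_fct (fun w => 1 - W j w).
  apply: bounded_fctD; first exact: bounded_fct_cst.
  by have [M hM] := Wb j; exists M => w; rewrite normrN.
have W1l j : lip_in Y j (fun w => 1 - W j w).
  apply: lip_inD; first exact: lip_in_cst.
  exact: (lip_in_comp lip_opp (Wl j)).
pose K j := sexp (l * x' - (n - j)%:R * al) l.
have Kl j : lip (K j) by exact: sexp_lip.
have Kb j : exists M, forall t, `|K j t| <= M by exact: sexp_bdd.
have hWK j : bdd_rv (fun w => W j w + (1 - W j w) * K j (S j w)).
  apply: (bdd_lip_in_rv Yi _ (_ : lip_in Y j _)).
    by apply: bounded_fctD => //; apply: bounded_fctM => //; exact: (@bounded_fct_comp _ _ (K j) (S j) (Kb j)).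
  apply: lip_inD => //; apply: lip_inM => //; first exact: (@bounded_fct_comp _ _ (K j) (S j) (Kb j)).
  exact: (lip_in_comp (Kl j) (Sl j)).
have step j : (j < n)%N ->
    expect (fun w => W j.+1 w + (1 - W j.+1 w) * K j.+1 (S j.+1 w)) <=
    expect (fun w => W j w + (1 - W j w) * K j (S j w)).
  move=> jn; rewrite (_ : (fun w => _) =
      fun w => W j w + (1 - W j w) * K j.+1 (S j w + Num.min (Y j w) y)).
    rewrite (iid_step Yi (Wb j) (Wl j) (W1b j) (W1l j) (W10 j) (Sl j) (Kl j.+1)
      (Kb j.+1) (min_lip y)).
    apply: expect_le => //.
      have kl := expect_kernel_lip (Kl j.+1) (Kb j.+1) (min_lip y) (HY 0%N).
      have kb := expect_kernel_bdd (Kl j.+1) (Kb j.+1) (min_lip y) (HY 0%N).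
      apply: (bdd_lip_in_rv Yi _ (_ : lip_in Y j _)).
        by apply: bounded_fctD => //; apply: bounded_fctM => //; exact: (@bounded_fct_comp _ _ _ (S j) kb).
      apply: lip_inD => //; apply: lip_inM => //; first exact: (@bounded_fct_comp _ _ _ (S j) kb).
      exact: (lip_in_comp kl (Sl j)).
    move=> w; rewrite lerD2l ler_wpM2l//.
    rewrite /K (le_trans (expect_sexp_le _ _ (HY 0%N) Yc Ys y0 l0 Yb))// -/al.
    rewrite (_ : l * x' - (n - j.+1)%:R * al - al = l * x' - (n - j)%:R * al)//.
    by rewrite -(subnSK jn) -natr1; ring.
  apply/funext => w; rewrite {1 2}/W/= -/(W j w).
  have -> : S j.+1 w = S j w + Num.min (Y j w) y by rewrite /S big_nat_recr.
  (* The identity g + (1 - g) K = K holds at t: either g = 0, or t > x' and then K = 1. *)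
  set t := S j w + _; have [/gx' ->|x't] := leP t x'; first by ring.
  have -> : K j.+1 t = 1.
    rewrite /K /sexp max_l ?oppr0 ?expR0//.
    have : l * x' <= l * t by rewrite ler_wpM2l// ltW.
    by move: (mulr_ge0 (ler0n R (n - j.+1)) al0); move: (_ * al) => q; lra.
  by ring.
have iter j : (j <= n)%N -> expect (W n) <= expect (fun w => W (n - j)%N w + (1 - W (n - j)%N w) * K (n - j)%N (S (n - j)%N w)).
  elim: j => [_|j IH jn].
    rewrite subn0; apply: expect_le => //; first exact: (bdd_lip_in_rv Yi (Wb n) (Wl n)).
    by move=> w; rewrite lerDl mulr_ge0 ?sexp_ge0.
  rewrite (le_trans (IH (ltnW jn)))//.
  have e : (n - j = (n - j.+1).+1)%N by rewrite subnSK.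
  by rewrite e; apply: step; rewrite -e leq_subr.
exists (W n); split.
- exact: (bdd_lip_in_rv Yi (Wb n) (Wl n)).
- by move=> w; have /andP[] := W01 n w.
- by move=> j w /andP[j0 jn] /gx gS; exact: run_max1 gS.
- rewrite (le_trans (iter n (leqnn n)))// subnn.
  under eq_fun do rewrite /W/= add0r subr0 mul1r /S big_geq//.
  rewrite expect_cst /K (le_trans (sexp_le_exp _ _ _))// ler_expR subn0; lra.
Qed.

(** * Lipschitz tails and the third moment they control *)

Definition ramp (a x : R) : R := Num.min 1 (Num.max 0 (2 * `|x| / a - 1)).

Lemma ramp01 a x : 0 <= ramp a x <= 1.
Proof. by rewrite /ramp le_min ler01 le_max lexx ge_min lexx. Qed.

Lemma ramp1 a x : 0 < a -> a <= `|x| -> ramp a x = 1.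
Proof.
move=> a0 ax; rewrite /ramp min_l// le_max; apply/orP; right.
by rewrite lerBrDr ler_pdivlMr//; lra.
Qed.

Lemma ramp0 a x : 0 < a -> `|x| <= a / 2 -> ramp a x = 0.
Proof.
move=> a0 ax; rewrite /ramp max_l ?min_r//.
by rewrite lerBlDr ler_pdivrMr//; lra.
Qed.

Lemma ramp_lip a : 0 < a -> lip (ramp a).
Proof.
move=> a0; exists (2 / a); split; first by rewrite divr_ge0 ?ltW.
move=> x y; rewrite /ramp ![Num.min 1 _]minC (le_trans (min_dist _ _ _))//.
rewrite (le_trans (max0_lip _ _))//.
rewrite (_ : _ - _ = 2 / a * (`|x| - `|y|)); last by ring.
rewrite normrM ger0_norm ?divr_ge0 ?(ltW a0)// ler_wpM2l ?divr_ge0 ?(ltW a0)//.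
exact: ler_dist_dist.
Qed.

Lemma ramp_bdd a : exists M, forall x, `|ramp a x| <= M.
Proof. by exists 1 => x; have /andP[? ?] := ramp01 a x; rewrite ger0_norm. Qed.

Definition tail f (a : R) : R := expect (fun w => ramp a (f w)).

Definition scale (c : R) (k : nat) : R := c * Num.sqrt (2 ^+ k * lnk R k).

(** The Choquet condition in Lipschitz form: [ramp a] lies between the indicators of |x| >= a and of
    |x| > a / 2, and [scale c k] has the order of [lil] at 2^k. *)
Definition tail_cond f := forall c : R, 0 < c ->
  bounded_sums (fun k => 2 ^+ k * tail f (scale c k)).

Lemma scale_gt0 c k : 0 < c -> 0 < scale c k.
Proof. by move=> c0; rewrite mulr_gt0// sqrtr_gt0 mulr_gt0 ?exprn_gt0 ?lnk_gt0. Qed.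

Lemma bdd_ramp a f : 0 < a -> H f -> bdd_rv (fun w => ramp a (f w)).
Proof. by move=> a0 Hf; apply: bdd_rv_comp (ramp_lip a0) (ramp_bdd a) Hf. Qed.

Lemma tail_ge0 f a : 0 < a -> H f -> 0 <= tail f a.
Proof.
move=> a0 Hf; apply: (expect_ge0 (bdd_ramp a0 Hf)) => w.
by have /andP[] := ramp01 a (f w).
Qed.

Lemma pcut_cube_ramp (y y' x : R) : 0 < y -> y <= y' ->
  pcut y' x ^+ 3 <= pcut y x ^+ 3 + y' ^+ 3 * ramp y x.
Proof.
move=> y0 yy'; have y'0 := lt_le_trans y0 yy'.
have [xy|yx] := leP x y.
  rewrite (_ : pcut y' x = pcut y x); last first.
    rewrite /pcut !min_l//; rewrite ge_max; apply/andP; split; lra.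
  by rewrite lerDl mulr_ge0 ?exprn_ge0 ?(ltW y'0)//; have /andP[] := ramp01 y x.
rewrite ramp1//; last by rewrite gtr0_norm ?(ltW yx)// (lt_trans y0).
rewrite mulr1 (le_trans (y := y' ^+ 3))// ?lerDr ?exprn_ge0//.
  rewrite lerXn2r ?nnegrE ?(ltW y'0)// ?ge_min ?lexx ?orbT//.
  by rewrite le_min (ltW y'0) le_max lexx.
by rewrite le_min (ltW y0) le_max lexx.
Qed.

(** Splitting over dyadic levels gives the recursion of [B]. Since y grows by at least sqrt 2 per
    step, 2^k B k / y k^3 contracts by 2^(-1/2) < 3/4 up to a summable tail term, and
    [bounded_sums_contract] applies. *)
Lemma tail_cond_third_moment f (c : R) : H f -> tail_cond f -> 0 < c ->
  exists D : nat -> R, [/\ forall k, 0 < D k, bounded_sums D &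
    forall k, 2 ^+ k * expect (fun w => pcut (scale c k) (f w) ^+ 3) <=
              D k * scale c k ^+ 3].
Proof.
move=> Hf ft c0; pose y := scale c; have y0 k : 0 < y k by exact: scale_gt0.
pose B := fix B k := if k is i.+1 then B i + y k ^+ 3 * tail f (y i) else y 0%N ^+ 3.
have yS k : 2 * y k ^+ 2 <= y k.+1 ^+ 2.
  rewrite /y /scale !exprMn !sqr_sqrtr ?mulr_ge0 ?exprn_ge0 ?lnk_ge0//.
  have h : 0 <= c ^+ 2 * 2 ^+ k :> R by rewrite mulr_ge0 ?sqr_ge0 ?exprn_ge0.
  have := ler_wpM2l h (@lnk_leS R k); rewrite (exprS _ k).
  by move: (_ ^+ k) (lnk R k) (lnk R k.+1) => p q r; lra.
have yle k : y k <= y k.+1.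
  rewrite -(@ler_pXn2r _ 2) ?nnegrE ?(ltW (y0 _))//.
  by have := yS k; have := sqr_ge0 (y k); lra.
have B0 k : 0 < B k.
  elim: k => [|k IH] /=; first by rewrite exprn_gt0.
  by rewrite ltr_wpDr// mulr_ge0 ?exprn_ge0 ?(ltW (y0 _))// tail_ge0.
have fB k : expect (fun w => pcut (y k) (f w) ^+ 3) <= B k.
  elim: k => [|k IH].
    rewrite -[leRHS]expect_cst; apply: expect_le.
    - exact: bdd_rv_comp (pcut_cube_lip (ltW (y0 _))) (pcut_cube_bdd (ltW (y0 _))) Hf.
    - exact: bdd_rv_cst.
    - move=> w; rewrite lerXn2r ?nnegrE ?(ltW (y0 _))// ?ge_min ?lexx ?orbT//.
      by rewrite le_min (ltW (y0 _)) le_max lexx.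
  have h1 := bdd_rv_comp (pcut_cube_lip (ltW (y0 k.+1))) (pcut_cube_bdd (ltW (y0 k.+1))) Hf.
  have h2 := bdd_rv_comp (pcut_cube_lip (ltW (y0 k))) (pcut_cube_bdd (ltW (y0 k))) Hf.
  have h3 := bdd_rvZ (y k.+1 ^+ 3) (bdd_ramp (y0 k) Hf).
  apply: (le_trans (expect_le h1 (bdd_rvD h2 h3)
    (fun w => pcut_cube_ramp (f w) (y0 k) (yle k)))).
  rewrite (le_trans (expectD_le h2 h3))//= lerD//.
  by rewrite expectZ ?exprn_ge0 ?(ltW (y0 _))//; exact: bdd_ramp.
have q0 k : 0 < 2 ^+ k * B k / y k ^+ 3.
  apply: divr_gt0; last exact: exprn_gt0 (y0 k).
  by apply: mulr_gt0; [exact: exprn_gt0|exact: B0].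
exists (fun k => 2 ^+ k * B k / y k ^+ 3); split => //.
- apply: (@bounded_sums_contract _ _ (fun k => 2 * (2 ^+ k * tail f (y k))) (3 / 4)).
  + lra.
  + lra.
  + move=> k /=.
    pose r := y k / y k.+1.
    have r0 : 0 <= r by rewrite divr_ge0 ?(ltW (y0 _)).
    have r2 : r ^+ 2 <= 1 / 2.
      rewrite expr_div_n ler_pdivrMr ?exprn_gt0//; have := yS k; lra.
    have r34 : 2 * r ^+ 3 <= 3 / 4.
      have r1 : r <= 3 / 4.
        rewrite -(@ler_pXn2r _ 2) ?nnegrE//; lra.
      have := ler_pM (sqr_ge0 r) r0 r2 r1; rewrite -exprSr; lra.
    have -> : 2 ^+ k.+1 * (B k + y k.+1 ^+ 3 * tail f (y k)) / y k.+1 ^+ 3 =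
        2 * r ^+ 3 * (2 ^+ k * B k / y k ^+ 3) + 2 * (2 ^+ k * tail f (y k)).
      by rewrite /r exprS; field; rewrite !gt_eqF.
    by rewrite lerD2r ler_wpM2r// (ltW (q0 k)).
  + by move=> k; exact: ltW (q0 k).
  + by apply: bounded_sumsZ => //; exact: ft.
- move=> k; rewrite -/(y k) mulfVK ?expf_neq0 ?gt_eqF//.
  by rewrite ler_wpM2l ?exprn_ge0.
Qed.

(** * Null sets of the outer capacity *)

Lemma hatV_ge0 (A : set T) : (0 <= hatV H E A)%E.
Proof.
apply: le_ereal_inf_tmp => _ [xi [Hxi Axi] <-].
rewrite -[leLHS](sle_cst Es 0); apply: (sle_monotone Es (rv_cst 0) Hxi) => w.
by rewrite (le_trans _ (Axi w))//; exact: indic_ge0.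
Qed.

Lemma hatV_ge1_le (xi : T -> R) : bdd_rv xi -> (forall w, 0 <= xi w) ->
  (hatV H E [set w | (1 <= xi w)%R] <= (expect xi)%:E)%E.
Proof.
move=> hxi xi0; rewrite -expectE//; apply: ereal_inf_lbound.
exists xi => //; split; first by case: hxi.
move=> w; rewrite indicE; case: (boolP (w \in _)) => //.
by rewrite inE.
Qed.

Lemma measurable_rv_ge1 (xi : T -> R) : H xi -> measurable [set w | 1 <= xi w].
Proof.
move=> /(rvs_measurable Hs) mxi; rewrite -[X in measurable X]setTI.
rewrite (_ : [set w | 1 <= xi w] = xi @^-1` `[1, +oo[); first exact: mxi.
by apply/seteqP; split => w /=; rewrite in_itv/= andbT.
Qed.

(** By conversion this is the outer measure generated by [hatV], which brings monotonicity and
    countable sub-additivity although [hatV] need not be additive. *)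
Lemma hatVstarE : hatVstar H E = mu_ext (hatV H E).
Proof. by []. Qed.

Lemma hatV_set0 : hatV H E set0 = 0%E.
Proof.
apply/eqP; rewrite eq_le hatV_ge0 andbT -[leRHS](sle_cst Es 0).
apply: ereal_inf_lbound; exists (fun=> 0) => //; split; first exact: rv_cst.
by move=> w; rewrite indic0.
Qed.

Definition null_set (A : set T) := hatVstar H E A = 0%E.

Lemma null_setP (A : set T) : null_set A <-> (hatVstar H E A <= 0)%E.
Proof.
split=> [->//|A0]; apply/eqP; rewrite eq_le A0 hatVstarE/=.
by apply: mu_ext_ge0 => ?; exact: hatV_ge0.
Qed.

Lemma null_set_sub (A B : set T) : A `<=` B -> null_set B -> null_set A.
Proof.
move=> AB B0; apply/null_setP; rewrite -B0 !hatVstarE; exact: le_mu_ext.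
Qed.

Lemma null_set_bigcup (A : nat -> set T) : (forall n, null_set (A n)) ->
  null_set (\bigcup_n A n).
Proof.
move=> A0; apply/null_setP; rewrite hatVstarE.
rewrite (le_trans (mu_ext_sigma_subadditive hatV_ge0 _))//.
by rewrite eseries0// => n _ _; exact: A0.
Qed.

Lemma null_setU (A B : set T) : null_set A -> null_set B -> null_set (A `|` B).
Proof.
move=> A0 B0; rewrite -bigcup2E; apply: null_set_bigcup => -[|[|n]] //=.
by apply/null_setP; rewrite hatVstarE mu_ext0//; [exact: hatV_set0|exact: hatV_ge0].
Qed.

(** Sets of the form {xi k >= 1} serve as the cover: they are measurable, and [hatV_ge1_le] is
    Markov's inequality for them. *)
Lemma null_set_bound (A : set T) :
  (forall eps, 0 < eps -> exists xi : nat -> T -> R,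
    [/\ forall k, bdd_rv (xi k), forall k w, 0 <= xi k w,
        forall N, \sum_(0 <= k < N) expect (xi k) <= eps
      & forall w, A w -> exists k, 1 <= xi k w]) -> null_set A.
Proof.
move=> h; apply/null_setP/lee_addgt0Pr => eps e0; rewrite add0e.
have [xi [xib xi0 xis Axi]] := h _ e0.
apply: (@le_trans _ _ (\sum_(k <oo) hatV H E [set w | (1 <= xi k w)%R])%E).
  apply: ereal_inf_lbound; exists (fun k => [set w | 1 <= xi k w]) => //; split.
    by move=> k; apply: measurable_rv_ge1; case: (xib k).
  by move=> w /Axi[k xk]; exists k.
apply: lime_le; first by apply: is_cvg_nneseries => n _ _; exact: hatV_ge0.
apply: nearW => N; apply: (@le_trans _ _ (\sum_(0 <= k < N) expect (xi k))%:E).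
  by rewrite -sumEFin; apply: lee_sum => k _; exact: hatV_ge1_le.
by rewrite lee_fin.
Qed.

Lemma borel_cantelli (xi : nat -> T -> R) :
  (forall k, bdd_rv (xi k)) -> (forall k w, 0 <= xi k w) ->
  bounded_sums (fun k => expect (xi k)) ->
  null_set [set w | forall K, exists2 k, (K <= k)%N & 1 <= xi k w].
Proof.
move=> xib xi0 xis; apply: null_set_bound => eps e0.
have [K hK] := bounded_sums_tail (fun k => expect_ge0 (xib k) (xi0 k)) xis e0.
exists (fun k => xi (K + k)%N); split => // w /(_ K)[k Kk xk].
by exists (k - K)%N; rewrite subnKC.
Qed.

Lemma null_set_small (A : set T) :
  (forall eps, 0 < eps -> exists xi : T -> R,
    [/\ bdd_rv xi, forall w, 0 <= xi w, expect xi <= eps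
      & forall w, A w -> 1 <= xi w]) -> null_set A.
Proof.
move=> h; apply: null_set_bound => eps e0; have [xi [xib xi0 xie Axi]] := h _ e0.
exists (fun k => if k is 0%N then xi else fun=> 0); split.
- by case=> [|k]; [exact: xib|exact: (bdd_rv_cst 0)].
- by case.
- case=> [|N]; first by rewrite big_geq// ltW.
  rewrite big_nat_recl//= big1 ?addr0// => i _; exact: expect_cst.
- by move=> w Aw; exists 0%N; exact: Axi.
Qed.

(** Either a single variable exceeds y, which the sum of ramps counts, or the sums coincide with
    those cut at y and the maximal inequality applies. The cut y is a quarter of the level x', which
    balances the two constraints on l. *)
Lemma iid_upper_event (Y : nat -> T -> R) (s eps D : R) (a k : nat) :
  iid_seq Y -> centered (Y 0%N) -> moment2_le (Y 0%N) s -> 0 < s ->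
  (0 < a)%N -> 0 < eps -> 0 < D ->
  let c0 := (1 + eps) * s * Num.sqrt (2 * a%:R) in
  2 ^+ k * expect (fun w => pcut (scale (c0 / 4) k) (Y 0%N w) ^+ 3) <=
    D * scale (c0 / 4) k ^+ 3 ->
  exists xi : T -> R, [/\ bdd_rv xi, forall w, 0 <= xi w,
    forall w j, (0 < j <= a * 2 ^ k)%N ->
      (1 + eps) * scale c0 k <= \sum_(0 <= i < j) Y i w -> 1 <= xi w
    & expect xi <= 3 * (expR (- ((1 + eps) ^+ 2 * lnk R k)) + a%:R * D) +
        a%:R * (2 ^+ k * tail (Y 0%N) (scale (c0 / 4) k))].
Proof.
move=> Yi Yc Ys s0 a0 e0 D0 c0 hD; have [HY _ Yid] := Yi.
have aR : 0 < a%:R :> R by rewrite ltr0n.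
have c00 : 0 < c0 by rewrite !mulr_gt0 ?sqrtr_gt0 ?mulr_gt0//; lra.
have c40 : 0 < c0 / 4 by rewrite divr_gt0.
set y := scale (c0 / 4) k in hD *.
have y0 : 0 < y by exact: scale_gt0.
have xE : scale c0 k = 4 * y by rewrite /y /scale; field.
have xE2 : scale c0 k ^+ 2 = (1 + eps) ^+ 2 * s ^+ 2 * (2 * a%:R) * (2 ^+ k * lnk R k).
  rewrite /scale /c0 !exprMn !sqr_sqrtr ?mulr_ge0 ?exprn_ge0 ?lnk_ge0 ?(ltW aR)//.
move: xE2; rewrite xE => xE2; clearbody y; set x' := 4 * y; have x'0 : 0 < x' by rewrite mulr_gt0.
have tl0 : 0 <= tail (Y 0%N) y by exact: tail_ge0.
(* If a D >= 1, the constant 1 is already small enough; otherwise ln (a D) is negative and can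
   define [l2]. *)
have [d1|d1] := leP 1 (a%:R * D).
  exists (fun=> 1); split; [exact: bdd_rv_cst|by []|by []|].

  rewrite expect_cst; have : 0 <= expR (- ((1 + eps) ^+ 2 * lnk R k)) by exact: expR_ge0.
  have : 0 <= a%:R * (2 ^+ k * tail (Y 0%N) y) by rewrite !mulr_ge0 ?exprn_ge0.
  lra.
set dd := a%:R * D in d1 *; have dd0 : 0 < dd by rewrite mulr_gt0.
have lnd : ln dd < 0 by rewrite ln_lt0// dd0.
set n := (a * 2 ^ k)%N.
have nE : n%:R = a%:R * 2 ^+ k :> R by rewrite natrM natrX.
have n0 : 0 < n%:R :> R by rewrite nE mulr_gt0 ?exprn_gt0.
pose b := expect (fun w => pcut y (Y 0%N w) ^+ 3).
have b0 : 0 <= b.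
  apply: (expect_ge0 (bdd_rv_comp (pcut_cube_lip (ltW y0)) (pcut_cube_bdd (ltW y0)) (HY 0%N))).
  by move=> w; rewrite exprn_ge0// le_min (ltW y0) le_max lexx.
have nb : n%:R * b <= dd * y ^+ 3.
  by rewrite nE /dd -!mulrA ler_wpM2l// ltW.
have ns0 : 0 < n%:R * s ^+ 2 by rewrite mulr_gt0 ?exprn_gt0.
(* [l1] minimizes the Gaussian exponent and yields (1 + eps)^2 [lnk k]; [l2] makes exp (2 l y) at
   most 1 / dd, so that the cubic term stays below 1, and x' = 4 y gives exp (- l2 x' / 2) = dd. *)
pose l1 := x' / (n%:R * s ^+ 2); pose l2 := - ln dd / (2 * y).
have l10 : 0 <= l1 by rewrite divr_ge0 ?(ltW x'0) ?(ltW ns0).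
have l20 : 0 <= l2.
  by rewrite divr_ge0 ?oppr_ge0 ?(ltW lnd)// mulr_ge0 ?(ltW y0).
pose l := Num.min l1 l2.
have l0 : 0 <= l by rewrite le_min l10 l20.
have xx' : x' < (1 + eps) * x' by rewrite ltr_pMl// ltrDl.
have [W [Wb W0 W1 We]] := iid_max_exp n Yi Yc Ys y0 l0 b0 (lexx _) xx'.
have expo : n%:R * exp_rate l s y b - l * x' <= 1 - l * x' / 2.
  have h1 : n%:R * (l ^+ 2 / 2 * s ^+ 2) <= l * x' / 2.
    have : l * (l * (n%:R * s ^+ 2)) <= l * x'.
      by rewrite ler_wpM2l// -ler_pdivlMr// ge_min lexx.
    lra.
  have h2 : n%:R * (l ^+ 3 / 6 * expR (l * y) * b) <= 1.
    have ly0 : 0 <= l * y by rewrite mulr_ge0 ?(ltW y0).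
    have q1 : (l * y) ^+ 3 / 6 <= expR (l * y).
      by have := @expR_ge1Dxn R (l * y) 2 ly0; rewrite /= (_ : 3`!%:R = 6 :> R)//; lra.
    have q2 : expR (l * y) * expR (l * y) <= dd^-1.
      rewrite -expRD -[leRHS]lnK ?posrE ?invr_gt0// ler_expR lnV ?posrE//.
      have : l <= l2 by rewrite ge_min lexx orbT.
      rewrite /l2 ler_pdivlMr ?mulr_gt0//; lra.
    have q3 : l ^+ 3 / 6 * expR (l * y) * (n%:R * b) <= l ^+ 3 / 6 * expR (l * y) * (dd * y ^+ 3).
      by rewrite ler_wpM2l// mulr_ge0 ?expR_ge0// divr_ge0 ?exprn_ge0.
    have q4 : dd * ((l * y) ^+ 3 / 6 * expR (l * y)) <= dd * (expR (l * y) * expR (l * y)).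
      by rewrite ler_wpM2l ?(ltW dd0)// ler_wpM2r ?expR_ge0.
    have q5 : dd * (expR (l * y) * expR (l * y)) <= 1.
      by rewrite -ler_pdivlMl// mulr1.
    move: q3 q4; rewrite exprMn; lra.
  by rewrite /exp_rate mulrDr; lra.
have Wd : expect W <= 3 * (expR (- ((1 + eps) ^+ 2 * lnk R k)) + dd).
  rewrite (le_trans We)//.
  apply: (@le_trans _ _ (expR 1 * expR (- (l * x' / 2)))); first by rewrite -expRD ler_expR.
  rewrite ler_pM ?expR_ge0 ?expR1_le3//.
  have [l12|l21] := leP l1 l2.
    rewrite /l (min_l l12) ler_wpDr ?(ltW dd0)// ler_expR lerN2.
    rewrite /l1 (_ : x' / _ * x' / 2 = x' ^+ 2 / (2 * (n%:R * s ^+ 2))); last first.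
      by field; rewrite !gt_eqF.
    rewrite /x' xE2 ler_pdivlMr ?(mulr_gt0 _ ns0)// nE.
    by move: (lnk R k) (_ ^+ k) => p q; lra.

  rewrite /l (min_r (ltW l21)) ler_wpDl ?expR_ge0//.
  rewrite /l2 /x' (_ : - (_ / 2) = ln dd) ?lnK ?posrE//.
  by field; rewrite gt_eqF.
pose G w := \sum_(0 <= i < n) ramp y (Y i w).
have Gb : bdd_rv G by apply: bdd_rv_sum => i _; exact: bdd_ramp.
exists (fun w => W w + G w); split.
- exact: bdd_rvD.
- move=> w; rewrite addr_ge0// sumr_ge0// => i _.
  by have /andP[] := ramp01 y (Y i w).
- move=> w j /andP[j0 jn] hj.
  have G0 : 0 <= G w by rewrite sumr_ge0// => i _; have /andP[] := ramp01 y (Y i w).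
  have [/hasP[i]|/hasPn hi] := boolP (has (fun i => y < Y i w) (index_iota 0 j)).
    rewrite mem_index_iota => /andP[_ ij] yi.
    have iN : i \in index_iota 0 n by rewrite mem_index_iota (leq_trans ij).
    apply: (@le_trans _ _ (G w)); last by rewrite lerDr.
    rewrite /G (bigD1_seq i)//= ?iota_uniq// ramp1//; last by rewrite gtr0_norm ?(ltW yi) ?(lt_trans y0).
    rewrite lerDl sumr_ge0// => i' _.
    by have /andP[] := ramp01 y (Y i' w).
  rewrite (W1 j w); first by rewrite lerDl.
    by rewrite j0.
  rewrite (le_trans hj)// big_nat [leRHS]big_nat le_eqVlt; apply/orP; left; apply/eqP.
  apply: eq_bigr => i; rewrite -mem_index_iota => /hi.
  by rewrite -leNgt => /min_l.
- rewrite (le_trans (expectD_le Wb Gb))// lerD//.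
  rewrite (le_trans (expect_sum_le _ _))//; first by move=> i _; exact: bdd_ramp.
  rewrite (eq_bigr (fun=> tail (Y 0%N) y)); last first.
    by move=> i _; rewrite /tail; apply: Yid; [exact: ramp_lip|exact: ramp_bdd].
  by rewrite sumr_const_nat subn0 -[_ *+ n]mulr_natl nE mulrA.
Qed.

Lemma iid_upper_dyadic (Y : nat -> T -> R) (s eps : R) (a : nat) :
  iid_seq Y -> centered (Y 0%N) -> moment2_le (Y 0%N) s -> 0 < s ->
  tail_cond (Y 0%N) -> (0 < a)%N -> 0 < eps ->
  null_set [set w | forall K, exists2 k, (K <= k)%N &
    exists2 j, (0 < j <= a * 2 ^ k)%N &
      (1 + eps) ^+ 2 * s * Num.sqrt (2 * a%:R * (2 ^+ k * lnk R k)) <=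
      \sum_(0 <= i < j) Y i w].
Proof.
move=> Yi Yc Ys s0 Yt a0 e0; have [HY _ _] := Yi.
have aR : 0 < a%:R :> R by rewrite ltr0n.
pose c0 := (1 + eps) * s * Num.sqrt (2 * a%:R).
have c00 : 0 < c0 by rewrite !mulr_gt0 ?sqrtr_gt0 ?mulr_gt0//; lra.
have c40 : 0 < c0 / 4 by rewrite divr_gt0.
have [D [D0 Ds DE]] := tail_cond_third_moment (HY 0%N) Yt c40.
have /choice[xi Hxi] k :=
  iid_upper_event Yi Yc Ys s0 a0 e0 (D0 k) (DE k).
apply: (@null_set_sub _ [set w | forall K, exists2 k, (K <= k)%N & 1 <= xi k w]).
  move=> w /= h K; have [k Kk [j ja hj]] := h K; exists k => //.
  have [_ _ hx _] := Hxi k; apply: (hx w j ja).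
  rewrite (le_trans _ hj)// /scale /c0.
  rewrite (_ : Num.sqrt (2 * a%:R * (2 ^+ k * lnk R k)) =
    Num.sqrt (2 * a%:R) * Num.sqrt (2 ^+ k * lnk R k)).
    by move: (Num.sqrt (2 * _)) (Num.sqrt (_ * lnk R k)) => p q; lra.
  by apply: sqrtrM; rewrite mulr_ge0 ?(ltW aR).
apply: borel_cantelli.
- by move=> k; have [] := Hxi k.
- by move=> k; have [] := Hxi k.
- apply: (@bounded_sums_le _ _ (fun k =>
    3 * (expR (- ((1 + eps) ^+ 2 * lnk R k)) + a%:R * D k) +
    a%:R * (2 ^+ k * tail (Y 0%N) (scale (c0 / 4) k)))).
    by move=> k; have [] := Hxi k.
  apply: bounded_sumsD; last by apply: bounded_sumsZ (Yt _ c40); exact: ltW.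
  apply: bounded_sumsZ => //; apply: bounded_sumsD; last first.
    by apply: bounded_sumsZ Ds; exact: ltW.
  rewrite (_ : (1 + eps) ^+ 2 = 1 + (2 * eps + eps ^+ 2)); last by ring.
  by apply: bounded_sums_lnk; rewrite addr_gt0 ?mulr_gt0 ?exprn_gt0.
Qed.

(** Each time is compared with a grid point (a + 1) 2^k, J <= a < 2 J, at most a factor 1 + de above
    it; the exceptional sets are indexed by a alone, hence countable. *)
Lemma iid_upper (Y : nat -> T -> R) (s eps : R) :
  iid_seq Y -> centered (Y 0%N) -> moment2_le (Y 0%N) s -> 0 < s ->
  tail_cond (Y 0%N) -> 0 < eps ->
  null_set [set w | ~ exists N0, forall n, (N0 <= n)%N ->
    \sum_(0 <= i < n) Y i w <= (1 + eps) * s * lil R n].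
Proof.
move=> Yi Yc Ys s0 Yt e0.
(* For de <= 1, (1 + de)^3 <= 1 + 7 de: two factors come from [iid_upper_dyadic], the third from the
   grid together with the replacement of [lnk k] by log log n. *)
pose de := Num.min 1 eps / 7.
have m0 : 0 < Num.min 1 eps by rewrite lt_min ltr01 e0.
have d0 : 0 < de by rewrite divr_gt0.
have d1 : de <= 1.
  by have : Num.min 1 eps <= 1; [rewrite ge_min lexx|rewrite /de; lra].
have d7 : 7 * de <= eps.
  by have : Num.min 1 eps <= eps; [rewrite ge_min lexx orbT|rewrite /de; lra].
clearbody de.
have de1 : (1 + de) ^+ 3 <= 1 + eps.
  have h2 : de * de <= de by rewrite ger_pMr.
  have h3 : de * (de * de) <= de by rewrite ger_pMr// (le_trans h2).
  have -> : (1 + de) ^+ 3 = 1 + 3 * de + 3 * (de * de) + de * (de * de) by ring.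
  lra.
have [J hJ] := natr_ge (Num.max 1 de^-1).
have [J1 Jd] : 1 <= J%:R :> R /\ de^-1 <= J%:R by move: (hJ J (leqnn _)); rewrite ge_max => /andP[].
have J0 : (0 < J)%N by rewrite -(ltr_nat R) (lt_le_trans ltr01).
have [K1 hK1] := lnk_le_loglog d0.
pose A a := [set w | forall K, exists2 k, (K <= k)%N &
    exists2 j, (0 < j <= a.+1 * 2 ^ k)%N &
      (1 + de) ^+ 2 * s * Num.sqrt (2 * a.+1%:R * (2 ^+ k * lnk R k)) <=
      \sum_(0 <= i < j) Y i w].
apply: (@null_set_sub _ (\bigcup_a A a)); last first.
  by apply: null_set_bigcup => a; exact: iid_upper_dyadic.
move=> w /= h; apply: contrapT => nA; apply: h.
have /choice[Ka hKa] a : exists K, forall k, (K <= k)%N -> forall j,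
    (0 < j <= a.+1 * 2 ^ k)%N -> \sum_(0 <= i < j) Y i w <
      (1 + de) ^+ 2 * s * Num.sqrt (2 * a.+1%:R * (2 ^+ k * lnk R k)).
  apply: contrapT => nK; apply: nA; exists a => // K.
  apply: contrapT => nk; apply: nK; exists K => k Kk j ja.
  by rewrite ltNge; apply/negP => hj; apply: nk; exists k => //; exists j.
pose K := maxn K1 (\max_(a < (2 * J).+1) Ka a).
exists (J * 2 ^ K)%N => n Kn.
pose k := trunc_log 2 (n %/ J).
have nJ : (2 ^ K <= n %/ J)%N by rewrite leq_divRL// mulnC.
have nJ0 : (0 < n %/ J)%N by rewrite (leq_trans _ nJ)// expn_gt0.
have /andP[k1 k2] := @trunc_log_bounds 2 (n %/ J) isT nJ0.
rewrite -/k in k1 k2.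
have Kk : (K <= k)%N by rewrite -ltnS -(@ltn_exp2l 2)// (leq_ltn_trans nJ).
have p0 : (0 < 2 ^ k)%N by rewrite expn_gt0.
pose a := (n %/ 2 ^ k)%N.
have aJ : (J <= a)%N by rewrite leq_divRL// mulnC -leq_divRL.
have a2J : (a < 2 * J)%N by rewrite ltn_divLR// -mulnA (mulnC J) mulnA -expnS -ltn_divLR.
have na : (n < a.+1 * 2 ^ k)%N by rewrite -ltn_divLR.
have an : (a * 2 ^ k <= n)%N by rewrite -leq_divRL.
have Kak : (Ka a <= k)%N.
  rewrite (leq_trans _ Kk)// /K leq_max; apply/orP; right.
  have a2J' : (a < (2 * J).+1)%N by rewrite ltnW.
  exact: (@leq_bigmax _ (fun i : 'I_(2 * J).+1 => Ka i) (Ordinal a2J')).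
have n0 : (0 < n)%N by rewrite (leq_trans _ an)// muln_gt0 p0 (leq_trans J0).
have := hKa a k Kak n; rewrite n0 (ltnW na) => /(_ isT) /ltW /le_trans; apply.
have kn : (2 ^ k <= n)%N by rewrite (leq_trans k1)// leq_div.
have := hK1 k n (leq_trans (leq_maxl _ _) Kk) kn => hl.
apply: (@le_trans _ _ ((1 + de) ^+ 2 * s * ((1 + de) * lil R n))); last first.
  rewrite mulrA ler_wpM2r ?lil_ge0// mulrAC ler_wpM2r ?(ltW s0)//.
  by rewrite -exprSr.
have d10 : 0 <= 1 + de by lra.
rewrite ler_wpM2l ?mulr_ge0 ?exprn_ge0 ?(ltW s0)//.
rewrite -(@ler_pXn2r _ 2) ?nnegrE ?sqrtr_ge0 ?mulr_ge0 ?lil_ge0//.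
rewrite exprMn lil_sqr sqr_sqrtr ?mulr_ge0 ?exprn_ge0 ?lnk_ge0//.
have h1 : a.+1%:R * 2 ^+ k <= (1 + de) * n%:R :> R.
  apply: (@le_trans _ _ ((1 + de) * (a * 2 ^ k)%:R)); last by rewrite ler_wpM2l// ler_nat.
  rewrite natrM natrX mulrA ler_wpM2r ?exprn_ge0// -natr1 mulrDl mul1r lerD2l.
  rewrite -ler_pdivrMl// mulr1 (le_trans Jd)// ler_nat//.
have h2 := ler_pM _ _ h1 hl.
have : a.+1%:R * 2 ^+ k * lnk R k <= (1 + de) * n%:R * ((1 + de) * logp (logp n%:R)).
  by apply: h2; rewrite ?mulr_ge0 ?exprn_ge0 ?lnk_ge0.
move: (a.+1%:R) (_ ^+ k) (lnk R k) (n%:R) (logp _) => u v p q r; lra.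
Qed.

(** * The lower bound for independent sequences *)

Lemma clip_hi (b x : R) : 0 <= b -> b <= x -> clip b x = b.
Proof. by move=> b0 bx; rewrite /clip min_r// max_r//; lra. Qed.

Lemma clip_lo (b x : R) : 0 <= b -> x <= - b -> clip b x = - b.
Proof. by move=> b0 bx; rewrite /clip min_l ?max_l//; lra. Qed.

Lemma clip_clip (b c x : R) : 0 <= b -> b <= c -> clip b (clip c x) = clip b x.
Proof.
move=> b0 bc; have c0 := le_trans b0 bc.
have [xc|cx] := leP `|x| c; first by rewrite (clip_id xc).
have [x0|x0] := leP 0 x.
  move: cx; rewrite ger0_norm// => cx.
  by rewrite (clip_hi c0 (ltW cx)) !clip_hi//; lra.
move: cx; rewrite ltr0_norm// => cx.
by rewrite (@clip_lo c x) ?(@clip_lo b)//; lra.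
Qed.

Lemma bump_lip (a B : R) : 0 < a -> 0 <= B -> lip (bump a B).
Proof.
move=> a0 B0; exists (a * B); split; first by rewrite mulr_ge0 ?(ltW a0).
by move=> x y; exact: bump_dist.
Qed.

Lemma bump_bdd (a B : R) : 0 < a -> 0 <= B -> exists M, forall x, `|bump a B x| <= M.
Proof.
move=> a0 B0; exists 1 => x; rewrite ger0_norm ?bump_le1//.
exact: ltW (bump_gt0 _ _ _).
Qed.

Lemma lipZ (c : R) : lip (fun x => c * x).
Proof. by exists `|c|; split => // x y; rewrite -mulrBr normrM. Qed.

(* The travelling bump [exp (kap t) * bump (x - v t)] is a subsolution of the
   lower heat equation; here is its discrete version, exact for a single step. *)
Lemma expect_bump_step f (s r b v a B eta kap kap' : R) :
  H f -> centered f -> moment2_le f s -> 0 <= r -> 0 < b ->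
  r ^+ 2 <= - expect (fun w => - clip b (f w) ^+ 2) ->
  0 <= v -> 0 <= kap' -> v ^+ 2 <= 2 * kap' * r ^+ 2 ->
  0 < a -> 0 < eta -> 0 <= B -> kap' + (a + eta) * s ^+ 2 < kap ->
  exists2 si0, 0 < si0 & forall si, 0 < si -> si <= si0 -> forall y,
    expect (fun w => - bump a B (y - v * si ^+ 2 + si * f w)) <=
    - (expR (- (kap * si ^+ 2)) * bump a B y).
Proof.
move=> Hf fc [s0 fs] r0 b0 fr v0 kp0 vr a0 eta0 B0 gap0.
pose L := a * B; have L0 : 0 <= L by rewrite mulr_ge0 ?(ltW a0).
have [si1 si10 h1] := expR_ge_quad_trunc a0 eta0 L0 b0.
have ae0 : 0 < a + eta by rewrite addr_gt0.
pose Gm := L ^+ 2 / 2 * r ^+ 2 + (a + eta) * s ^+ 2.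
have Gm0 : 0 <= Gm.
  apply: addr_ge0; first by rewrite mulr_ge0 ?divr_ge0 ?sqr_ge0.
  by rewrite mulr_ge0 ?sqr_ge0 ?(ltW ae0).
pose gap := kap - kap' - (a + eta) * s ^+ 2.
have gp : 0 < gap by rewrite /gap; lra.
have av0 : 0 <= a * v ^+ 2 by rewrite mulr_ge0 ?sqr_ge0 ?(ltW a0).
have q0 : 0 < a * v ^+ 2 + Gm ^+ 2 + 1.
  by rewrite ltr_wpDl// addr_ge0 ?sqr_ge0.
(* Beyond the Taylor range [si1], si must keep si^2 |g| below 1/4 for [expR_sub_sqr_le], and the
   second-order errors below [gap]. *)
exists (Num.min (Num.min si1 1) (Num.min (1 / (4 * (Gm + 1))) (gap / (a * v ^+ 2 + Gm ^+ 2 + 1)))).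
  by rewrite !lt_min si10 ltr01 !divr_gt0// mulr_gt0// ltr_wpDl.
move=> si sip; rewrite !le_min => /andP[/andP[sis si_1] /andP[si2 si3]] y.
have sin := ltW sip.
have sisq : si ^+ 2 <= si by rewrite expr2 ger_pMr.
have sq0 : 0 < si ^+ 2 by rewrite exprn_gt0.
have siG : si ^+ 2 * Gm <= 1 / 4.
  move: si2; rewrite ler_pdivlMr; last by rewrite mulr_gt0// ltr_wpDl.
  have := ler_wpM2r Gm0 sisq; have := mulr_ge0 sin Gm0; lra.
have siQ : si ^+ 2 * (a * v ^+ 2 + Gm ^+ 2) <= gap.
  move: si3; rewrite ler_pdivlMr//.
  have Q0 : 0 <= a * v ^+ 2 + Gm ^+ 2 by rewrite addr_ge0 ?sqr_ge0.
  by have := ler_wpM2r Q0 sisq; have := mulr_ge0 sin Q0; lra.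
pose p := a * huber_arg B y.
have p0 : 0 <= p by rewrite mulr_ge0 ?(ltW a0)// huber_arg_ge0.
have pL : p <= L by rewrite ler_wpM2l ?(ltW a0)// huber_arg_le.
(* A linear term removed by centering, a loss bounded through s, and a clipped gain bounded below
   through r. *)
pose Phi t := 1 + p * si * t - (a + eta) * si ^+ 2 * t ^+ 2 +
  p ^+ 2 / 2 * si ^+ 2 * clip b t ^+ 2.
pose G := expR (- (p * v * si ^+ 2 + a * v ^+ 2 * si ^+ 4)).
have G0 : 0 < G by exact: expR_gt0.
have h0 := bump_gt0 a B y.
have hG : 0 < bump a B y * G by rewrite mulr_gt0.
have c1 t : bump a B y * G * Phi t <= bump a B (y - v * si ^+ 2 + si * t).
  rewrite -addrA (le_trans _ (bump_ge a0 B0 _ _))//.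
  rewrite -mulrA ler_wpM2l ?(ltW h0)//.
  apply: (@le_trans _ _ (G * expR (p * si * t - a * si ^+ 2 * t ^+ 2))).
    rewrite ler_wpM2l ?(ltW G0)// (le_trans _ (h1 _ sip sis p t p0 pL))//.
    by rewrite /Phi clip_sqE ?(ltW b0).
  rewrite -expRD ler_expR -/p.
  have := mulr_ge0 (ltW a0) (sqr_ge0 (si * t + v * si ^+ 2)).
  have -> : si ^+ 4 = si ^+ 2 * si ^+ 2 by ring.
  have -> : (- (v * si ^+ 2) + si * t) ^+ 2 = si ^+ 2 * t ^+ 2 +
     v ^+ 2 * (si ^+ 2 * si ^+ 2) - 2 * (v * si ^+ 2 * (si * t)) by ring.
  have -> : (si * t + v * si ^+ 2) ^+ 2 = si ^+ 2 * t ^+ 2 +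
     v ^+ 2 * (si ^+ 2 * si ^+ 2) + 2 * (v * si ^+ 2 * (si * t)) by ring.
  lra.
(* Only clipped variables have controlled expectations, so Phi is evaluated at [clip c t]: above c
   the bump is nondecreasing, and below - c the level [c0] makes Phi nonpositive. *)
pose c0 := Num.max 1 ((1 + L ^+ 2 / 2 * si ^+ 2 * b ^+ 2) / ((a + eta) * si ^+ 2)).
have aes : 0 < (a + eta) * si ^+ 2 by rewrite mulr_gt0.
have c2 c t : b <= c -> c0 <= c ->
    bump a B y * G * Phi (clip c t) <= bump a B (y - v * si ^+ 2 + si * t).
  move=> bc; rewrite ge_max => /andP[c11 c12].
  have cn : 0 <= c by rewrite (le_trans (ltW b0)).
  have [tc|ct] := leP `|t| c; first by rewrite (clip_id tc) c1.
  have [t0|t0] := leP 0 t.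
    rewrite clip_hi//; last by move: ct; rewrite ger0_norm// => /ltW.
    rewrite (le_trans (c1 c))// bump_nondec// lerD2l ler_wpM2l//.
    by move: ct; rewrite ger0_norm// => /ltW.
  rewrite clip_lo//; last by move: ct; rewrite ltr0_norm//; lra.
  rewrite (@le_trans _ _ 0)//; last exact: ltW (bump_gt0 _ _ _).
  rewrite pmulr_rle0// /Phi sqrrN.
  have : c * ((a + eta) * si ^+ 2) <= c ^+ 2 * ((a + eta) * si ^+ 2).
    by rewrite ler_wpM2r ?(ltW aes)// expr2 ler_peMl.
  have : 1 + L ^+ 2 / 2 * si ^+ 2 * b ^+ 2 <= c * ((a + eta) * si ^+ 2).
    by rewrite -ler_pdivrMr.
  have : p ^+ 2 / 2 * si ^+ 2 * clip b (- c) ^+ 2 <= L ^+ 2 / 2 * si ^+ 2 * b ^+ 2.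
    apply: ler_pM.
    - by rewrite mulr_ge0 ?divr_ge0 ?sqr_ge0.
    - exact: sqr_ge0.
    - by rewrite ler_wpM2r ?sqr_ge0// ler_wpM2r// lerXn2r ?nnegrE.
    - by rewrite clip_sq_le// ltW.
  have := mulr_ge0 (mulr_ge0 p0 sin) cn.
  lra.
pose g := p ^+ 2 / 2 * r ^+ 2 - (a + eta) * s ^+ 2.
have hb : bdd_rv (fun w => - bump a B (y - v * si ^+ 2 + si * f w)).
  exact: bdd_rvN (lip_kernel (bump_lip a0 B0) (bump_bdd a0 B0) (lipZ si) Hf _).
have c3 : expect (fun w => - bump a B (y - v * si ^+ 2 + si * f w)) <=
    - (bump a B y * G * (1 + si ^+ 2 * g)).
  apply/ler_addgt0Pr => eps e0.
  have [|cc hcc] := centered_lin (- (p * si)) Hf fc (_ : 0 < eps / (bump a B y * G)).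
    by rewrite divr_gt0.
  pose c := Num.max cc (Num.max b c0).
  have ccc : cc <= c by rewrite le_max lexx.
  have bcc : Num.max b c0 <= c by rewrite le_max lexx orbT.
  have bc : b <= c by apply: le_trans bcc; rewrite le_max lexx.
  have c0c : c0 <= c by apply: le_trans bcc; rewrite le_max lexx orbT.
  have cn : 0 <= c by rewrite (le_trans (ltW b0)).
  have u1 := bdd_clip cn Hf; have u2 := bdd_clip_sq cn Hf.
  have u3 := bdd_rvN (bdd_clip_sq (ltW b0) Hf).
  have v1 := bdd_rvZ (- (p * si)) u1; have v2 := bdd_rvZ ((a + eta) * si ^+ 2) u2.
  have v3 := bdd_rvZ (p ^+ 2 / 2 * si ^+ 2) u3.
  have v12 := bdd_rvD v1 v2; have v123 := bdd_rvD v12 v3.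
  have v4 := bdd_rvD v123 (bdd_rv_cst (- 1)).
  apply: (le_trans (expect_le hb (bdd_rvZ (bump a B y * G) v4) _)).
    move=> w; have := c2 c (f w) bc c0c; rewrite /Phi clip_clip ?(ltW b0)//.
    lra.
  rewrite expectZ ?(ltW hG)// expectDc//.
  have w1 := expectD_le v12 v3; have w2 := expectD_le v1 v2.
  have w3 := hcc _ ccc.
  have w4 : expect (fun w => (a + eta) * si ^+ 2 * clip c (f w) ^+ 2) <=
      (a + eta) * si ^+ 2 * s ^+ 2.
    by rewrite expectZ ?(ltW aes)// ler_wpM2l ?(ltW aes)// fs.
  have w5 : expect (fun w => p ^+ 2 / 2 * si ^+ 2 * - clip b (f w) ^+ 2) <=
      p ^+ 2 / 2 * si ^+ 2 * - r ^+ 2.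
    have z0 : 0 <= p ^+ 2 / 2 * si ^+ 2 by rewrite mulr_ge0 ?divr_ge0 ?sqr_ge0.
    by rewrite expectZ// ler_wpM2l// lerNr.
  apply: (@le_trans _ _ (bump a B y * G * (eps / (bump a B y * G) - (1 + si ^+ 2 * g)))).
    rewrite ler_wpM2l ?(ltW hG)//; move: w1 w2 w3 w4 w5; rewrite /g.
    by move: (_ / (_ * G)) => q; lra.
  by rewrite mulrBr mulrCA divff ?gt_eqF// mulr1 addrC.
rewrite (le_trans c3)// lerN2 -[leRHS]mulrA mulrC ler_wpM2l ?(ltW h0)//.
have gG : `|g| <= Gm.
  rewrite /g /Gm ler_norml.
  have z1 : p ^+ 2 / 2 * r ^+ 2 <= L ^+ 2 / 2 * r ^+ 2.
    by rewrite ler_wpM2r ?sqr_ge0// ler_wpM2r// lerXn2r ?nnegrE.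
  have z2 : 0 <= p ^+ 2 / 2 * r ^+ 2 by rewrite mulr_ge0 ?divr_ge0 ?sqr_ge0.
  have z3 : 0 <= (a + eta) * s ^+ 2 by rewrite mulr_ge0 ?sqr_ge0 ?(ltW ae0).
  by apply/andP; split; lra.
have xle : `|si ^+ 2 * g| <= 1 / 4.
  by rewrite normrM gtr0_norm// (le_trans _ siG)// ler_wpM2l ?(ltW sq0).
apply: (@le_trans _ _ (G * expR (si ^+ 2 * g - (si ^+ 2 * g) ^+ 2))); last first.
  by rewrite ler_wpM2l ?(ltW G0)// expR_sub_sqr_le.
rewrite -expRD ler_expR.
(* The speed limit enters here: p^2 v^2 <= 4 kap' (p^2 r^2 / 2), which is at most the square of the
   sum of kap' and p^2 r^2 / 2. *)
have pv : p * v <= kap' + p ^+ 2 / 2 * r ^+ 2.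
  have z2 : 0 <= p ^+ 2 / 2 * r ^+ 2 by rewrite mulr_ge0 ?divr_ge0 ?sqr_ge0.
  rewrite -(@ler_pXn2r _ 2) ?nnegrE ?(mulr_ge0 p0 v0) ?(addr_ge0 kp0 z2)// exprMn.
  have := ler_wpM2l (sqr_ge0 p) vr.
  by have := sqr_ge0 (kap' - p ^+ 2 / 2 * r ^+ 2); rewrite !expr2; lra.
have g2 : g ^+ 2 <= Gm ^+ 2.
  by rewrite -[leLHS]real_normK ?num_real// lerXn2r ?nnegrE.
have : si ^+ 2 * (p * v - g + si ^+ 2 * (a * v ^+ 2 + g ^+ 2)) <= si ^+ 2 * kap.
  rewrite ler_wpM2l ?(ltW sq0)//.
  have : si ^+ 2 * (a * v ^+ 2 + g ^+ 2) <= si ^+ 2 * (a * v ^+ 2 + Gm ^+ 2).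
    by rewrite ler_wpM2l ?(ltW sq0)// lerD2l.
  by move: siQ; rewrite /gap /g; lra.
have -> : si ^+ 4 = si ^+ 2 * si ^+ 2 by ring.
by rewrite exprMn; lra.
Qed.

(** [A] and [P] depend on the first N variables only, so the block is integrated out from its last
    variable; the weight c of the induction collects the powers of q. *)
Lemma iid_bump_iter (Y : nat -> T -> R) (A P : T -> R) (N n : nat)
    (a B v si q : R) :
  iid_seq Y -> bounded_fct A -> lip_in Y N A -> bounded_fct P -> lip_in Y N P ->
  (forall w, 0 <= P w) -> 0 < a -> 0 <= B -> 0 <= q ->
  (forall y, expect (fun w => - bump a B (y - v * si ^+ 2 + si * Y 0%N w)) <=
     - (q * bump a B y)) ->
  expect (fun w => A w - P w * bump a B
      (si * (\sum_(N <= i < N + n) Y i w) - v * si ^+ 2 * n%:R)) <=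
  expect (fun w => A w - q ^+ n * P w).
Proof.
move=> Yi Ab Al Pb Pl P0 a0 B0 q0 step; have [HY _ _] := Yi.
have bl := bump_lip a0 B0; have bb := bump_bdd a0 B0.
suff h : forall j c, 0 <= c -> expect (fun w => A w - c * P w * bump a B
      (si * (\sum_(N <= i < N + j) Y i w) - v * si ^+ 2 * j%:R)) <=
    expect (fun w => A w - c * q ^+ j * P w).
  have := h n 1 ler01.
  under eq_fun do rewrite mul1r; under [in leRHS]eq_fun do rewrite mul1r.
  by [].
elim=> [|j IH] c c0.
  rewrite le_eqVlt; apply/orP; left; apply/eqP; congr (expect _).
  apply/funext => w; rewrite addn0 big_geq// mulr0 mulr0 subr0 bump0//.
  by rewrite expr0 !mulr1.
have cPb : bounded_fct (fun w => c * P w).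
  by apply: bounded_fctM => //; exact: bounded_fct_cst.
have cPl m : (N <= m)%N -> lip_in Y m (fun w => c * P w).
  by move=> Nm; apply: lip_in_comp (lipZ c) _; exact: lip_in_widen Pl.
have Al' m : (N <= m)%N -> lip_in Y m A by move=> Nm; exact: lip_in_widen Al.
pose S w := si * (\sum_(N <= i < N + j) Y i w) - v * si ^+ 2 * j%:R - v * si ^+ 2.
have Sl : lip_in Y (N + j) S.
  apply: lip_inD; last exact: lip_in_cst.
  apply: lip_inD; last exact: lip_in_cst.
  by apply: lip_in_comp (lipZ si) _; apply: iid_lip_sum lip_id _.
have cP0 w : 0 <= c * P w by rewrite mulr_ge0.
have Nj : (N <= N + j)%N by rewrite leq_addr.
have st := iid_step Yi Ab (Al' _ Nj) cPb (cPl _ Nj) cP0 Sl (lipN bl) (bddN bb)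
  (lipZ si).
rewrite (_ : (fun w => _) =
    fun w => A w + c * P w * - bump a B (S w + si * Y (N + j)%N w)); last first.
  apply/funext => w; rewrite mulrN; congr (_ - _ * bump a B _).
  by rewrite addnS big_nat_recr ?leq_addr//= /S -natr1; ring.
rewrite st.
have IH' := IH (c * q) (mulr_ge0 c0 q0).
rewrite (le_trans _ (le_trans IH' _))//; last first.
  rewrite le_eqVlt; apply/orP; left; apply/eqP; congr (expect _).
  by apply/funext => w; rewrite exprS; ring.
apply: expect_le.
- apply: (bdd_lip_in_rv Yi _ (_ : lip_in Y (N + j) _)).
    apply: bounded_fctD => //; apply: bounded_fctM => //.
    have [M hM] := expect_kernel_bdd (lipN bl) (bddN bb) (lipZ si) (HY 0%N).
    by exists M => w; exact: hM.
  apply: lip_inD; first exact: Al'.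
  apply: lip_inM => //.
  + have [M hM] := expect_kernel_bdd (lipN bl) (bddN bb) (lipZ si) (HY 0%N).
    by exists M => w; exact: hM.
  + exact: cPl.
  + exact: (lip_in_comp (expect_kernel_lip (lipN bl) (bddN bb) (lipZ si) (HY 0%N)) Sl).
- apply: (bdd_lip_in_rv Yi _ (_ : lip_in Y (N + j) _)).
    apply: bounded_fctD => //; case: bb => M hM.
    have [M' hM'] := Pb; exists (`|c * q| * M' * M) => w.
    rewrite normrN !normrM -!normrM normrM ler_pM//.
    by rewrite normrM ler_wpM2l.
  apply: lip_inD; first exact: Al'.
  apply: (lip_in_comp lip_opp); apply: lip_inM.
  + by apply: bounded_fctM => //; exact: bounded_fct_cst.
  + by case: bb => M hM; exists M.
  + by apply: lip_in_comp (lipZ _) _; exact: lip_in_widen Pl.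
  + apply: lip_in_comp bl _; apply: lip_inD; last exact: lip_in_cst.
    by apply: lip_in_comp (lipZ si) _; apply: iid_lip_sum lip_id _.
- move=> w; rewrite lerD2l.
  have := ler_wpM2l (cP0 w) (step (si * (\sum_(N <= i < N + j) Y i w) - v * si ^+ 2 * j%:R)).
  by rewrite -/(S w); lra.
Qed.

(** An explicit form of the divergence of the harmonic series: the square of each factor is at most
    (k + 3) / (k + 4), and these quotients telescope. *)
Lemma prod_half_le (K n : nat) : (\prod_(K <= k < K + n) (1 - (2 * k.+3%:R)^-1)) ^+ 2 <=
  K.+3%:R / (K + n).+3%:R :> R.
Proof.
elim: n => [|n IH].
  by rewrite addn0 big_geq// expr1n divff ?pnatr_eq0.
rewrite addnS big_nat_recr ?leq_addr//= exprMn.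
set m := (K + n)%N in IH *; have m0 : 0 < m.+3%:R :> R by [].
have m1 : 0 < m.+4%:R :> R by [].
apply: (@le_trans _ _ (K.+3%:R / m.+3%:R * (m.+3%:R / m.+4%:R))).
  apply: ler_pM => //; [exact: sqr_ge0|exact: sqr_ge0|].
  rewrite -[m.+4]addn1 natrD; have : 1 <= m.+3%:R :> R by rewrite ler1n.
  move: (m.+3%:R) m0 => x x0 x1.
  rewrite -subr_ge0.
  have -> : x / (x + 1) - (1 - (2 * x)^-1) ^+ 2 =
     (3 * x - 1) / (4 * x ^+ 2 * (x + 1)).
    by field; rewrite !gt_eqF//; lra.
  by rewrite divr_ge0 ?mulr_ge0 ?sqr_ge0//; lra.
by rewrite mulrA mulfVK ?gt_eqF.
Qed.

Lemma scaled_lnk_small (si0 : R) : 0 < si0 -> exists K, forall k, (K <= k)%N ->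
  lnk R k / 2 ^+ k <= si0 ^+ 2.
Proof.
move=> s0; have [K hK] := natr_ge (16 / si0 ^+ 2).
exists K => k /hK h; have s2 : 0 < si0 ^+ 2 by rewrite exprn_gt0.
have h2 : k.+3%:R * k.+3%:R <= 16 * 2 ^+ k :> R.
  elim: k {h} => [|k IH]; first by rewrite expr0 mulr1 -natrM ler_nat.
  rewrite exprS -[k.+4]addn1 natrD; move: IH.
  have : 3 <= k.+3%:R :> R by rewrite ler_nat.
  move: (k.+3%:R) (2 ^+ k) => x y x3 IH.
  have : 0 <= (x - 3) * (x + 1) by rewrite mulr_ge0//; lra.
  lra.
rewrite ler_pdivrMr ?exprn_gt0//.
move: h; rewrite ler_pdivrMr// => h.
have lk : lnk R k <= k.+3%:R by rewrite ltW// ln_sublinear.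
have k0 : 0 < k.+3%:R :> R by [].
rewrite -(ler_pM2l k0).
apply: (@le_trans _ _ (16 * 2 ^+ k)); first by rewrite (le_trans _ h2)// ler_wpM2l// ltW.
rewrite mulrA ler_wpM2r ?exprn_ge0//.
by rewrite (le_trans h)// ler_wpM2r ?(ltW s2)// ler_nat !leqW.
Qed.

(* The second half of Borel--Cantelli needs no countable additivity: the event
   is contained in finite intersections, whose capacity factorizes. *)
Lemma iid_lower_block (Y : nat -> T -> R) (s r b de : R) (M : nat) :
  iid_seq Y -> centered (Y 0%N) -> moment2_le (Y 0%N) s -> 0 <= r -> 0 < b ->
  r ^+ 2 <= - expect (fun w => - clip b (Y 0%N w) ^+ 2) ->
  0 < de -> de < 1 -> (2 <= M)%N ->
  null_set [set w | exists K, forall k, (K <= k)%N ->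
    \sum_(M ^ k <= i < M ^ k.+1) Y i w <=
    (Num.sqrt 2 * r * (1 - de) - de) *
      Num.sqrt ((M ^ k.+1 - M ^ k)%:R * lnk R k)].
Proof.
move=> Yi Yc Ys r0 b0 rY d0 d1 M2; have [HY _ _] := Yi; have [s0 _] := Ys.
pose kap' := (1 - de) ^+ 2.
have kap1 : kap' < 1 by rewrite expr_lt1//; lra.
(* Small enough that kap' + 2 a s^2 < 1, so that [expect_bump_step] applies with kap = 1. *)
pose a := (1 - kap') / (4 * (s ^+ 2 + 1)).
have s21 : 0 < s ^+ 2 + 1 by rewrite ltr_wpDl ?sqr_ge0.
have a0 : 0 < a by rewrite divr_gt0 ?subr_gt0 ?mulr_gt0.
have as2 : kap' + (a + a) * s ^+ 2 < 1.
  have : a * (4 * (s ^+ 2 + 1)) = 1 - kap' by rewrite mulfVK// gt_eqF// mulr_gt0.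
  have := mulr_ge0 (ltW a0) (sqr_ge0 s); lra.
clearbody a.
(* The rate a B = 4 / de of exponential decay brings the bump below [pi_ k] at - de [lnk k]. *)
pose B := 4 / de / a.
have B0 : 0 <= B by rewrite !divr_ge0 ?(ltW d0) ?(ltW a0).
pose v := Num.sqrt 2 * r * (1 - de).
have v0 : 0 <= v by rewrite !mulr_ge0 ?sqrtr_ge0//; lra.
have v2 : v ^+ 2 <= 2 * kap' * r ^+ 2.
  by rewrite /v !exprMn sqr_sqrtr// /kap'; lra.
have [si0 si00 step] := expect_bump_step (HY 0%N) Yc Ys r0 b0 rY v0 (sqr_ge0 _)
  v2 a0 a0 B0 as2.
have [K1 hK1] := scaled_lnk_small si00.
have [K2 hK2] := natr_ge (expR (ln 2 + a * B ^+ 2 / 2)).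
pose d_ k : R := (M ^ k.+1 - M ^ k)%:R.
have dE k : d_ k = (M ^ k)%:R * (M.-1)%:R.
  by rewrite /d_ expnS -{2}[(M ^ k)%N]mul1n -mulnBl mulnC subn1 natrM.
have dge k : 2 ^+ k <= d_ k.
  rewrite dE -natrX -natrM ler_nat.
  have h : (2 ^ k <= M ^ k)%N by case: k => // k; rewrite leq_exp2r.
  by rewrite (leq_trans h)// leq_pmulr// -subn1 subn_gt0.
have d0' k : 0 < d_ k by rewrite (lt_le_trans _ (dge k))// exprn_gt0.
(* The block then has rescaled duration si^2 d_ = [lnk k], over which the bump keeps at least the
   factor exp (- lnk k) = 1 / (k + 3), twice [pi_ k]. *)
pose si k := Num.sqrt (lnk R k / d_ k).
have si_gt0 k : 0 < si k by rewrite sqrtr_gt0 divr_gt0 ?lnk_gt0.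
have si2 k : si k ^+ 2 = lnk R k / d_ k by rewrite sqr_sqrtr// divr_ge0 ?lnk_ge0 ?ltW.
have sile k : (K1 <= k)%N -> si k <= si0.
  move=> /hK1 h; rewrite -(@ler_pXn2r _ 2) ?nnegrE ?(ltW (si_gt0 k)) ?(ltW si00)// si2 (le_trans _ h)//.
  rewrite ler_wpM2l ?lnk_ge0// lef_pV2 ?posrE ?exprn_gt0//.
pose pi_ k : R := (2 * k.+3%:R)^-1.
have pi0 k : 0 < pi_ k by rewrite invr_gt0 mulr_gt0.
(* Subtracting half of that lower bound makes g vanish where the increment is too small, and still
   leaves a lower expectation of at least [pi_ k]. *)
pose g k t := Num.max 0 (bump a B t - pi_ k).
pose Dk k w := si k * (\sum_(M ^ k <= i < M ^ k.+1) Y i w) - v * si k ^+ 2 * d_ k.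
have aB : a * B = 4 / de by rewrite /B mulrC divfK// gt_eqF.
have gE k t : (K2 <= k)%N -> t <= - (de * lnk R k) -> g k t = 0.
  move=> /hK2 hk tl; rewrite /g max_l// subr_le0.
  rewrite (le_trans (bump_le_exp a0 B0 t))//.
  rewrite -[pi_ k]lnK ?posrE// ler_expR /pi_ lnV ?posrE ?mulr_gt0// lnM ?posrE//.
  rewrite -/(lnk R k) aB.
  have h1 : ln 2 + a * B ^+ 2 / 2 <= lnk R k.
    rewrite -[leLHS]expRK ler_ln ?posrE ?expR_gt0//.
    by rewrite (le_trans hk)// ler_nat !leqW.
  have h2 : 4 / de * t <= 4 / de * - (de * lnk R k).
    by rewrite ler_wpM2l ?divr_ge0 ?(ltW d0).
  have h3 : 4 / de * - (de * lnk R k) = - 4 * lnk R k by field; rewrite gt_eqF.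
  by have := lnk_ge0 R k; lra.
have g01 k t : 0 <= g k t <= 1.
  rewrite /g le_max lexx ge_max ler01/=.
  by have := bump_le1 a0 B0 t; have := pi0 k; lra.
have gl k : lip (g k).
  have [C [C0 hC]] := bump_lip a0 B0; exists C; split => // x y.
  rewrite (le_trans (max0_lip _ _))//.
  by rewrite (_ : _ - _ = bump a B x - bump a B y)//; ring.
have gb k : exists M', forall t, `|g k t| <= M'.
  by exists 1 => t; have /andP[? ?] := g01 k t; rewrite ger0_norm.
have Ml k k' : (k <= k')%N -> (M ^ k <= M ^ k')%N by move=> kk; rewrite leq_pexp2l// ltnW.
have Dl k n : (M ^ k.+1 <= n)%N -> lip_in Y n (Dk k).
  move=> kn; apply: lip_inD; last exact: lip_in_cst.
  by apply: lip_in_comp (lipZ _) _; apply: iid_lip_sum lip_id _.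
pose Q K n w := \prod_(K <= k < K + n) (1 - g k (Dk k w)).
have Q01 K n w : 0 <= Q K n w <= 1.
  rewrite /Q; elim: n => [|n /andP[q0 q1]]; first by rewrite addn0 big_geq// ler01 lexx.
  rewrite addnS big_nat_recr ?leq_addr//=.
  have /andP[g0 g1] := g01 (K + n)%N (Dk (K + n)%N w).
  by rewrite mulr_ge0 ?subr_ge0//= mulr_ile1 ?subr_ge0// gerBl.
have Qb K n : bounded_fct (Q K n).
  by exists 1 => w; have /andP[? ?] := Q01 K n w; rewrite ger0_norm.
have Fl k n : (M ^ k.+1 <= n)%N -> lip_in Y n (fun w => 1 - g k (Dk k w)).
  move=> kn; apply: lip_inD; first exact: lip_in_cst.
  apply: lip_in_comp lip_opp _; exact: lip_in_comp (gl k) (Dl k n kn).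
have Fb k : bounded_fct (fun w => 1 - g k (Dk k w)).
  exists 1 => w; have /andP[? ?] := g01 k (Dk k w).
  by rewrite ger0_norm ?subr_ge0// gerBl.
have Ql K n : lip_in Y (M ^ (K + n)) (Q K n).
  rewrite /Q; elim: n => [|n IH].
    by under eq_fun do rewrite addn0 big_geq//; exact: lip_in_cst.
  rewrite (_ : (fun w => _) = fun w =>
      Q K n w * (1 - g (K + n)%N (Dk (K + n)%N w))); last first.
    by apply/funext => w; rewrite addnS big_nat_recr ?leq_addr.
  apply: lip_inM => //; last by rewrite addnS; exact: Fl.
  by apply: lip_in_widen IH; rewrite Ml// leq_add2l.
have Qrv K n : bdd_rv (Q K n) := bdd_lip_in_rv Yi (Qb K n) (Ql K n).
have Qstep K n : (K1 <= K)%N ->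
    expect (Q K n.+1) <= (1 - pi_ (K + n)) * expect (Q K n).
  move=> K1K; set k := (K + n)%N.
  have k1 : (K1 <= k)%N by rewrite (leq_trans K1K)// leq_addr.
  have pi1 : pi_ k <= 1 / 2.
    by rewrite /pi_ div1r lef_pV2 ?posrE ?mulr_gt0// ler_peMr// ler1n.
  rewrite -expectZ//; last by lra.
  have q0 : 0 <= expR (- (1 * si k ^+ 2)) by exact: expR_ge0.
  (* Since 1 - g <= 1 + pi - bump and the bump keeps the factor 2 pi, the block contributes the
     factor 1 - pi. *)
  have A1 : bounded_fct (fun w => (1 + pi_ k) * Q K n w).
    by apply: bounded_fctM => //; exact: bounded_fct_cst.
  have A2 : lip_in Y (M ^ k) (fun w => (1 + pi_ k) * Q K n w).
    exact: lip_in_comp (lipZ _) (Ql K n).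
  have Q0 w : 0 <= Q K n w by have /andP[] := Q01 K n w.
  have := iid_bump_iter (M ^ k.+1 - M ^ k) Yi A1 A2 (Qb K n) (Ql K n) Q0 a0 B0 q0
    (step _ (si_gt0 k) (sile _ k1)).
  rewrite subnKC ?Ml// -expRM_natl.
  have -> : expR ((M ^ k.+1 - M ^ k)%:R * - (1 * si k ^+ 2)) = 2 * pi_ k.
    rewrite -/(d_ k) si2 mul1r mulrN mulrCA divff ?gt_eqF// mulr1 expRN expR_lnk.
    by rewrite /pi_ invfM mulrA divff ?mul1r// pnatr_eq0.
  move=> h; apply: (le_trans _ (le_trans h _)).
    apply: expect_le => //.
      apply: (bdd_lip_in_rv Yi _ (_ : lip_in Y (M ^ k.+1) _)).
        apply: bounded_fctD => //; have [M' hM] := bump_bdd a0 B0.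
        have [M1 hM1] := Qb K n; exists (M1 * M') => w.
        by rewrite normrN normrM ler_pM.
      have Ql' := lip_in_widen (Ml k k.+1 (leqnSn k)) (Ql K n).
      apply: lip_inD; first exact: lip_in_comp (lipZ _) Ql'.
      apply: lip_in_comp lip_opp _; apply: lip_inM => //.
        by have [M' hM] := bump_bdd a0 B0; exists M' => w.
      exact: lip_in_comp (bump_lip a0 B0) (Dl k _ (leqnn _)).
    move=> w; rewrite {1}/Q addnS big_nat_recr ?leq_addr//= -/(Q K n w) -/k.
    rewrite -/(d_ k) -/(Dk k w).
    have : bump a B (Dk k w) - pi_ k <= g k (Dk k w) by rewrite /g le_max lexx orbT.
    by move=> /(ler_wpM2l (Q0 w)); lra.
  apply: expect_le.
  - apply: bdd_rvD; first exact: bdd_rvZ.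
    by apply: bdd_rvN; exact: bdd_rvZ.
  - exact: bdd_rvZ.
  - by move=> w; lra.
have Qle K n : (K1 <= K)%N ->
    expect (Q K n) <= \prod_(K <= k < K + n) (1 - (2 * k.+3%:R)^-1).
  move=> K1K; elim: n => [|n IH].
    rewrite addn0 big_geq// /Q.
    by under eq_fun do rewrite addn0 big_geq//; rewrite expect_cst.
  rewrite (le_trans (Qstep K n K1K))// addnS big_nat_recr ?leq_addr//= mulrC.
  rewrite ler_wpM2r// subr_ge0 invf_le1 ?mulr_gt0//.
  by rewrite -natrM ler1n.
pose A K := [set w | forall k, (K <= k)%N ->
    \sum_(M ^ k <= i < M ^ k.+1) Y i w <= (v - de) * Num.sqrt (d_ k * lnk R k)].
apply: (@null_set_sub _ (\bigcup_K A K)).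
  by move=> w [K hK]; exists K.
apply: null_set_bigcup => K.
apply: null_set_small => eps e0.
pose K' := maxn K (maxn K1 K2).
have [n hn] : exists n, \prod_(K' <= k < K' + n) (1 - (2 * k.+3%:R)^-1) <= eps.
  have [N hN] := natr_ge (K'.+3%:R / eps ^+ 2).
  exists N; have e2 : 0 < eps ^+ 2 by rewrite exprn_gt0.
  have Kp : (K' <= K' + N)%N by rewrite leq_addr.
  rewrite -(@ler_pXn2r _ 2) ?nnegrE ?(ltW e0)//; last first.
    apply: prodr_ge0 => k _; rewrite subr_ge0 invf_le1 ?mulr_gt0//.
    by rewrite -natrM ler1n.
  rewrite (le_trans (prod_half_le _ _))// ler_pdivrMr// mulrC -ler_pdivrMr//.
  by apply: hN; do 3!apply: leqW; rewrite leq_addl.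
exists (Q K' n); split => //.
- by move=> w; have /andP[] := Q01 K' n w.
- by rewrite (le_trans (Qle _ _ _))// leq_max leq_maxl orbT.
- move=> w Aw; rewrite /Q big1_seq// => k; rewrite mem_index_iota => /andP[_ /andP[Kk _]].
  have Kk1 : (K <= k)%N by rewrite (leq_trans _ Kk)// leq_maxl.
  have Kk2 : (K2 <= k)%N by rewrite (leq_trans _ Kk)// !leq_max leqnn !orbT.
  rewrite gE ?subr0//.
  have e1 : si k * Num.sqrt (d_ k * lnk R k) = lnk R k.
    rewrite /si -sqrtrM ?divr_ge0 ?lnk_ge0 ?(ltW (d0' k))//.
    rewrite (_ : _ / _ * _ = lnk R k ^+ 2); last by rewrite mulrA divfK ?gt_eqF.
    by rewrite sqrtr_sqr ger0_norm ?lnk_ge0.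
  have e2 : v * si k ^+ 2 * d_ k = v * lnk R k.
    by rewrite si2 -mulrA divfK ?gt_eqF.
  have := ler_wpM2l (ltW (si_gt0 k)) (Aw k Kk1).
  by rewrite /Dk e2 mulrCA e1; lra.
Qed.

Lemma iid_seqN (Y : nat -> T -> R) : iid_seq Y -> iid_seq (fun n w => - Y n w).
Proof.
move=> [HY Yind Yid]; split.
- by move=> n; exact: rvN.
- move=> n phi [[M phiM] [L phiL]].
  have phiC : C_bLip (fun z => phi (- z)).
    split; first by exists M => x.
    exists L => x y; rewrite (le_trans (phiL _ _))// -opprD /enorm.
    rewrite le_eqVlt; apply/orP; left; apply/eqP; congr (_ * Num.sqrt _).
    by apply: eq_bigr => i _; rewrite mxE sqrrN.
  have segN a k w : segment (fun n w => - Y n w) a k w = - segment Y a k w.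
    by apply/rowP => i; rewrite !mxE.
  have := Yind n _ phiC.
  under eq_fun do rewrite opp_row_mx -!segN.
  move=> ->; congr (E _); apply/funext => w; congr (fine (E _)).
  by apply/funext => w'; rewrite opp_row_mx -!segN.
- move=> n k [C [C0 kC]] [M kM].
  apply: (Yid n (fun x => k (- x))); last by exists M.
  by exists C; split => // x y; rewrite (le_trans (kC _ _))// -opprD normrN.
Qed.

Lemma clipN b x : 0 <= b -> clip b (- x) = - clip b x.
Proof.
move=> b0; have [xb|bx] := leP `|x| b; first by rewrite !clip_id ?normrN.
have [x0|x0] := leP 0 x.
  move: bx; rewrite ger0_norm// => /ltW bx.
  by rewrite (clip_hi b0 bx) clip_lo// lerN2.
move: bx; rewrite ltr0_norm// => /ltW bx.
by rewrite (clip_hi b0 bx) clip_lo ?opprK// lerNr.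
Qed.

Lemma centeredN f : centered f -> centered (fun w => - f w).
Proof.
move=> fc eps e0; have [b0 h] := fc _ e0.
exists (Num.max 0 b0) => b; rewrite ge_max => /andP[b00 /h[h1 h2]].
split; first by under eq_fun do rewrite clipN//.
by under eq_fun do rewrite clipN// opprK.
Qed.

Lemma moment2_leN f s : moment2_le f s -> moment2_le (fun w => - f w) s.
Proof.
move=> [s0 h]; split => // b b0; under eq_fun do rewrite clipN// sqrrN.
exact: h.
Qed.

Lemma tail_condN f : tail_cond f -> tail_cond (fun w => - f w).
Proof.
move=> h c c0; rewrite (_ : (fun k => _) = fun k => 2 ^+ k * tail f (scale c k)).
  exact: h.
apply/funext => k; rewrite /tail; congr (_ * expect _); apply/funext => w.
by rewrite /ramp normrN.
Qed.

Lemma lil_mulM (M k : nat) : (0 < M)%N ->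
  lil R (M ^ k) <= lil R (M ^ k.+1) / Num.sqrt M%:R.
Proof.
move=> M0; have MR : 0 < M%:R :> R by rewrite ltr0n.
rewrite ler_pdivlMr ?sqrtr_gt0// /lil -sqrtrM ?mulr_ge0//; last first.
  exact: le_trans (logp_ge1 _).
apply: ler_wsqrtr; rewrite expnSr natrM mulrAC mulrA.
rewrite ler_wpM2l ?mulr_ge0//; apply: le_logp; apply: le_logp.
by rewrite ler_peMr// ler1n.
Qed.

(** A large increment over the k-th block makes the sum at M^(k+1) large unless the sum at M^k is
    very negative; the upper half for - Y bounds that by a fraction of order M^(-1/2) of the
    scale. *)
Lemma iid_lower (Y : nat -> T -> R) (s r b eps : R) :
  iid_seq Y -> centered (Y 0%N) -> moment2_le (Y 0%N) s -> 0 < s ->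
  tail_cond (Y 0%N) -> 0 <= r -> 0 < b ->
  r ^+ 2 <= - expect (fun w => - clip b (Y 0%N w) ^+ 2) -> 0 < eps ->
  null_set [set w | exists N0, forall n, (N0 <= n)%N ->
    \sum_(0 <= i < n) Y i w <= (r - eps) * lil R n].
Proof.
move=> Yi Yc Ys s0 Yt r0 b0 rY e0.
pose de := Num.min (1 / 2) (eps / (4 * (2 * r + 1))).
have r1 : 0 < 4 * (2 * r + 1) by lra.
have d0 : 0 < de by rewrite lt_min !divr_gt0.
have d2 : de <= 1 / 2 by rewrite ge_min lexx.
have d1 : de < 1 by lra.
have de4 : de * (2 * r + 1) <= eps / 4.
  have : de <= eps / (4 * (2 * r + 1)) by rewrite ge_min lexx orbT.
  by rewrite ler_pdivlMr//; lra.
clearbody de.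
(* This puts r / M, lost because the block is shorter than M^(k+1), and 2 s / sqrt M, lost to the
   past, each below eps / 4. *)
have [M hM] := natr_ge (Num.max (3 : R) (Num.max (4 * r / eps) ((8 * s / eps) ^+ 2))).
have := hM M (leqnn M); rewrite !ge_max => /andP[M3 /andP[Mr Ms]].
have MR : 0 < M%:R :> R by rewrite (lt_le_trans _ M3).
have M2 : (2 <= M)%N by rewrite -(ler_nat R); lra.
have M0 : (0 < M)%N by rewrite ltnW.
have Mr' : r / M%:R <= eps / 4.
  by rewrite ler_pdivrMr// mulrC; move: Mr; rewrite ler_pdivrMr//; lra.
have Ms' : 2 * s / Num.sqrt M%:R <= eps / 4.
  have h : 8 * s / eps <= Num.sqrt M%:R.
    rewrite -[leLHS]ger0_norm -?sqrtr_sqr ?ler_wsqrtr//.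
    by rewrite divr_ge0 ?(ltW e0)// mulr_ge0// ltW.
  by rewrite ler_pdivrMr ?sqrtr_gt0// mulrC; move: h; rewrite ler_pdivrMr//; lra.
have nu := iid_upper (iid_seqN Yi) (centeredN Yc) (moment2_leN Ys) s0
  (tail_condN Yt) ltr01.
have nl := iid_lower_block Yi Yc Ys r0 b0 rY d0 d1 M2.
have M1 : 1 <= M%:R :> R by rewrite ler1n.
have [K1 hK1] := loglog_le_lnk d0 M1 M1.
have [K2 hK2] := @lnk_le_loglog R 1 ltr01.
apply: null_set_sub (null_setU nu nl) => w [N0 hN0].
have [|nnu] := pselect (exists N1, forall n, (N1 <= n)%N ->
    \sum_(0 <= i < n) - Y i w <= (1 + 1) * s * lil R n); last by left.
move=> [N1 hN1]; right.
exists (maxn (maxn N0 N1) (maxn K1 K2)) => k.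
rewrite !geq_max => /andP[/andP[N0k N1k] /andP[K1k K2k]].
pose n := (M ^ k.+1)%N; pose n' := (M ^ k)%N.
have kn' : (k <= n')%N by rewrite ltnW// ltn_expl.
have n'n : (n' <= n)%N by rewrite leq_pexp2l.
have kn := leq_trans kn' n'n.
have TN := hN0 n (leq_trans N0k kn).
have TN' := hN1 n' (leq_trans N1k kn').
have nE : n%:R = M%:R * n'%:R :> R by rewrite /n expnS natrM.
have LL1 : logp (logp n%:R) <= (1 + de) * lnk R k.
  by apply: hK1 => //; rewrite nE /n' natrX.
have LL2 : lnk R k <= (1 + 1) * logp (logp n%:R).
  apply: hK2 => //; rewrite (leq_trans _ n'n)//.
  by rewrite /n'; case: k {N0k N1k K1k K2k n n' kn' n'n kn TN TN' nE LL1} => // k; rewrite leq_exp2r.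
have LL0 : 0 <= logp (logp n%:R) :> R by exact: le_trans (logp_ge1 _).
have n0 : 0 <= n%:R :> R by [].
pose dd : R := (n - n')%:R.
have ddE : dd = n%:R * (1 - M%:R^-1).
  rewrite /dd natrB// nE; field; rewrite gt_eqF//.
have Mi : 0 < M%:R^-1 :> R by rewrite invr_gt0.
have Mi1 : M%:R^-1 <= 1 / 3 :> R by rewrite div1r lef_pV2 ?posrE.
have dd0 : 0 <= dd by [].
have lk0 := lnk_ge0 R k.
pose q := Num.sqrt (dd * lnk R k).
have q0 : 0 <= q by exact: sqrtr_ge0.
have qle : q <= lil R n.
  apply: ler_wsqrtr; apply: (@le_trans _ _ (n%:R * lnk R k)).
    by rewrite ler_wpM2r// ddE ler_piMr//; lra.
  by have := ler_wpM2l n0 LL2; lra.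
have qge : (1 - M%:R^-1) * (1 - de) * lil R n <= Num.sqrt 2 * q.
  rewrite /q -sqrtrM// /lil -[X in X * _ <= _]ger0_norm; last by rewrite mulr_ge0//; lra.
  rewrite -sqrtr_sqr -sqrtrM ?sqr_ge0//; apply: ler_wsqrtr.
  rewrite ddE exprMn.
  have h1 : (1 - M%:R^-1) ^+ 2 <= 1 - M%:R^-1 :> R.
    by rewrite expr2 ger_pMl//; lra.
  have h2 : (1 - de) ^+ 2 * logp (logp n%:R) <= lnk R k.
    apply: (@le_trans _ _ ((1 - de) ^+ 2 * ((1 + de) * lnk R k))).
      by rewrite ler_wpM2l ?sqr_ge0.
    rewrite mulrA ger_pMl ?lnk_gt0//.
    have -> : (1 - de) ^+ 2 * (1 + de) = 1 - de - de ^+ 2 * (1 - de) by ring.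
    have : 0 <= de ^+ 2 * (1 - de) by rewrite mulr_ge0 ?sqr_ge0//; lra.
    lra.
  have h3 : (1 - M%:R^-1) ^+ 2 * ((1 - de) ^+ 2 * logp (logp n%:R)) <=
      (1 - M%:R^-1) * lnk R k.
    exact: ler_pM (sqr_ge0 _) (mulr_ge0 (sqr_ge0 _) LL0) h1 h2.
  by have := ler_wpM2l n0 h3; lra.
have ln' : lil R n' <= lil R n / Num.sqrt M%:R by exact: lil_mulM.
have S2 : \sum_(0 <= i < n) Y i w = \sum_(0 <= i < n') Y i w + \sum_(n' <= i < n) Y i w.
  by rewrite (big_cat_nat (n := n')).
have TN2 : - \sum_(0 <= i < n') Y i w <= 2 * s * lil R n'.
  by rewrite -sumrN (le_trans TN')// [1 + 1](_ : _ = 2)//; ring.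
rewrite -/n -/n' -/dd -/q leNgt; apply/negP => hD.
have l0 := lil_ge0 R n.
have z1 : r * (1 - de) * ((1 - M%:R^-1) * (1 - de) * lil R n) <= r * (1 - de) * (Num.sqrt 2 * q).
  by rewrite ler_wpM2l// mulr_ge0//; lra.
have z2 : 2 * s * lil R n' <= 2 * s / Num.sqrt M%:R * lil R n.
  rewrite [leRHS](_ : _ = 2 * s * (lil R n / Num.sqrt M%:R)); last by ring.
  by rewrite ler_wpM2l// mulr_ge0// ltW.
have z3 : 2 * s / Num.sqrt M%:R * lil R n <= eps / 4 * lil R n by rewrite ler_wpM2r.
have z4 : de * q <= de * lil R n by rewrite ler_wpM2l// ltW.
have z5 : r - eps <= r * (1 - de) * ((1 - M%:R^-1) * (1 - de)) - de - eps / 4.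
  have y1 : (1 - de) ^+ 2 * (1 - M%:R^-1) >= 1 - 2 * de - M%:R^-1.
    have : 0 <= de ^+ 2 * (1 - M%:R^-1) by rewrite mulr_ge0 ?sqr_ge0//; lra.
    have : 0 <= de * M%:R^-1 by rewrite mulr_ge0 ?ltW.
    have -> : (1 - de) ^+ 2 * (1 - M%:R^-1) = 1 - 2 * de - M%:R^-1 +
      de ^+ 2 * (1 - M%:R^-1) + 2 * (de * M%:R^-1) by ring.
    lra.
  by have := ler_wpM2l r0 y1; lra.
have := ler_wpM2r l0 z5; lra.
Qed.

(** * Stationary m-dependent sequences *)

Definition ident_rv f g := forall k : R -> R, lip k ->
  (exists M, forall x, `|k x| <= M) ->
  expect (fun w => k (f w)) = expect (fun w => k (g w)).

Lemma centered_ident f g : ident_rv f g -> centered g -> centered f.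
Proof.
move=> fg gc eps e0; have [b0 h] := gc _ e0.
exists (Num.max 0 b0) => b; rewrite ge_max => /andP[b00 /h].
rewrite (fg _ (clip_lip b) (clip_bdd b00)).
by rewrite (fg _ (lipN_clip b) (bddN (clip_bdd b00))).
Qed.

Lemma moment2_le_ident f g s : ident_rv f g -> moment2_le g s -> moment2_le f s.
Proof.
move=> fg [s0 gs]; split => // b b0.
by rewrite (fg _ (clip_sq_lip b0) (clip_sq_bdd b0)) gs.
Qed.

Lemma tail_cond_ident f g : ident_rv f g -> tail_cond g -> tail_cond f.
Proof.
move=> fg gt c c0; rewrite (_ : (fun k => _) = fun k => 2 ^+ k * tail g (scale c k)).
  exact: gt.
apply/funext => k; congr (_ * _).
exact: fg _ (ramp_lip (scale_gt0 k c0)) (ramp_bdd _).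
Qed.

(** Pigeonhole: if the sum exceeds c / 2 in absolute value, some term reaches c / (2 (p + 1)). The
    successor keeps this level positive at p = 0. *)
Lemma ramp_sum (c : R) (p : nat) (x : nat -> R) : 0 < c ->
  ramp c (\sum_(0 <= l < p) x l) <=
  \sum_(0 <= l < p) ramp (c / (2 * p.+1%:R)) (x l).
Proof.
move=> c0; have [c' c'E] : exists c', c' = c / (2 * p.+1%:R) by eexists.
rewrite -c'E; have c'0 : 0 < c' by rewrite c'E divr_gt0 ?mulr_gt0.
have S0 : 0 <= \sum_(0 <= l < p) ramp c' (x l).
  by rewrite sumr_ge0// => l _; have /andP[] := ramp01 c' (x l).
have [|h] := leP `|\sum_(0 <= l < p) x l| (c / 2); first by move=> /(ramp0 c0) ->.
have [/hasP[l lp lx]|/hasPn hn] := boolP (has (fun l => c' <= `|x l|) (index_iota 0 p)).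
  have /andP[_ h1] := ramp01 c (\sum_(0 <= l < p) x l).
  rewrite (le_trans h1)// (bigD1_seq l)//= ?iota_uniq// (ramp1 c'0 lx) lerDl.
  by rewrite sumr_ge0// => i _; have /andP[] := ramp01 c' (x i).
exfalso; move: h; rewrite ltNge => /negP; apply.
rewrite (le_trans (ler_norm_sum _ _ _))//.
apply: (@le_trans _ _ (\sum_(0 <= l < p) c')).
  rewrite big_nat [leRHS]big_nat; apply: ler_sum => l hl.
  by rewrite ltW// ltNge hn// mem_index_iota.
rewrite sumr_const_nat subn0 -[_ *+ p]mulr_natl c'E mulrCA ler_wpM2l ?(ltW c0)//.
rewrite invfM mulrCA ler_piMr ?invr_ge0// ler_pdivrMr// mul1r ler_nat//.
Qed.

Lemma tail_cond_sum (p : nat) (F : nat -> T -> R) : (forall l, H (F l)) ->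
  (forall l, tail_cond (F l)) ->
  tail_cond (fun w => \sum_(0 <= l < p) F l w).
Proof.
move=> HF Ft c c0.
have Fs : forall n, bounded_sums (fun k => \sum_(0 <= l < n)
    2 ^+ k * tail (F l) (scale (c / (2 * p.+1%:R)) k)).
  elim=> [|n IH].
    by exists 0 => N; rewrite big1// => k _; rewrite big_geq.
  apply: (@bounded_sums_le _ _ (fun k => \sum_(0 <= l < n)
      2 ^+ k * tail (F l) (scale (c / (2 * p.+1%:R)) k) +
      2 ^+ k * tail (F n) (scale (c / (2 * p.+1%:R)) k))).
    by move=> k; rewrite big_nat_recr.
  by apply: bounded_sumsD => //; apply: Ft; rewrite divr_gt0.
apply: bounded_sums_le (Fs p) => k.
rewrite -mulr_sumr ler_wpM2l ?exprn_ge0// /tail.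
have c'0 : 0 < scale (c / (2 * p.+1%:R)) k by apply: scale_gt0; rewrite divr_gt0.
apply: (le_trans _ (expect_sum_le _ _)); last by move=> l _; exact: bdd_ramp.
apply: expect_le.
- by apply: bdd_ramp; [exact: scale_gt0|exact: rv_sum].
- by apply: bdd_rv_sum => l _; exact: bdd_ramp.
- by move=> w; rewrite /scale -mulrAC; exact: ramp_sum (scale_gt0 k c0).
Qed.

Lemma coordv_row_mxl p q (x : 'rV[R]_p) (y : 'rV[R]_q) t : (t < p)%N ->
  coordv t (row_mx x y) = coordv t x.
Proof.
move=> tp; rewrite -[t]/(val (Ordinal tp)) coordvE.
by rewrite -[val _]/(val (lshift q (Ordinal tp))) coordvE row_mxEl.
Qed.

Lemma coordv_row_mxr p q (x : 'rV[R]_p) (y : 'rV[R]_q) t : (t < q)%N ->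
  coordv (p + t) (row_mx x y) = coordv t y.
Proof.
move=> tq; rewrite -[t in RHS]/(val (Ordinal tq)) coordvE.
by rewrite -[(p + t)%N]/(val (rshift p (Ordinal tq))) coordvE row_mxEr.
Qed.

Lemma coordv_segment (X : nat -> T -> R) a k t w : (t < k)%N ->
  coordv t (segment X a k w) = X (a + t)%N w.
Proof. by move=> tk; rewrite -[t in LHS]/(val (Ordinal tk)) coordvE mxE. Qed.

Lemma C_bLip_comp p q (F : 'I_q -> 'rV[R]_p -> R) (phi : 'rV[R]_q -> R) :
  C_bLip phi -> (forall i, lip_in (@coordv p) p (F i)) ->
  C_bLip (fun z => phi (\row_i F i z)).
Proof.
move=> [[M phiM] [L phiL]] FL; split; first by exists M => x.
by apply: lip_coordvP; exact: lip_in_vcomp phiL FL.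
Qed.

Lemma C_bLip_lip (k : R -> R) p (F : 'rV[R]_p -> R) : lip k ->
  (exists M, forall x, `|k x| <= M) -> lip_in (@coordv p) p F ->
  C_bLip (fun z => k (F z)).
Proof.
move=> kl [M kM] Fl; split; first by exists M => x.
by apply: lip_coordvP; exact: lip_in_comp kl Fl.
Qed.

(** Window i of a pattern of period q; the added 1 is due to the sequence starting at [X 1]. Offset
    0 will give the long blocks and offset p the short ones. *)
Definition block (X : nat -> T -> R) (q o len i : nat) (w : T) : R :=
  \sum_(0 <= l < len) X (i * q + o + 1 + l)%N w.

Section Blocks.
Variables (m : nat) (X : nat -> T -> R).
Hypotheses (X_in_H : forall n, (1 <= n)%N -> H (X n))
  (X_mdep : m_dependent E m X) (X_stat : stationary E X).

Lemma stationary_segment (a len : nat) (phi : 'rV[R]_len -> R) : C_bLip phi ->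
  (0 < len)%N ->
  E (fun w => phi (segment X (1 + a) len w)) = E (fun w => phi (segment X 1 len w)).
Proof.
move=> phiC len0; case: a => [//|a]; symmetry.
by apply: X_stat.
Qed.

Lemma block_ident (q o len i : nat) : (0 < len)%N ->
  ident_rv (block X q o len i) (fun w => \sum_(0 <= l < len) X (1 + l)%N w).
Proof.
move=> len0 k kl kb; rewrite /expect.
pose phi (z : 'rV[R]_len) := k (\sum_(0 <= l < len) coordv l z).
have phiC : C_bLip phi.
  apply: C_bLip_lip => //; under eq_fun do rewrite big_nat_cond.
  by apply: lip_in_sum => l /andP[/andP[_ ll] _]; exact: lip_in_coord.
have phiE a w : phi (segment X a len w) = k (\sum_(0 <= l < len) X (a + l)%N w).
  rewrite /phi; congr k; rewrite big_nat [RHS]big_nat; apply: eq_bigr => l /andP[_ ll].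
  exact: coordv_segment.
have := stationary_segment (i * q + o) phiC len0.
under eq_fun do rewrite phiE; under [in RHS]eq_fun do rewrite phiE.
by move=> <-; congr (fine (E _)); apply/funext => w; rewrite /block (addnC _ 1%N).
Qed.

Lemma block_rv (q o len i : nat) : H (block X q o len i).
Proof. by apply: rv_sum => l _; apply: X_in_H; rewrite addnAC addn1. Qed.

(** Consecutive windows are at least m indices apart, so the past ones lie within X 1, ..., X n'
    while the next one starts at n' + m + 1. *)
Lemma block_iid (q o len : nat) : (0 < len)%N -> (len + m <= q)%N ->
  iid_seq (block X q o len).
Proof.
move=> len0 lmq; have HY := block_rv q o len; split => //; last first.
  move=> n k kl kb; rewrite (block_ident q o n len0 kl kb).
  by rewrite (block_ident q o 0 len0 kl kb).
(* [m_dependent] speaks of a nonempty past only. The empty past is a constant vector, and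
   independence from it amounts to the preservation of constants. *)
case=> [|n] phi phiC.
  have phib (x : 'rV[R]_0) : bdd_rv (fun w => phi (row_mx x (segment (block X q o len) 0 1 w))).
    have [[M phiM] [L phiL]] := phiC; split; last by exists M => w.
    apply: (@rv_lip_in (block X q o len) 1) => [i _|]; first exact: HY.
    rewrite (_ : (fun w => _) = fun w => phi (\row_(i < 0 + 1) block X q o len 0%N w)).
      by apply: lip_in_vcomp phiL _ => i; exact: lip_in_coord.
    apply/funext => w; congr phi; apply/rowP => i; rewrite !mxE.
    by case: splitP => [[]//|j _]; rewrite mxE ord1.
  have x0 (w w' : T) : segment (block X q o len) 0 0 w = segment (block X q o len) 0 0 w'.
    by apply/rowP => -[].
  have [w0|Te] := pselect (exists w : T, True); last first.
    by congr E; apply/funext => w; exfalso; apply: Te; exists w.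
  case: w0 => w0 _.
  rewrite (_ : (fun w => fine _) = fun=> fine (E (fun w' => phi (row_mx
    (segment (block X q o len) 0 0 w0) (segment (block X q o len) 0 1 w'))))); last first.
    by apply/funext => w; rewrite (x0 w w0).
  rewrite (sle_cst Es) -/(expect _) -expectE//; congr E; apply/funext => w.
  by rewrite (x0 w w0).
pose n' := (n.+1 * q + o - m)%N.
have mq : (m < q)%N by rewrite (leq_trans _ lmq)// addnC -addn1 leq_add2l.
have n'0 : (0 < n')%N by rewrite subn_gt0 mulSn -addnA (leq_trans mq)// leq_addr.
have n'E : (n' + m = n.+1 * q + o)%N.
  by rewrite subnK// mulSn -addnA (leq_trans (ltnW mq))// leq_addr.
have bound i l : (i < n.+1)%N -> (l < len)%N -> (i * q + o + l < n')%N.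
  move=> iN ll; rewrite -(ltn_add2r m) n'E.
  apply: (@leq_trans (i * q + o + (len + m))).
    by rewrite -!addnA !ltn_add2l ltn_add2r.
  rewrite addnAC leq_add2r (@leq_trans (i.+1 * q))//; last by rewrite leq_mul2r iN orbT.
  by rewrite mulSn addnC leq_add2r.
have := X_mdep n'0 (_ : (m + 1 <= len + m)%N).
rewrite addnK => /(_ _); rewrite addnC leq_add2r => /(_ len0) ind.
pose F (i : 'I_(n.+1 + 1)) (z : 'rV[R]_(n' + len)) : R :=
  if (i < n.+1)%N then \sum_(0 <= l < len) coordv (i * q + o + l) z
  else \sum_(0 <= l < len) coordv (n' + l) z.
have Fl i : lip_in (@coordv (n' + len)) (n' + len) (F i).
  rewrite /F; case iN: (i < n.+1)%N; under eq_fun do rewrite big_nat_cond;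
    apply: lip_in_sum => l /andP[/andP[_ ll] _]; apply: lip_in_coord.
    by rewrite (leq_trans (bound i l iN ll))// leq_addr.
  by rewrite ltn_add2l.
have := ind _ (C_bLip_comp phiC Fl).
have FE w w' : \row_i F i (row_mx (segment X 1 n' w) (segment X (n' + m + 1) len w')) =
    row_mx (segment (block X q o len) 0 n.+1 w) (segment (block X q o len) n.+1 1 w').
  apply/rowP => i; rewrite !mxE /F; case: splitP => j ij.
    rewrite ij mxE /block big_nat [RHS]big_nat; apply: eq_bigr => l /andP[_ ll].
    rewrite coordv_row_mxl ?bound// coordv_segment ?bound//.
    by congr (X _ w); rewrite add0n addnC addnAC.
  rewrite mxE /block big_nat [RHS]big_nat; apply: eq_bigr => l /andP[_ ll].
  rewrite coordv_row_mxr// coordv_segment//; congr (X _ w').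
  by rewrite n'E ord1 addn0.
under eq_fun do rewrite FE.
move=> ->; congr E; apply/funext => w; congr (fine (E _)); apply/funext => w'.
by rewrite FE.
Qed.

End Blocks.

(** * Truncated second moments as least norms *)

Lemma trunc_rv_sq (S : T -> R) (c : R) : 0 <= c ->
  trunc_rv (fun w => S w ^+ 2) c = fun w => clip (Num.sqrt c) (S w) ^+ 2.
Proof.
move=> c0; apply/funext => w; rewrite /trunc_rv clip_sqE ?sqrtr_ge0//.
rewrite max_r; last first.
  by rewrite le_min; apply/andP; split; have := sqr_ge0 (S w); lra.
have [h|h] := leP `|S w| (Num.sqrt c).
  rewrite real_normK ?num_real// min_l//.
  rewrite -[leRHS](sqr_sqrtr c0) -[leLHS]real_normK ?num_real//.
  by rewrite lerXn2r ?nnegrE ?sqrtr_ge0.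
rewrite sqr_sqrtr// min_r// -[leLHS](sqr_sqrtr c0) -[leRHS]real_normK ?num_real//.
by rewrite lerXn2r ?nnegrE ?sqrtr_ge0// ltW.
Qed.

Lemma trunc_rv_sqN (S : T -> R) (c : R) : 0 <= c ->
  trunc_rv (fun w => - S w ^+ 2) c = fun w => - clip (Num.sqrt c) (S w) ^+ 2.
Proof.
move=> c0; apply/funext => w.
have /(congr1 (@^~ w)) /= <- := trunc_rv_sq S c0.
exact: clipN.
Qed.

Lemma clip_sq_mono (b b' x : R) : 0 <= b -> b <= b' ->
  clip b x ^+ 2 <= clip b' x ^+ 2.
Proof.
move=> b0 bb; have b'0 := le_trans b0 bb; rewrite !clip_sqE//.
rewrite lerXn2r ?nnegrE ?le_min ?normr_ge0//=.
by rewrite !ge_min lexx bb orbT.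
Qed.

Lemma rv_sqr (f : T -> R) : H f -> H (fun w => f w ^+ 2).
Proof.
move=> Hf; pose phi (x : 'rV[R]_1) := x 0 0 ^+ 2.
rewrite (_ : (fun w => _) = fun w => phi (rvec (fun=> f) w)); last first.
  by apply/funext => w; rewrite /phi mxE.
apply: (rvs_lLip Hs) => [|i]; last exact: Hf.
exists 1, 1%N; split => // x y; rewrite mul1r !expr1 /phi subr_sqr normrM mulrC.
have hx := coord_le_enorm x 0; have hy := coord_le_enorm y 0.
apply: ler_pM => //.
  by rewrite (le_trans (ler_normD _ _))//; lra.
by rewrite (le_trans _ (coord_le_enorm _ 0))// !mxE.
Qed.

Lemma trunc_expect_sq_ge (S : T -> R) (b : R) : H S -> 0 <= b ->
  ((expect (fun w => clip b (S w) ^+ 2))%:E <=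
    trunc_expect E (fun w => (S w ^+ 2)%R))%E.
Proof.
move=> HS b0; have [cS _] := ge0_has_trunc_expect Hs Es (rv_sqr HS) (fun w => sqr_ge0 (S w)).
apply: lime_ge => //; near=> c.
have c0 : 0 <= c by near: c; exact: (nbhs_pinfty_ge (num_real _)).
rewrite trunc_rv_sq// expectE; last exact: bdd_clip_sq (sqrtr_ge0 c) HS.
rewrite lee_fin.
apply: (expect_le (bdd_clip_sq b0 HS) (bdd_clip_sq (sqrtr_ge0 c) HS)) => w.
apply: clip_sq_mono => //; rewrite -[leLHS]ger0_norm// -sqrtr_sqr; apply: ler_wsqrtr.
by near: c; exact: (nbhs_pinfty_ge (num_real _)).
Unshelve. all: by end_near. Qed.

Lemma trunc_expect_sq_le (S : T -> R) (t : R) : H S ->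
  (forall b, 0 <= b -> expect (fun w => clip b (S w) ^+ 2) <= t) ->
  (trunc_expect E (fun w => (S w ^+ 2)%R) <= t%:E)%E.
Proof.
move=> HS ht; have [cS _] := ge0_has_trunc_expect Hs Es (rv_sqr HS) (fun w => sqr_ge0 (S w)).
apply: lime_le => //; near=> c.
have c0 : 0 <= c by near: c; exact: (nbhs_pinfty_ge (num_real _)).
rewrite trunc_rv_sq// expectE ?lee_fin ?ht ?sqrtr_ge0//.
exact: bdd_clip_sq.
Unshelve. all: by end_near. Qed.

Lemma trunc_cexpect_sq_ge (S : T -> R) (b : R) : H S -> 0 <= b ->
  ((- expect (fun w => - clip b (S w) ^+ 2))%:E <=
    trunc_cexpect E (fun w => (S w ^+ 2)%R))%E.
Proof.
move=> HS b0; have [_ cS] := ge0_has_trunc_expect Hs Es (rv_sqr HS) (fun w => sqr_ge0 (S w)).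
rewrite EFinN leeN2; apply: lime_le => //; near=> c.
have c0 : 0 <= c by near: c; exact: (nbhs_pinfty_ge (num_real _)).
have hc := bdd_rvN (bdd_clip_sq (sqrtr_ge0 c) HS).
rewrite trunc_rv_sqN// expectE// lee_fin.
apply: (expect_le hc (bdd_rvN (bdd_clip_sq b0 HS))) => w.
rewrite lerN2; apply: clip_sq_mono => //; rewrite -[leLHS]ger0_norm// -sqrtr_sqr; apply: ler_wsqrtr.
by near: c; exact: (nbhs_pinfty_ge (num_real _)).
Unshelve. all: by end_near. Qed.

Lemma trunc_cexpect_sq_le (S : T -> R) (t : R) : H S ->
  (forall b, 0 <= b -> - expect (fun w => - clip b (S w) ^+ 2) <= t) ->
  (trunc_cexpect E (fun w => (S w ^+ 2)%R) <= t%:E)%E.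
Proof.
move=> HS ht; have [_ cS] := ge0_has_trunc_expect Hs Es (rv_sqr HS) (fun w => sqr_ge0 (S w)).
rewrite leeNl -EFinN; apply: lime_ge => //; near=> c.
have c0 : 0 <= c by near: c; exact: (nbhs_pinfty_ge (num_real _)).
rewrite trunc_rv_sqN// expectE; last exact: bdd_rvN (bdd_clip_sq (sqrtr_ge0 c) HS).
by rewrite lee_fin lerNl ht ?sqrtr_ge0.
Unshelve. all: by end_near. Qed.

(** The root of the truncated second moment is the least bound; minimality is what later turns
    inequalities between bounds into inequalities between norms. *)
Lemma moment2_optimal (S : T -> R) : H S ->
  (trunc_expect E (fun w => (S w ^+ 2)%R) < +oo)%E ->
  exists al : R, [/\ moment2_le S al, forall t, moment2_le S t -> al <= t
    & trunc_expect E (fun w => (S w ^+ 2)%R) = (al ^+ 2)%:E].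
Proof.
move=> HS; have := trunc_expect_sq_ge HS (lexx 0).
have := @trunc_expect_sq_le S _ HS; have := fun b => @trunc_expect_sq_ge S b HS.
case: (trunc_expect _ _) => [L| |]//; move=> hge hle L0 _; last first.
have {}L0 : 0 <= L.
  rewrite -lee_fin (le_trans _ L0)// lee_fin.
  by apply: expect_ge0 => [|w]; [exact: bdd_clip_sq|exact: sqr_ge0].
exists (Num.sqrt L); split; last by rewrite sqr_sqrtr.
  split; first exact: sqrtr_ge0.
  by move=> b b0; rewrite sqr_sqrtr// -lee_fin hge.
move=> t [t0 ht]; rewrite -[leRHS](ger0_norm t0) -sqrtr_sqr ler_wsqrtr//.
by rewrite -lee_fin; apply: hle.
Qed.

Lemma lmoment2_optimal (S : T -> R) (s : R) : H S -> moment2_le S s ->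
  exists be : R, [/\ lmoment2_le S be, forall t, lmoment2_le S t -> be <= t,
    be <= s & trunc_cexpect E (fun w => (S w ^+ 2)%R) = (be ^+ 2)%:E].
Proof.
move=> HS [s0 hs]; have ls : lmoment2_le S s.
  split => // b b0; rewrite (le_trans _ (hs b b0))//.
  exact: expectN_ge (bdd_clip_sq b0 HS).
have := trunc_cexpect_sq_le HS ls.2.
have := trunc_cexpect_sq_ge HS (lexx 0).
have := @trunc_cexpect_sq_le S _ HS; have := fun b => @trunc_cexpect_sq_ge S b HS.
case: (trunc_cexpect _ _) => [L| |]//; move=> hge hle L0 Ls.
have {}L0 : 0 <= L.
  rewrite -lee_fin (le_trans _ L0)// lee_fin oppr_ge0 -[leRHS](expect_cst 0).
  apply: (expect_le (bdd_rvN (bdd_clip_sq (lexx 0) HS)) (bdd_rv_cst 0)).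
  by move=> w; rewrite oppr_le0 sqr_ge0.
have lst t : lmoment2_le S t -> Num.sqrt L <= t.
  move=> [t0 ht]; rewrite -[leRHS](ger0_norm t0) -sqrtr_sqr ler_wsqrtr//.
  by rewrite -lee_fin; apply: hle.
exists (Num.sqrt L); split; [|exact: lst|exact: lst|by rewrite sqr_sqrtr].
split; first exact: sqrtr_ge0.
by move=> b b0; rewrite sqr_sqrtr// -lee_fin hge.
Qed.

(** A value below the least norm is exceeded at some finite truncation level, the form required by
    the bump estimate; passing to b + 1 secures positivity. *)
Lemma lmoment2_witness (S : T -> R) (be r : R) :
  H S -> (forall t, lmoment2_le S t -> be <= t) -> 0 <= r -> r < be ->
  exists2 b, 0 < b & r ^+ 2 <= - expect (fun w => - clip b (S w) ^+ 2).
Proof.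
move=> HS bl r0 rb; apply: contrapT => nb.
suff : be <= r by rewrite leNgt rb.
apply: bl; split => // b b0; rewrite leNgt; apply/negP => hb.
apply: nb; exists (b + 1); first by rewrite ltr_wpDl.
rewrite ltW// (lt_le_trans hb)// lerN2; apply: expect_le.
- by apply: bdd_rvN; apply: bdd_clip_sq => //; rewrite addr_ge0.
- exact: bdd_rvN (bdd_clip_sq b0 HS).
- by move=> w; rewrite lerN2; apply: clip_sq_mono => //; rewrite lerDl.
Qed.

Lemma centered_of_trunc (f : T -> R) : H f ->
  has_trunc_expect E f -> has_trunc_expect E (fun w => - f w) ->
  trunc_expect E f = 0%E -> trunc_cexpect E f = 0%E -> centered f.
Proof.
move=> Hf c1 c2 l1 l2 eps e0.
have {}l2 : trunc_expect E (fun w => - f w) = 0%E.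
  by move: l2; rewrite /trunc_cexpect => /eqP; rewrite oppe_eq0 => /eqP.
have h (g : T -> R) : has_trunc_expect E g -> trunc_expect E g = 0%E ->
    exists b0, forall b, b0 <= b -> (E (trunc_rv g b) <= eps%:E)%E.
  move=> cg lg; move: cg; rewrite /has_trunc_expect cvg_ex => -[l cl].
  have le0 : l = 0%E by rewrite -lg; symmetry; apply: cvg_lim.
  rewrite le0 in cl.
  have nb : nbhs (0%E : \bar R) [set x | (x < eps%:E)%E].
    apply: open_nbhs_nbhs; split; first exact: open_ereal_lt_ereal.
    by rewrite /= lte_fin.
  have [M [_ hM]] := cl _ nb.
  exists (M + 1) => b Mb; apply: ltW; apply: hM.
  by rewrite (lt_le_trans _ Mb)// ltrDl.
have [b1 h1] := h _ c1 l1; have [b2 h2] := h _ c2 l2.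
exists (Num.max 0 (Num.max b1 b2)) => b.
rewrite !ge_max => /and3P[b0 /h1 k1 /h2 k2]; split.
  by rewrite -lee_fin -expectE//; exact: bdd_clip.
rewrite -lee_fin -expectE; last exact: bdd_rvN (bdd_clip b0 Hf).
apply: le_trans k2; rewrite le_eqVlt; apply/orP; left; apply/eqP; congr E.
by apply/funext => w; rewrite -clipN.
Qed.

(** The ramp at [scale c k] vanishes unless |f| exceeds half that scale, where f^2 / log log |f| is
    at least min(c^2/4, 1) 2^k. Compatibility bounds its expectation by the capacity of that
    event. *)
Lemma tail_cond_choquet (V : set T -> R) f : subadditive_capacity V ->
  capacity_compatible H E V -> H f ->
  (choquet V (fun w => (f w ^+ 2 / logp (logp `|f w|))%R) < +oo)%E ->
  tail_cond f.
Proof.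
move=> Vc VE Hf; pose Z w := f w ^+ 2 / logp (logp `|f w|).
rewrite -[(fun w => _)]/Z => Zint c c0.
have L0 x : 0 < logp (logp x) :> R by rewrite (lt_le_trans ltr01 (logp_ge1 _)).
have Z0 w : 0 <= Z w by rewrite divr_ge0 ?sqr_ge0// ltW.
have mZ := measurable_div_loglog (rvs_measurable Hs Hf).
have mA t : measurable [set w | t <= Z w].
  rewrite (_ : [set w | _] = setT `&` Z @^-1` `[t, +oo[%classic).
    by apply: mZ => //; exact: measurable_itv.
  by rewrite setTI; apply/seteqP; split => w /=; rewrite in_itv/= andbT.
pose G t := V [set w | t <= Z w].
have G0 t : 0 <= G t by have /andP[] := cap_range Vc (mA t).
have Gni : nonincreasing_fun G.
  move=> s t st; apply: (cap_monotone Vc) => //.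
  by move=> w /= tZ; rewrite (le_trans st).
have {}Zint : (\int[lebesgue_measure]_(t in `[0%R, +oo[) (G t)%:E < +oo)%E.
  move: Zint; rewrite /choquet [X in (_ + X)%E](_ : _ = 0%E) ?adde0//.
  apply: integral0_eq => t /=; rewrite in_itv/= => t0; congr (_%:E).
  rewrite (_ : [set w | _] = setT) ?(cap_setT Vc) ?subrr//.
  by apply/seteqP; split => // w _ /=; rewrite (le_trans t0).
have c40 : 0 < c ^+ 2 / 4 by rewrite divr_gt0 ?exprn_gt0.
have m0 : 0 < Num.min (c ^+ 2 / 4) 1 by rewrite lt_min c40 ltr01.
apply: bounded_sums_le (bounded_sums_dyadic G0 Gni Zint m0) => k.
rewrite ler_wpM2l ?exprn_ge0//; have s0 := scale_gt0 k c0.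
have b1 := bdd_ramp s0 Hf; rewrite -lee_fin -expectE//.
have [] := VE _ (fun=> 1) _ b1.1 (rv_cst 1) (mA (Num.min (c ^+ 2 / 4) 1 * 2 ^+ k)) => //.
move=> w; rewrite indicE; have /andP[r0 r1] := ramp01 (scale c k) (f w).
  have [//|wA] := boolP (w \in _); rewrite ramp0//.
  rewrite leNgt; apply: contraNN wA => h; rewrite inE/=.
  apply: sq_div_loglog_ge => //.
  rewrite -[leRHS]real_normK ?num_real//.
  rewrite (_ : _ * _ = (scale c k / 2) ^+ 2); last first.
    rewrite /scale !exprMn sqr_sqrtr ?mulr_ge0 ?exprn_ge0 ?lnk_ge0//.
    by move: (2 ^+ k * _) => x; field.
  by rewrite lerXn2r ?nnegrE ?divr_ge0 ?(ltW s0)// ltW.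
Qed.

(** * Partial sums of the m-dependent sequence, by blocks *)

Section PartialSums.
Variables (m : nat) (X : nat -> T -> R) (s1 : R).
Hypotheses (X_in_H : forall n, (1 <= n)%N -> H (X n))
  (X_mdep : m_dependent E m X) (X_stat : stationary E X)
  (X_centered : centered (X 1%N)) (X_moment2 : moment2_le (X 1%N) s1)
  (X_tail : tail_cond (X 1%N)).

Lemma psumE n : psum X n = fun w => \sum_(0 <= l < n) X (1 + l)%N w.
Proof.
apply/funext => w; rewrite /psum big_add1 /=.
by apply: eq_bigr => l _; rewrite add1n.
Qed.

Lemma psumS n : psum X n.+1 = fun w => psum X n w + X n.+1 w.
Proof. by apply/funext => w; rewrite /psum big_nat_recr. Qed.

Lemma psum_rv n : H (psum X n).
Proof. by rewrite psumE; apply: rv_sum => l _; exact: X_in_H. Qed.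

Lemma block_psum_ident q o len i : (0 < len)%N ->
  ident_rv (block X q o len i) (psum X len).
Proof. by move=> len0; rewrite psumE; exact: block_ident. Qed.

Lemma ident_rv1 n : ident_rv (X n.+1) (X 1%N).
Proof.
have := @block_psum_ident 0 n 1 0 (ltn0Sn 0).
rewrite (_ : block _ _ _ _ _ = X n.+1); last first.
  by apply/funext => w; rewrite /block big_nat1 mul0n add0n addn0 addn1.
rewrite (_ : psum X 1 = X 1%N)//.
by apply/funext => w; rewrite /psum big_nat1.
Qed.

(** Minkowski alone gives linear growth, enough for finiteness and for remainders of bounded length;
    square-root growth comes from the blocks. *)
Lemma psum_moment2 n : moment2_le (psum X n) (n%:R * s1).
Proof.
elim: n => [|n IH].
  rewrite mul0r (_ : psum X 0 = fun=> 0); last by apply/funext => w; rewrite /psum big_geq.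
  split => // b b0; rewrite (_ : (fun _ => _) = fun=> 0).
    by rewrite expect_cst expr0n.
  by apply/funext => w; rewrite clip_id ?normr0// expr0n.
rewrite psumS -natr1 mulrDl mul1r.
apply: moment2_leD (psum_rv n) (X_in_H _) IH _ => //.
exact: moment2_le_ident (ident_rv1 n) X_moment2.
Qed.

Lemma psum_centered n : centered (psum X n).
Proof.
elim: n => [|n IH].
  rewrite (_ : psum X 0 = fun=> 0); last by apply/funext => w; rewrite /psum big_geq.
  move=> eps e0; exists 0 => b b0.
  have -> : (fun _ : T => clip b 0) = fun=> 0 by apply/funext => w; rewrite clip_id ?normr0.
  have -> : (fun _ : T => - clip b 0) = fun=> 0.
    by apply/funext => w; rewrite clip_id ?normr0// oppr0.
  by rewrite expect_cst (ltW e0).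
rewrite psumS.
have Xm := moment2_le_ident (ident_rv1 n) X_moment2.
apply: (centeredD (psum_rv n) (X_in_H _) (psum_moment2 n) Xm IH) => //.
exact: centered_ident (ident_rv1 n) X_centered.
Qed.

Lemma psum_tail_cond n : tail_cond (psum X n).
Proof.
rewrite psumE; apply: tail_cond_sum => l; first exact: X_in_H.
exact: tail_cond_ident (ident_rv1 l) X_tail.
Qed.

Lemma psumD a r w :
  psum X (a + r) w = psum X a w + \sum_(0 <= l < r) X (a + 1 + l)%N w.
Proof.
elim: r => [|r IH]; first by rewrite addn0 big_geq// addr0.
rewrite addnS psumS IH big_nat_recr//= addrA; congr (_ + X _ w).
by rewrite addn1 addSn.
Qed.

Lemma psum_blocks (p g N : nat) w : psum X (N * (p + g)) w =
  \sum_(0 <= i < N) block X (p + g) 0 p i w +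
  \sum_(0 <= i < N) block X (p + g) p g i w.
Proof.
elim: N => [|N IH]; first by rewrite mul0n /psum !big_geq// addr0.
rewrite mulSn addnC addnA !psumD IH !big_nat_recr//= addrACA addrA.
by congr (_ + _ + _); rewrite /block; apply: eq_bigr => l _; rewrite ?addn0.
Qed.

Lemma psum_norms : exists al be : nat -> R, forall n,
  [/\ moment2_le (psum X n) (al n),
      forall t, moment2_le (psum X n) t -> al n <= t
    & trunc_expect E (fun w => (psum X n w ^+ 2)%R) = (al n ^+ 2)%:E] /\
  [/\ lmoment2_le (psum X n) (be n),
      forall t, lmoment2_le (psum X n) t -> be n <= t, be n <= al n
    & trunc_cexpect E (fun w => (psum X n w ^+ 2)%R) = (be n ^+ 2)%:E].
Proof.
have h n : exists xy : R * R,
  [/\ moment2_le (psum X n) xy.1,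
      forall t, moment2_le (psum X n) t -> xy.1 <= t
    & trunc_expect E (fun w => (psum X n w ^+ 2)%R) = (xy.1 ^+ 2)%:E] /\
  [/\ lmoment2_le (psum X n) xy.2,
      forall t, lmoment2_le (psum X n) t -> xy.2 <= t, xy.2 <= xy.1
    & trunc_cexpect E (fun w => (psum X n w ^+ 2)%R) = (xy.2 ^+ 2)%:E].
  have [_ hs] := psum_moment2 n.
  have [|al hal] := moment2_optimal (psum_rv n).
    exact: le_lt_trans (trunc_expect_sq_le (psum_rv n) hs) (ltry _).
  have [al1 _ _] := hal.
  have [be [b1 b2 b3 b4]] := lmoment2_optimal (psum_rv n) al1.
  by exists (al, be).
have [f hf] := choice h.
by exists (fun n => (f n).1), (fun n => (f n).2).
Qed.

Lemma remainder_moment2 a r :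
  moment2_le (fun w => \sum_(0 <= l < r) X (a + 1 + l)%N w) (r%:R * s1).
Proof.
have [->|r0] := posnP r.
  rewrite (_ : (fun w => _) = psum X 0); first exact: psum_moment2.
  by apply/funext => w; rewrite /psum !big_geq.
rewrite (_ : (fun w => _) = block X 0 a r 0).
  exact: moment2_le_ident (block_psum_ident 0 a 0 r0) (psum_moment2 r).
by apply/funext => w; apply: eq_bigr => l _; rewrite mul0n add0n.
Qed.

Section Blocking.
Variables (p g : nat).
Hypotheses (gm : (m < g)%N) (gp : (g <= p)%N).

Let Y := block X (p + g) 0 p.
Let Z := block X (p + g) p g.

Let g0 : (0 < g)%N. Proof. exact: leq_ltn_trans gm. Qed.
Let p0 : (0 < p)%N. Proof. exact: leq_trans gp. Qed.

(** The gap between long blocks is g > m; between short blocks it is p >= g. *)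
Lemma long_block_iid : iid_seq Y.
Proof. by apply: (block_iid X_in_H X_mdep X_stat) => //; rewrite leq_add2l ltnW. Qed.

Lemma short_block_iid : iid_seq Z.
Proof.
apply: (block_iid X_in_H X_mdep X_stat) => //.
by rewrite addnC leq_add2r (leq_trans (ltnW gm)).
Qed.

Lemma long_block_ident : ident_rv (Y 0%N) (psum X p).
Proof. exact: block_psum_ident. Qed.

Lemma short_block_ident : ident_rv (Z 0%N) (psum X g).
Proof. exact: block_psum_ident. Qed.

Let sum_rv (W : nat -> T -> R) N : iid_seq W -> H (fun w => \sum_(0 <= i < N) W i w).
Proof. by move=> [HW _ _]; apply: rv_sum => i _; exact: HW. Qed.

Let rest_rv a r : H (fun w => \sum_(0 <= l < r) X (a + 1 + l)%N w).
Proof. by apply: rv_sum => i _; apply: X_in_H; rewrite addnAC addn1. Qed.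

Lemma psum_decomp N r : psum X (N * (p + g) + r) = fun w =>
  \sum_(0 <= i < N) Y i w + (\sum_(0 <= i < N) Z i w +
  \sum_(0 <= l < r) X (N * (p + g) + 1 + l)%N w).
Proof. by apply/funext => w; rewrite psumD psum_blocks addrA. Qed.

Let rest_moment2 N r s : (r < p + g)%N -> moment2_le (psum X g) s ->
  moment2_le (fun w => \sum_(0 <= i < N) Z i w +
    \sum_(0 <= l < r) X (N * (p + g) + 1 + l)%N w)
    (Num.sqrt N%:R * s + (p + g)%:R * s1).
Proof.
move=> rq gs; have [s10 _] := X_moment2.
have hZ := iid_moment2 N short_block_iid
  (centered_ident short_block_ident (psum_centered g))
  (moment2_le_ident short_block_ident gs).
apply: (moment2_leD (sum_rv N short_block_iid) (rest_rv _ _) hZ).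
apply: moment2_le_trans (remainder_moment2 _ r).
by rewrite ler_wpM2r// ler_nat ltnW.
Qed.

Lemma psum_moment2_blocks N r s t : (r < p + g)%N ->
  moment2_le (psum X p) s -> moment2_le (psum X g) t ->
  moment2_le (psum X (N * (p + g) + r))
    (Num.sqrt N%:R * (s + t) + (p + g)%:R * s1).
Proof.
move=> rq ps gt; rewrite psum_decomp mulrDr -addrA.
have hY := iid_moment2 N long_block_iid
  (centered_ident long_block_ident (psum_centered p))
  (moment2_le_ident long_block_ident ps).
apply: (moment2_leD (sum_rv N long_block_iid) _ hY (rest_moment2 N rq gt)).
exact: rvs_add (sum_rv N short_block_iid) (rest_rv _ _).
Qed.

Lemma lmoment2_le_ident f f' s : ident_rv f f' -> lmoment2_le f' s -> lmoment2_le f s.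
Proof.
move=> ff [s0 fs]; split => // b b0.
by rewrite (ff _ (lipN (clip_sq_lip b0)) (bddN (clip_sq_bdd b0))) fs.
Qed.

(** The lower norm is kept for the long blocks; short blocks and remainder enter with their upper
    norms, as in [lmoment2_leD]. *)
Lemma psum_lmoment2_blocks N r s t : (r < p + g)%N ->
  lmoment2_le (psum X p) s -> moment2_le (psum X g) t ->
  lmoment2_le (psum X (N * (p + g) + r))
    (Num.sqrt N%:R * (s + t) + (p + g)%:R * s1).
Proof.
move=> rq ps gt; rewrite psum_decomp mulrDr -addrA.
have hY := iid_lmoment2 N long_block_iid
  (centered_ident long_block_ident (psum_centered p))
  (lmoment2_le_ident long_block_ident ps).
apply: (lmoment2_leD (sum_rv N long_block_iid) _ hY (rest_moment2 N rq gt)).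
exact: rvs_add (sum_rv N short_block_iid) (rest_rv _ _).
Qed.

End Blocking.

(** Handles the incomplete last block, which has boundedly many terms. The indices in [2^k, 2^(k+1)[
    contribute at most 2^k tails at [scale c k], the terms of [tail_cond]. *)
Lemma psum_negligible (c : R) : 0 < c ->
  null_set [set w | ~ exists N0, forall n, (N0 <= n)%N -> `|X n w| <= c * lil R n].
Proof.
move=> c0.
pose xi k w := \sum_(2 ^ k <= n < 2 ^ k.+1) ramp (scale c k) (X n w).
have Xn k n : (2 ^ k <= n)%N -> H (X n).
  by move=> kn; apply: X_in_H; rewrite (leq_trans _ kn)// expn_gt0.
have xib k : bdd_rv (xi k).
  rewrite /xi; under eq_fun do rewrite big_nat_cond.
  apply: bdd_rv_sum => n /andP[/andP[kn _] _].
  exact: bdd_ramp (scale_gt0 k c0) (Xn k n kn).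
have xi0 k w : 0 <= xi k w.
  by apply: sumr_ge0 => n _; have /andP[] := ramp01 (scale c k) (X n w).
have xis : bounded_sums (fun k => expect (xi k)).
  apply: bounded_sums_le (X_tail c0) => k.
  rewrite /xi; under eq_fun do rewrite big_nat_cond.
  apply: (le_trans (expect_sum_le _ _)) => [n /andP[/andP[kn _] _]|].
    exact: bdd_ramp (scale_gt0 k c0) (Xn k n kn).
  rewrite -big_nat_cond (_ : 2 ^+ k * _ = \sum_(2 ^ k <= n < 2 ^ k.+1) tail (X 1%N) (scale c k)).
    rewrite big_nat_cond [leRHS]big_nat_cond.
    apply: ler_sum => -[|n] /andP[/andP[kn _] _].
      by move: kn; rewrite leqn0 expn_eq0.
    rewrite /tail (ident_rv1 n (ramp_lip (scale_gt0 k c0)) (ramp_bdd _)).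
    exact: lexx.
  by rewrite sumr_const_nat expnS mul2n -addnn addnK -[RHS]mulr_natl natrX.
apply: null_set_sub (borel_cantelli xib xi0 xis) => w /= nw K.
have [K1 hK1] := @lnk_le_loglog R 1 ltr01.
apply: contrapT => hK; apply: nw; exists (2 ^ maxn K K1)%N => n Kn.
have n0 : (0 < n)%N by rewrite (leq_trans _ Kn)// expn_gt0.
have kK : (maxn K K1 <= trunc_log 2 n)%N by apply: trunc_log_max.
have kn : (2 ^ trunc_log 2 n <= n)%N by exact: trunc_logP.
have nk : (n < 2 ^ (trunc_log 2 n).+1)%N by exact: trunc_log_ltn.
move: (trunc_log 2 n) kK kn nk => k; rewrite geq_max => /andP[Kk K1k] kn nk.
rewrite leNgt; apply/negP => h; apply: hK; exists k => //.
rewrite /xi (bigD1_seq n)/= ?iota_uniq//; last by rewrite mem_index_iota kn.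
rewrite ramp1 ?scale_gt0//.
  by rewrite lerDl sumr_ge0// => i _; have /andP[] := ramp01 (scale c k) (X i w).
rewrite (le_trans _ (ltW h))// /scale ler_wpM2l ?(ltW c0)//.
apply: ler_wsqrtr; rewrite [2 * _]mulrC -mulrA; apply: ler_pM.
- exact: exprn_ge0.
- exact: lnk_ge0.
- by rewrite -natrX ler_nat.
- by have := hK1 k n K1k kn; rewrite (_ : 1 + 1 = 2).
Qed.

Section Norms.
Variables (al be : nat -> R).
Hypotheses (al_moment2 : forall n, moment2_le (psum X n) (al n))
  (al_least : forall n t, moment2_le (psum X n) t -> al n <= t)
  (be_lmoment2 : forall n, lmoment2_le (psum X n) (be n))
  (be_least : forall n t, lmoment2_le (psum X n) t -> be n <= t).

Lemma upper_norm_cvg : exists2 sigma : R, 0 <= sigma &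
  al n / Num.sqrt n%:R @[n --> \oo] --> sigma.
Proof.
have [s10 _] := X_moment2.
(* The constant [C1] is the norm of one short block, of length m + 1. *)
apply: (@sqrt_growth_cvg _ al (al m.+1) m.+1 m.+1) => // [n||p mp].
- by have [] := al_moment2 n.
- by have [] := al_moment2 m.+1.
exists ((p + m.+1)%:R * s1); first by rewrite mulr_ge0.
move=> N r rq; apply: al_least.
exact: psum_moment2_blocks.
Qed.

Lemma lower_norm_cvg : exists2 sigma : R, 0 <= sigma &
  be n / Num.sqrt n%:R @[n --> \oo] --> sigma.
Proof.
have [s10 _] := X_moment2.
apply: (@sqrt_growth_cvg _ be (al m.+1) m.+1 m.+1) => // [n||p mp].
- by have [] := be_lmoment2 n.
- by have [] := al_moment2 m.+1.
exists ((p + m.+1)%:R * s1); first by rewrite mulr_ge0.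
move=> N r rq; apply: be_least.
exact: psum_lmoment2_blocks.
Qed.

Lemma sqrt_natr_ge (x : R) : exists K, forall n, (K <= n)%N -> x <= Num.sqrt n%:R.
Proof.
have [K hK] := natr_ge (x ^+ 2); exists K => n /hK xn.
by rewrite (le_trans (ler_norm x))// -sqrtr_sqr ler_wsqrtr.
Qed.

Lemma psum_upper (sigma eps : R) :
  al n / Num.sqrt n%:R @[n --> \oo] --> sigma -> 0 <= sigma -> 0 < eps ->
  null_set [set w | ~ exists N0, forall n, (N0 <= n)%N ->
    psum X n w <= (sigma + eps) * lil R n].
Proof.
(* The budget of 7 eta: three beyond sigma for the long blocks, three for the short ones, one for
   the incomplete block. *)
move=> alc sg0 e0; have [eta etaE] : exists eta, eps = 7 * eta.
  by exists (eps / 7); field.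
have h0 : 0 < eta by lra.
have [K1 hK1] : exists K, forall n, (K <= n)%N -> al n / Num.sqrt n%:R <= sigma + eta.
  have : \forall n \near \oo, al n / Num.sqrt n%:R <= sigma + eta.
    by apply: (cvgr_le sigma) => //; lra.
  by move=> [K _ hK]; exists K => n; exact: hK.
have [K2 hK2] := sqrt_natr_ge (al m.+1 / eta).
pose g := m.+1; pose p := maxn g (maxn K1 K2); pose q := (p + g)%N.
have gp : (g <= p)%N by rewrite leq_max leqnn.
have q0 : (0 < q)%N by rewrite addn_gt0 orbT.
have p0 : (0 < p)%N by rewrite (leq_trans _ gp).
have Q0 : 0 < Num.sqrt q%:R :> R by rewrite sqrtr_gt0 ltr0n.
have P0 : 0 < Num.sqrt p%:R :> R by rewrite sqrtr_gt0 ltr0n.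
have PQ : Num.sqrt p%:R <= Num.sqrt q%:R :> R by rewrite ler_wsqrtr// ler_nat leq_addr.
have alp : al p <= (sigma + eta) * Num.sqrt q%:R.
  apply: (@le_trans _ _ ((sigma + eta) * Num.sqrt p%:R)).
    by rewrite -ler_pdivrMr// hK1// /p !leq_max leqnn orbT.
  by rewrite ler_wpM2l// addr_ge0// ltW.
have alg : al g <= eta * Num.sqrt q%:R.
  rewrite mulrC -ler_pdivrMr// hK2// /q (leq_trans _ (leq_addr _ _))//.
  by rewrite /p !leq_max leqnn !orbT.
move: (Num.sqrt q%:R) Q0 PQ alp alg (@lil_div R ^~ q) => Q Q0 PQ alp alg lilq.
have aQ : 0 < eta * Q by rewrite mulr_gt0.
have [alp0 _] := al_moment2 p; have [alg0 _] := al_moment2 g.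
have upper (W : nat -> T -> R) (k : nat) : iid_seq W -> ident_rv (W 0%N) (psum X k) ->
    null_set [set w | ~ exists N0, forall n, (N0 <= n)%N ->
      \sum_(0 <= i < n) W i w <= (al k + eta * Q + eta * Q) * lil R n].
  move=> Wi Wk; have [alk0 _] := al_moment2 k.
  (* One eta Q makes the norm positive; the other becomes the relative error asked for by
     [iid_upper]. *)
  have s0 : 0 < al k + eta * Q by rewrite ltr_wpDl.
  have := iid_upper Wi (centered_ident Wk (psum_centered k))
    (moment2_le_ident Wk (moment2_le_trans _ (al_moment2 k))) s0
    (tail_cond_ident Wk (psum_tail_cond k)) (divr_gt0 aQ s0).
  rewrite mulrDl mul1r mulfVK ?gt_eqF//; apply.
  by rewrite lerDl (ltW aQ).
have Yn := upper _ p (long_block_iid (ltnSn m) gp) (long_block_ident (ltnSn m) gp).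
have Zn := upper _ g (short_block_iid (ltnSn m) gp) (short_block_ident p (ltnSn m)).
have Xn := psum_negligible (divr_gt0 h0 (ltr0Sn R q)).
apply: null_set_sub (null_setU Yn (null_setU Zn Xn)) => w /= nw.
apply: contrapT => /not_orP[/contrapT[N1 hN1] /not_orP[/contrapT[N2 hN2] /contrapT[N3 hN3]]].
apply: nw; exists ((maxn N1 (maxn N2 N3)).+1 * q)%N => n Nn.
have nE := divn_eq n q; set N := (n %/ q)%N in nE; set r := (n %% q)%N in nE.
have rq : (r < q)%N by rewrite ltn_mod.
have NN : (maxn N1 (maxn N2 N3) <= N)%N by rewrite ltnW// leq_divRL.
move: NN; rewrite !geq_max => /and3P[/hN1 hY /hN2 hZ N3N].
have Nqn : (N * q <= n)%N by rewrite nE leq_addr.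
have lNn := lilq N n q0 Nqn.
have lN0 := lil_ge0 R N; have ln0 := lil_ge0 R n.
have hX : \sum_(0 <= l < r) X (N * q + 1 + l)%N w <= eta * lil R n.
  apply: (@le_trans _ _ (\sum_(0 <= l < r) eta / q.+1%:R * lil R n)).
    rewrite big_nat [leRHS]big_nat; apply: ler_sum => l /andP[_ lr].
    have l1 : (N3 <= N * q + 1 + l)%N.
      by rewrite -addnA (leq_trans N3N)// (leq_trans (leq_pmulr _ q0))// leq_addr.
    rewrite (le_trans (ler_norm _))// (le_trans (hN3 _ l1))//.
    apply: ler_wpM2l; first by rewrite divr_ge0// ltW.
    by apply: lil_mono; rewrite nE -addnA leq_add2l add1n.
  rewrite sumr_const_nat subn0 -[_ *+ r]mulr_natr mulrAC.
  rewrite ler_wpM2r// mulrAC ler_pdivrMr// ler_wpM2l ?(ltW h0)//.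
  by rewrite ler_nat ltnW// ltnW.
rewrite [in psum X n]nE /q psum_decomp -/q etaE.
have hYn : (al p + eta * Q + eta * Q) * lil R N <= (sigma + 3 * eta) * lil R n.
  apply: (@le_trans _ _ ((sigma + 3 * eta) * (Q * lil R N))).
    by rewrite mulrA ler_wpM2r//; lra.
  by rewrite ler_wpM2l//; lra.
have hZn : (al g + eta * Q + eta * Q) * lil R N <= (3 * eta) * lil R n.
  apply: (@le_trans _ _ ((3 * eta) * (Q * lil R N))).
    by rewrite mulrA ler_wpM2r//; lra.
  by rewrite ler_wpM2l//; lra.
have := lerD (le_trans hY hYn) (lerD (le_trans hZ hZn) hX).
by move/le_trans; apply; rewrite -!mulrDl ler_wpM2r//; lra.
Qed.

(** A lower bound for the limit superior needs the times N q only, so no incomplete block appears;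
    the short blocks are bounded from below by the upper half for their negatives. *)
Lemma psum_lower (sigma eps : R) :
  be n / Num.sqrt n%:R @[n --> \oo] --> sigma -> 0 <= sigma -> 0 < eps ->
  null_set [set w | exists N0, forall n, (N0 <= n)%N ->
    psum X n w <= (sigma - eps) * lil R n].
Proof.
(* The budget of 8 eta: three for the short blocks, one for [lil_ratio], two for be p against sigma
   sqrt q, one for taking r below be p, one for [iid_lower]. *)
move=> bec sg0 e0; have [eta etaE] : exists eta, eps = 8 * eta.
  by exists (eps / 8); field.
have h0 : 0 < eta by lra.
have [K1 hK1] : exists K, forall n, (K <= n)%N -> sigma - eta <= be n / Num.sqrt n%:R.
  have : \forall n \near \oo, sigma - eta <= be n / Num.sqrt n%:R.
    by apply: (cvgr_ge sigma) => //; lra.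
  by move=> [K _ hK]; exists K => n; exact: hK.
have [K2 hK2] := sqrt_natr_ge (al m.+1 / eta).
pose g := m.+1; have [K3 hK3] := sqrt_natr_ge (sigma * Num.sqrt g%:R / eta).
pose p := maxn (maxn g K3) (maxn K1 K2); pose q := (p + g)%N.
have gp : (g <= p)%N by rewrite !leq_max leqnn.
have q0 : (0 < q)%N by rewrite addn_gt0 orbT.
have p0 : (0 < p)%N by rewrite (leq_trans _ gp).
have Q0 : 0 < Num.sqrt q%:R :> R by rewrite sqrtr_gt0 ltr0n.
have P0 : 0 < Num.sqrt p%:R :> R by rewrite sqrtr_gt0 ltr0n.
have PQ : Num.sqrt p%:R <= Num.sqrt q%:R :> R by rewrite ler_wsqrtr// ler_nat leq_addr.
have QP : Num.sqrt q%:R <= Num.sqrt p%:R + Num.sqrt g%:R :> R.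
  rewrite -(@ler_pXn2r _ 2) ?nnegrE ?addr_ge0// sqrrD !sqr_sqrtr//.
  rewrite /q natrD -addrA lerD2l lerDr.
  by rewrite mulrn_wge0// mulr_ge0.
have sgQ : sigma * Num.sqrt g%:R <= eta * Num.sqrt q%:R.
  rewrite mulrC [leRHS]mulrC -ler_pdivrMr// mulrC hK3// /q (leq_trans _ (leq_addr _ _))//.
  by rewrite /p !leq_max leqnn !orbT.
have bep : (sigma - 2 * eta) * Num.sqrt q%:R <= be p.
  have : (sigma - eta) * Num.sqrt p%:R <= be p.
    by rewrite -ler_pdivlMr// hK1// /p !leq_max leqnn !orbT.
  have := ler_wpM2l sg0 QP; have := ler_wpM2l (ltW h0) PQ; lra.
have alg : al g <= eta * Num.sqrt q%:R.
  rewrite mulrC -ler_pdivrMr// hK2// /q (leq_trans _ (leq_addr _ _))//.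
  by rewrite /p !leq_max leqnn !orbT.
have d0 : 0 < eta / (sigma + eta + eta) by rewrite divr_gt0//; lra.
have d1 : eta / (sigma + eta + eta) < 1 by rewrite ltr_pdivrMr; lra.
have [K4 hK4] := @lil_ratio R _ q d0 d1 q0.
have sd : sigma * (eta / (sigma + eta + eta)) <= eta.
  rewrite mulrCA ler_piMr ?(ltW h0)// ler_pdivrMr; lra.
move: (eta / _) d0 d1 sd hK4 => de d0 d1 sd hK4.
have lilq N := @lil_div R N q (N * q) q0 (leqnn _).
move: (Num.sqrt q%:R) Q0 PQ QP sgQ bep alg hK4 lilq => Q Q0 PQ QP sgQ bep alg hK4 lilq.
have aQ : 0 < eta * Q by rewrite mulr_gt0.
have [alp0 _] := al_moment2 p; have [alg0 _] := al_moment2 g.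
have Wk := long_block_ident (ltnSn m) gp; have Zk := short_block_ident p (ltnSn m).
have Wi := long_block_iid (ltnSn m) gp; have Zi := short_block_iid (ltnSn m) gp.
(* When positive, r is strictly below the least lower norm, so a finite clipping level realizes it;
   when it is 0, any level does. *)
pose r := Num.max 0 (be p - eta * Q).
have r0 : 0 <= r by rewrite le_max lexx.
have rQ : (sigma - 3 * eta) * Q <= r by rewrite /r le_max; apply/orP; right; lra.
have [b b0 hb] : exists2 b, 0 < b &
    r ^+ 2 <= - expect (fun w => - clip b (block X (p + g) 0 p 0 w) ^+ 2).
  suff [b b0 hb] : exists2 b, 0 < b & r ^+ 2 <= - expect (fun w => - clip b (psum X p w) ^+ 2).
    by exists b => //; rewrite (Wk _ (lipN (clip_sq_lip (ltW b0))) (bddN (clip_sq_bdd (ltW b0)))).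
  have [rE|rE] := leP (be p - eta * Q) 0.
    exists 1 => //; rewrite /r max_l// expr0n oppr_ge0 -[leRHS](expect_cst 0).
    apply: (expect_le (bdd_rvN (bdd_clip_sq ler01 (psum_rv p))) (bdd_rv_cst 0)).
    by move=> w; rewrite oppr_le0 sqr_ge0.
  apply: (lmoment2_witness (psum_rv p) (@be_least p) r0).
  by rewrite /r max_r ?(ltW rE)// ltrBlDr ltrDl.
have s0 : 0 < al p + 1 by rewrite ltr_wpDl.
have Yn := iid_lower Wi (centered_ident Wk (psum_centered p))
  (moment2_le_ident Wk (moment2_le_trans _ (al_moment2 p))) s0
  (tail_cond_ident Wk (psum_tail_cond p)) r0 b0 hb aQ.
have {}Yn := Yn (ltW (ltr_pwDr ltr01 (lexx _))).
have sZ0 : 0 < al g + eta * Q by rewrite ltr_wpDl.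
have Zn := iid_upper (iid_seqN Zi) (centeredN (centered_ident Zk (psum_centered g)))
  (moment2_leN (moment2_le_ident Zk (moment2_le_trans _ (al_moment2 g)))) sZ0
  (tail_condN (tail_cond_ident Zk (psum_tail_cond g))) (divr_gt0 aQ sZ0).
have {}Zn := Zn (ltW (ltr_pwDr aQ (lexx _))).
rewrite mulrDl mul1r mulfVK ?gt_eqF// in Zn.
apply: null_set_sub (null_setU Yn Zn) => w /= [N0 hw].
apply: contrapT => /not_orP[hY /contrapT[N1 hZ]].
apply: hY; exists (maxn N0 (maxn N1 K4)) => N; rewrite !geq_max => /and3P[NN /hZ {}hZ /hK4 ratio].
have Nq : (N0 <= N * q)%N by rewrite (leq_trans NN)// leq_pmulr.
have := hw _ Nq; rewrite psum_blocks => hs.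
have lN0 := lil_ge0 R N; have ln0 := lil_ge0 R (N * q).
rewrite sumrN in hZ.
move: (\sum_(0 <= i < N) _) (\sum_(0 <= i < N) _) hs hZ => y z hs hZ.
have := lilq N; move: (lil R N) (lil R (N * q)) lN0 ln0 ratio hs hZ => u v u0 v0 ratio hs hZ uv.
have h1 : (al g + eta * Q + eta * Q) * u <= 3 * eta * v.
  apply: (@le_trans _ _ ((3 * eta) * (Q * u))).
    by rewrite mulrA ler_wpM2r//; lra.
  by rewrite ler_wpM2l//; lra.
have h2 : (sigma - 4 * eta) * Q * u <= (r - eta * Q) * u.
  by rewrite ler_wpM2r//; lra.
have h3 := ler_wpM2l (ltW h0) uv.
have h4 := ler_wpM2l sg0 ratio.
have h5 := ler_wpM2r v0 sd.
by rewrite etaE in hs; lra.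
Qed.

End Norms.

Lemma sqr_norm_cvg (u : nat -> R) (f : nat -> \bar R) (sigma : R) :
  (forall n, f n = (u n ^+ 2)%:E) ->
  u n / Num.sqrt n%:R @[n --> \oo] --> sigma ->
  (f n * (n%:R^-1)%:E)%E @[n --> \oo] --> (sigma ^+ 2)%:E.
Proof.
move=> fu uc.
(* The equality includes n = 0, where both inverses are 0. *)
rewrite (_ : (fun n => _) = fun n => ((u n / Num.sqrt n%:R) ^+ 2)%:E); last first.
  by apply/funext => n; rewrite fu -EFinM exprMn exprVn sqr_sqrtr.
apply: cvg_EFin; first by near=> n.
rewrite (_ : (fine \o _) = fun n => (u n / Num.sqrt n%:R) * (u n / Num.sqrt n%:R)).
  by rewrite expr2; exact: cvgM.
by apply/funext => n; rewrite /= expr2.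
Unshelve. all: by end_near. Qed.

Lemma lil_stationary : exists sigma_lo sigma_up : R,
  [/\ 0 <= sigma_lo, sigma_lo <= sigma_up,
      (trunc_expect E (fun w => (psum X n w ^+ 2)%R) * (n%:R^-1)%:E)%E
        @[n --> \oo] --> (sigma_up ^+ 2)%:E,
      (trunc_cexpect E (fun w => (psum X n w ^+ 2)%R) * (n%:R^-1)%:E)%E
        @[n --> \oo] --> (sigma_lo ^+ 2)%:E
    & null_set [set w | ~ (sigma_lo%:E <= limsup_lil X w <= sigma_up%:E)%E]].
Proof.
have [al [be h]] := psum_norms.
have al_m n : moment2_le (psum X n) (al n) by have [[]] := h n.
have al_l n t : moment2_le (psum X n) t -> al n <= t.
  by have [[_ hl _] _] := h n; exact: hl.
have be_m n : lmoment2_le (psum X n) (be n) by have [_ []] := h n.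
have be_l n t : lmoment2_le (psum X n) t -> be n <= t.
  by have [_ [_ hl _ _]] := h n; exact: hl.
have [su su0 alc] := upper_norm_cvg al_m al_l.
have [sl sl0 bec] := lower_norm_cvg al_m be_m be_l.
exists sl, su; split => //.
- apply: ler_cvg_to bec alc _; apply: nearW => n.
  by rewrite ler_wpM2r ?invr_ge0//; have [_ []] := h n.
- by apply: sqr_norm_cvg alc => n; have [[]] := h n.
- by apply: sqr_norm_cvg bec => n; have [_ []] := h n.
have inv_gt0 j : 0 < j.+1%:R^-1 :> R by rewrite invr_gt0.
(* Errors 1 / (j + 1) suffice, so that the exceptional sets form a countable union. *)
have bad j := null_setU (psum_upper al_m alc su0 (inv_gt0 j))
  (psum_lower al_m be_l bec sl0 (inv_gt0 j)).
apply: null_set_sub (null_set_bigcup bad) => w /= hw.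
apply: contrapT => nw; apply: hw; apply/andP.
have inv_small (eps : R) : 0 < eps -> exists j : nat, j.+1%:R^-1 <= eps.
  move=> e0; have [K hK] := natr_ge eps^-1; exists K.
  by rewrite invf_ple ?posrE// hK.
have lN n := lil_ge0 R n.
split.
- apply: limsup_lil_ge => eps /inv_small[j je] [N0 hN0]; apply: nw.
  exists j => //; right; exists N0 => n /hN0 /le_trans; apply.
  by rewrite ler_wpM2r// lerB.
- apply: limsup_lil_le => eps /inv_small[j je].
  have [[N0 hN0]|no] := pselect (exists N0, forall n, (N0 <= n)%N ->
      psum X n w <= (su + j.+1%:R^-1) * lil R n); last by exfalso; apply: nw; exists j => //; left.
  exists N0 => n /hN0 /le_trans; apply.
  by rewrite ler_wpM2r// lerD.
Qed.

End PartialSums.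

End RealExpectation.

Theorem theorem3p2 (R : realType) (d : measure_display) (T : measurableType d)
    (H : set (T -> R)) (E : (T -> R) -> \bar R) (V : set T -> R)
    (m : nat) (X : nat -> T -> R)
    (H_space : random_variable_space H)
    (E_sublinear : sublinear_expectation H E)
    (V_capacity : subadditive_capacity V)
    (V_compatible : capacity_compatible H E V)
    (X_in_H : forall n, (1 <= n)%N -> H (X n))
    (X_mdep : m_dependent E m X)
    (X_stat : stationary E X)
    (X_mean_exists : has_trunc_expect E (X 1%N))
    (X_cmean_exists : has_trunc_expect E (fun w => - X 1%N w))
    (X_mean : trunc_expect E (X 1%N) = 0%E)
    (X_cmean : trunc_cexpect E (X 1%N) = 0%E)
    (X_var : (trunc_expect E (fun w => (X 1%N w ^+ 2)%R) < +oo)%E)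
    (X_choquet :
      (choquet V (fun w => (X 1%N w ^+ 2 / logp (logp `|X 1%N w|))%R) < +oo)%E) :
  exists sigma_lo sigma_up : R,
    [/\ 0 <= sigma_lo,
        sigma_lo <= sigma_up,
        (trunc_expect E (fun w => (psum X n w ^+ 2)%R) * (n%:R^-1)%:E)%E
          @[n --> \oo] --> (sigma_up ^+ 2)%:E,
        (trunc_cexpect E (fun w => (psum X n w ^+ 2)%R) * (n%:R^-1)%:E)%E
          @[n --> \oo] --> (sigma_lo ^+ 2)%:E
      & hatcVstar H E
          [set w | ((sigma_lo%:E <= limsup_lil X w) &&
                    (limsup_lil X w <= sigma_up%:E))%E] = 1%E].
Proof.
have Xt := tail_cond_choquet H_space E_sublinear V_capacity V_compatible
  (X_in_H 1%N isT) X_choquet.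
have Xc := centered_of_trunc H_space E_sublinear (X_in_H 1%N isT)
  X_mean_exists X_cmean_exists X_mean X_cmean.
have [s [Xm _ _]] := moment2_optimal H_space E_sublinear (X_in_H 1%N isT) X_var.
have [lo [up [lo0 loup upc loc Hnull]]] := lil_stationary H_space E_sublinear
  X_in_H X_mdep X_stat Xc Xm Xt.
exists lo, up; split => //; rewrite /hatcVstar.
by rewrite (_ : hatVstar H E _ = 0%E) ?sube0.
Qed.
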